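(* Let $\mathfrak g=\mathfrak{pe}(n)$, let $\lambda,\gamma\in\mathfrak h^*$ be integral weights, and let $\Delta(\gamma)\to\Delta(\lambda)$ be a non-zero homomorphism (it is injective; write $\Delta(\lambda)/\Delta(\gamma)$ for its cokernel). Let $\mu$ be a dominant integral weight and $x,y\in W$ with $x<y$ in the Bruhat order such that $\lambda=x\cdot\mu$ and $\gamma=y\cdot\mu$. Let $n_{x,y,z}$ ($z\in W$) be the non-negative integers such that $$\mathrm{soc}\big(\Delta_{\bar 0}(x\cdot\mu)/\Delta_{\bar 0}(y\cdot\mu)\big)\cong\bigoplus_{z\in W}L_{\bar 0}(z\cdot\mu)^{\oplus n_{x,y,z}}.$$ Then $$\mathrm{soc}\big(\Delta(\lambda)/\Delta(\gamma)\big)\cong\bigoplus_{z\in W}L\big((z\cdot\mu)^++\eta\big)^{\oplus n_{x,y,z}}.$$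
   Context: Everything is over $\mathbb C$; modules are supermodules and parities are not tracked. The periplectic Lie superalgebra $\mathfrak{pe}(n)\subset\mathfrak{gl}(n|n)$ consists of the block matrices $\begin{pmatrix}A&B\\ C&-A^t\end{pmatrix}$ with $A,B,C\in\mathbb C^{n\times n}$, $B^t=B$, $C^t=-C$, with the super commutator; $\mathfrak g_{\bar 0}\cong\mathfrak{gl}(n)$ is the subalgebra $B=C=0$, $\mathfrak g_1$ is given by $A=C=0$ and $\mathfrak g_{-1}$ by $A=B=0$. $\mathfrak h$ is the subalgebra of diagonal matrices, with basis $H_i=E_{i,i}-E_{n+i,n+i}$ ($1\le i\le n$) and dual basis $\epsilon_1,\dots,\epsilon_n$ of $\mathfrak h^*$. $\mathfrak b_{\bar0}$ is the Borel subalgebra of $\mathfrak g_{\bar 0}$ given by upper triangular $A$; $\mathfrak b=\mathfrak b_{\bar 0}\oplus\mathfrak g_1$, and the reverse Borel subalgebra is $\mathfrak b^r=\mathfrak b_{\bar 0}\oplus\mathfrak g_{-1}$. $\Delta_{\bar 0}(\lambda)=U(\mathfrak g_{\bar 0})\otimes_{U(\mathfrak b_{\bar 0})}\mathbb C_\lambda$ and $\Delta(\lambda)=U(\mathfrak g)\otimes_{U(\mathfrak b)}\mathbb C_\lambda$ are the Verma modules with simple quotients $L_{\bar 0}(\lambda)$ and $L(\lambda)$. $\Delta_{\bar 0}(x\cdot\mu)/\Delta_{\bar 0}(y\cdot\mu)$ denotes the cokernel of the (unique up to scalar) embedding of Verma modules over $\mathfrak g_{\bar 0}$. $L^r(\lambda)$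 is the simple highest weight $\mathfrak g$-module of $\mathfrak b^r$-highest weight $\lambda$, and $\lambda^+\in\mathfrak h^*$ is the weight uniquely determined by $L(\lambda^+)=L^r(\lambda)$. Put $\eta=(1-n)(\epsilon_1+\cdots+\epsilon_n)$ (the weight of $\Lambda^{\mathrm{top}}\mathfrak g_{-1}$). $W=\mathfrak S_n$ is the Weyl group of $\mathfrak g_{\bar 0}$, $w\cdot\lambda=w(\lambda+\rho_{\bar 0})-\rho_{\bar 0}$ with $\rho_{\bar 0}$ the half-sum of positive even roots. A weight is integral if $\langle\lambda,\alpha^\vee\rangle\in\mathbb Z$ for all even roots $\alpha$; an integral weight $\mu$ is dominant if $\langle\mu+\rho_{\bar 0},\alpha^\vee\rangle\ge 0$ for all positive even roots $\alpha$. If $\mu$ is singular the indexing of the summands $L_{\bar 0}(z\cdot\mu)$ by $z\in W$ is redundant, and any choice of the integers $n_{x,y,z}$ satisfying the displayed decomposition is allowed. *)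

(* Defs.v *)
From HB Require Import structures.
From mathcomp Require Import all_boot all_order all_algebra all_fingroup.
From mathcomp Require Import boolp classical_sets reals complex.

Set Implicit Arguments.
Unset Strict Implicit.
Unset Printing Implicit Defensive.

Import Order.TTheory GRing.Theory Num.Theory.
Local Open Scope quotient_scope.
Local Open Scope classical_set_scope.
Local Open Scope ring_scope.

Section LieSuperalgebras.
Variables (C : numClosedFieldType) (n : nat).
Implicit Types (X Y : 'M[C]_(n + n)) (a b : bool).

(* Parities are booleans, with true for odd. *)
Definition hpart a X : 'M[C]_(n + n) :=
  if a then block_mx 0 (ursubmx X) (dlsubmx X) 0
  else block_mx (ulsubmx X) 0 0 (drsubmx X).

Definition homog a X := hpart a X = X.

(* The super commutator of X, homogeneous of parity a, and Y, homogeneous of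
   parity b. *)
Definition sbracket a b X Y : 'M[C]_(n + n) :=
  X *m Y - (-1) ^+ (a && b) *: (Y *m X).

Record lieSub := LieSub {
  lie_set :> set 'M[C]_(n + n);
  lie_sub0 : lie_set 0;
  lie_subP : forall (c : C) X Y,
    lie_set X -> lie_set Y -> lie_set (c *: X + Y);
  lie_hpart : forall a X, lie_set X -> lie_set (hpart a X);
  lie_bracket : forall a b X Y, homog a X -> homog b Y ->
    lie_set X -> lie_set Y -> lie_set (sbracket a b X Y) }.

Lemma hpart_is_linear a : linear (hpart a).
Proof.
by move=> c X Y; rewrite /hpart /ulsubmx /ursubmx /dlsubmx /drsubmx; case: a;
  rewrite scale_block_mx add_block_mx !scaler0 !addr0 !linearP.
Qed.

Lemma hpart_id a X : homog a (hpart a X).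
Proof.
by rewrite /homog /hpart; case: a;
  rewrite ?block_mxKul ?block_mxKur ?block_mxKdl ?block_mxKdr.
Qed.

Lemma hpart_other a X : homog a X -> hpart (~~ a) X = 0.
Proof.
move=> <-; rewrite /hpart; case: a;
  by rewrite /= ?block_mxKul ?block_mxKur ?block_mxKdl ?block_mxKdr -block_mx0.
Qed.

Lemma homog_eq0 X : homog false X -> homog true X -> X = 0.
Proof. by move=> hX /hpart_other <-. Qed.

Lemma hpart_sum X : hpart false X + hpart true X = X.
Proof.
by rewrite /hpart add_block_mx !addr0 !add0r submxK.
Qed.

Lemma homog_bracket a b X Y :
  homog a X -> homog b Y -> homog (a (+) b) (sbracket a b X Y).
Proof.
move=> <- <-; rewrite /homog /hpart /sbracket; case: a; case: b => /=;
  rewrite !mulmx_block !mul0mx !mulmx0 ?addr0 ?add0r scale_block_mx opp_block_mx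
    add_block_mx ?scaler0 ?oppr0 ?addr0
    ?block_mxKul ?block_mxKur ?block_mxKdl ?block_mxKdr //.
Qed.

Section Supermodules.
Variable g : lieSub.

(* A g-supermodule. The grading M = M_0 (+) M_1 is recorded by the involution
   smod_par acting as (-1)^i on M_i. *)
Record smod := SMod {
  smod_car :> lmodType C;
  smod_par : smod_car -> smod_car;
  smod_act : set_type g -> smod_car -> smod_car;
  smod_par_linear : linear smod_par;
  smod_parK : involutive smod_par;
  smod_act_linear : forall x, linear (smod_act x);
  smod_actP : forall (c : C) (x y z : set_type g) v,
    val z = c *: val x + val y ->
    smod_act z v = c *: smod_act x v + smod_act y v;
  smod_act_par : forall a (x : set_type g) v, homog a (val x) ->
    smod_par (smod_act x v) = (-1) ^+ a *: smod_act x (smod_par v);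
  smod_act_bracket : forall a b (x y z : set_type g) v,
    homog a (val x) -> homog b (val y) ->
    val z = sbracket a b (val x) (val y) ->
    smod_act z v = smod_act x (smod_act y v)
                   - (-1) ^+ (a && b) *: smod_act y (smod_act x v) }.

(* Even homomorphisms. An odd homomorphism f : M -> N, with the usual rule
   f (x v) = (-1)^|x| x (f v), amounts to an even one v |-> f (smod_par v) from
   pshift true M to N. *)
Record shom (M N : smod) := SHom {
  shom_map :> M -> N;
  shom_linear : linear shom_map;
  shom_act : forall x v, shom_map (smod_act x v) = smod_act x (shom_map v);
  shom_par : forall v, shom_map (smod_par v) = smod_par (shom_map v) }.

Record submod (M : smod) := SubMod {
  sub_set :> M -> Prop;
  sub0 : sub_set 0;
  subP : forall (c : C) u v, sub_set u -> sub_set v -> sub_set (c *: u + v);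
  sub_par : forall v, sub_set v -> sub_set (smod_par v);
  sub_act : forall x v, sub_set v -> sub_set (smod_act x v) }.

Lemma linear_fun0 (U V : lmodType C) (f : U -> V) : linear f -> f 0 = 0.
Proof. by move=> lf; have := lf (-1) 0 0; rewrite scaler0 addr0 scaleN1r addNr. Qed.

Lemma linear_funZ (U V : lmodType C) (f : U -> V) c u :
  linear f -> f (c *: u) = c *: f u.
Proof. by move=> lf; rewrite -[c *: u]addr0 lf (linear_fun0 lf) addr0. Qed.

Lemma linear_funD (U V : lmodType C) (f : U -> V) u v :
  linear f -> f (u + v) = f u + f v.
Proof. by move=> lf; rewrite -{1}[u]scale1r lf scale1r. Qed.

Lemma linear_funB (U V : lmodType C) (f : U -> V) u v :
  linear f -> f u - f v = f (u - v).
Proof. by move=> lf; rewrite addrC -scaleN1r -lf scaleN1r addrC. Qed.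

Section Generated.
Variables (M : smod) (A : set M).

Definition gen_set : set M := [set v | forall N : submod M, A `<=` sub_set N -> N v].

Lemma gen_set0 : gen_set 0. Proof. by move=> N _; apply: sub0. Qed.
Lemma gen_setP (c : C) u v : gen_set u -> gen_set v -> gen_set (c *: u + v).
Proof. by move=> hu hv N hN; apply: subP; [apply: hu | apply: hv]. Qed.
Lemma gen_set_par v : gen_set v -> gen_set (smod_par v).
Proof. by move=> hv N hN; apply/sub_par/hv. Qed.
Lemma gen_set_act x v : gen_set v -> gen_set (smod_act x v).
Proof. by move=> hv N hN; apply/sub_act/hv. Qed.

Definition gen_submod := SubMod gen_set0 gen_setP gen_set_par gen_set_act.
End Generated.

Section Image.
Variables (M N : smod) (f : shom M N).

Lemma im_set0 : range f 0.
Proof. by exists 0 => //; apply/linear_fun0/shom_linear. Qed.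
Lemma im_setP (c : C) u v : range f u -> range f v -> range f (c *: u + v).
Proof. by move=> [u' _ <-] [v' _ <-]; exists (c *: u' + v'); rewrite ?shom_linear. Qed.
Lemma im_set_par v : range f v -> range f (smod_par v).
Proof. by move=> [v' _ <-]; exists (smod_par v'); rewrite ?shom_par. Qed.
Lemma im_set_act x v : range f v -> range f (smod_act x v).
Proof. by move=> [v' _ <-]; exists (smod_act x v'); rewrite ?shom_act. Qed.

Definition im_submod := SubMod im_set0 im_setP im_set_par im_set_act.
End Image.

Section Quotient.
Variables (M : smod) (N : submod M).

Definition quo_rel (u v : M) : bool := `[< N (u - v) >].

Lemma subN v : N v -> N (- v).
Proof. by move=> hv; rewrite -scaleN1r -[_ *: _]addr0; apply: subP hv (sub0 N). Qed.
Lemma subD u v : N u -> N v -> N (u + v).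
Proof. by move=> hu hv; rewrite -[u]scale1r; apply: subP. Qed.

Lemma quo_rel_refl : reflexive quo_rel.
Proof. by move=> u; apply/asboolP; rewrite subrr; apply: sub0. Qed.
Lemma quo_rel_sym : symmetric quo_rel.
Proof. by move=> u v; apply/asboolP/asboolP => /subN; rewrite opprB. Qed.
Lemma quo_rel_trans : transitive quo_rel.
Proof.
move=> v u w /asboolP huv /asboolP hvw; apply/asboolP.
by have := subD huv hvw; rewrite addrA subrK.
Qed.

Canonical quo_equiv := EquivRel quo_rel quo_rel_refl quo_rel_sym quo_rel_trans.

Definition quo_type : Type := {eq_quot quo_equiv}.
HB.instance Definition _ := Choice.on quo_type.

Definition quo_pi (u : M) : quo_type := \pi_{eq_quot quo_equiv} u.
Definition quo_repr (q : quo_type) : M := generic_quotient.repr (q : {eq_quot quo_equiv}).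

Lemma quo_reprK : cancel quo_repr quo_pi.
Proof. exact: reprK. Qed.
Lemma quo_piP u v : quo_pi u = quo_pi v <-> N (u - v).
Proof. by split=> [/eqmodP/asboolP|?]; [| apply/eqmodP/asboolP]. Qed.
Lemma quo_repr_pi u : N (quo_repr (quo_pi u) - u).
Proof. by apply/quo_piP; rewrite quo_reprK. Qed.

Definition quo_add p q := quo_pi (quo_repr p + quo_repr q).
Definition quo_opp p := quo_pi (- quo_repr p).
Definition quo_scale (c : C) p := quo_pi (c *: quo_repr p).

Lemma quo_addE u v : quo_add (quo_pi u) (quo_pi v) = quo_pi (u + v).
Proof. by apply/quo_piP; rewrite opprD addrACA; apply: subD; apply: quo_repr_pi. Qed.
Lemma quo_oppE u : quo_opp (quo_pi u) = quo_pi (- u).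
Proof. by apply/quo_piP; rewrite -opprD; apply/subN/quo_repr_pi. Qed.
Lemma quo_scaleE c u : quo_scale c (quo_pi u) = quo_pi (c *: u).
Proof.
apply/quo_piP; rewrite -scalerBr -[_ *: _]addr0.
exact: subP (quo_repr_pi u) (sub0 N).
Qed.

Lemma quo_ind (P : quo_type -> Prop) : (forall u, P (quo_pi u)) -> forall q, P q.
Proof. by move=> hP q; rewrite -(quo_reprK q). Qed.

Lemma quo_addA : associative quo_add.
Proof.
by elim/quo_ind=> u; elim/quo_ind=> v; elim/quo_ind=> w; rewrite !quo_addE addrA.
Qed.
Lemma quo_addC : commutative quo_add.
Proof. by elim/quo_ind=> u; elim/quo_ind=> v; rewrite !quo_addE addrC. Qed.
Lemma quo_add0 : left_id (quo_pi 0) quo_add.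
Proof. by elim/quo_ind=> u; rewrite quo_addE add0r. Qed.
Lemma quo_addN : left_inverse (quo_pi 0) quo_opp quo_add.
Proof. by elim/quo_ind=> u; rewrite quo_oppE quo_addE addNr. Qed.

HB.instance Definition _ :=
  GRing.isZmodule.Build quo_type quo_addA quo_addC quo_add0 quo_addN.

Lemma quo_piD u v : quo_pi (u + v) = quo_pi u + quo_pi v.
Proof. by rewrite -quo_addE. Qed.

Lemma quo_scaleA c d q : quo_scale c (quo_scale d q) = quo_scale (c * d) q.
Proof. by elim/quo_ind: q => u; rewrite !quo_scaleE scalerA. Qed.
Lemma quo_scale1 : left_id 1 quo_scale.
Proof. by elim/quo_ind=> u; rewrite quo_scaleE scale1r. Qed.
Lemma quo_scaleDr : right_distributive quo_scale +%R.
Proof.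
by move=> c; elim/quo_ind=> u; elim/quo_ind=> v;
  rewrite -quo_piD !quo_scaleE -quo_piD scalerDr.
Qed.
Lemma quo_scaleDl q : {morph quo_scale^~ q : c d / c + d}.
Proof. by elim/quo_ind: q => u c d; rewrite !quo_scaleE -quo_piD scalerDl. Qed.

HB.instance Definition _ := GRing.Zmodule_isLmodule.Build C quo_type
  quo_scaleA quo_scale1 quo_scaleDr quo_scaleDl.

Lemma quo_pi_linear : linear (quo_pi : M -> quo_type).
Proof. by move=> c u v; rewrite quo_piD -quo_scaleE. Qed.

Definition quo_par (q : quo_type) : quo_type := quo_pi (smod_par (quo_repr q)).
Definition quo_act x (q : quo_type) : quo_type := quo_pi (smod_act x (quo_repr q)).

Lemma quo_parE u : quo_par (quo_pi u) = quo_pi (smod_par u).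
Proof.
apply/quo_piP; rewrite (linear_funB _ _ (@smod_par_linear M)).
exact/sub_par/quo_repr_pi.
Qed.
Lemma quo_actE x u : quo_act x (quo_pi u) = quo_pi (smod_act x u).
Proof.
apply/quo_piP; rewrite (linear_funB _ _ (@smod_act_linear M x)).
exact/sub_act/quo_repr_pi.
Qed.

Lemma quo_par_linear : linear quo_par.
Proof.
move=> c; elim/quo_ind=> u; elim/quo_ind=> v.
by rewrite -quo_pi_linear !quo_parE -quo_pi_linear smod_par_linear.
Qed.
Lemma quo_parK : involutive quo_par.
Proof. by elim/quo_ind=> u; rewrite !quo_parE smod_parK. Qed.
Lemma quo_act_linear x : linear (quo_act x).
Proof.
move=> c; elim/quo_ind=> u; elim/quo_ind=> v.
by rewrite -quo_pi_linear !quo_actE -quo_pi_linear smod_act_linear.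
Qed.
Lemma quo_actP (c : C) (x y z : set_type g) q :
  val z = c *: val x + val y -> quo_act z q = c *: quo_act x q + quo_act y q.
Proof.
move=> hz; elim/quo_ind: q => u.
by rewrite !quo_actE -quo_pi_linear (smod_actP _ hz).
Qed.
Lemma quo_act_par a (x : set_type g) q : homog a (val x) ->
  quo_par (quo_act x q) = (-1) ^+ a *: quo_act x (quo_par q).
Proof.
move=> hx; elim/quo_ind: q => u.
by rewrite quo_parE !quo_actE quo_parE (smod_act_par _ hx)
  (linear_funZ _ _ quo_pi_linear).
Qed.
Lemma quo_act_bracket a b (x y z : set_type g) q :
    homog a (val x) -> homog b (val y) ->
    val z = sbracket a b (val x) (val y) ->
  quo_act z q = quo_act x (quo_act y q)
                - (-1) ^+ (a && b) *: quo_act y (quo_act x q).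
Proof.
move=> hx hy hz; elim/quo_ind: q => u.
rewrite !quo_actE -(linear_funZ _ _ quo_pi_linear).
by rewrite (linear_funB _ _ quo_pi_linear) (smod_act_bracket _ hx hy hz).
Qed.

Definition quo : smod := SMod quo_par_linear quo_parK quo_act_linear
  quo_actP quo_act_par quo_act_bracket.
End Quotient.

Definition coker (M N : smod) (f : shom M N) : smod := quo (im_submod f).

Section ParityShift.
Variables (a : bool) (M : smod).

Definition pshift_par (v : M) : M := (-1) ^+ a *: smod_par v.

Lemma pshift_par_linear : linear pshift_par.
Proof.
by move=> c u v; rewrite /pshift_par smod_par_linear scalerDr !scalerA [_ * c]mulrC.
Qed.
Lemma pshift_parK : involutive pshift_par.
Proof.
move=> v; rewrite /pshift_par (linear_funZ _ _ (@smod_par_linear M)) smod_parK.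
by rewrite scalerA -signr_addb addbb scale1r.
Qed.
Lemma pshift_act_par b (x : set_type g) v : homog b (val x) ->
  pshift_par (smod_act x v) = (-1) ^+ b *: smod_act x (pshift_par v).
Proof.
move=> hx; rewrite /pshift_par (smod_act_par _ hx).
by rewrite (linear_funZ _ _ (@smod_act_linear M x)) !scalerA mulrC.
Qed.

(* M for a = false, its parity shift for a = true. Some authors let x act on the
   shifted module by (-1)^|x| x instead; smod_par intertwines the two. *)
Definition pshift : smod := SMod pshift_par_linear pshift_parK
  (@smod_act_linear M) (@smod_actP M) pshift_act_par (@smod_act_bracket M).
End ParityShift.

Section DirectSum.
Variables (I : finType) (F : I -> smod).

Definition dsum_type : Type := forall i, F i.
HB.instance Definition _ := gen_eqMixin dsum_type.
HB.instance Definition _ := gen_choiceMixin dsum_type.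

Definition dsum_add (u v : dsum_type) : dsum_type := fun i => u i + v i.
Definition dsum_opp (u : dsum_type) : dsum_type := fun i => - u i.
Definition dsum_scale (c : C) (u : dsum_type) : dsum_type := fun i => c *: u i.
Definition dsum_zero : dsum_type := fun=> 0.

Lemma dsum_addA : associative dsum_add.
Proof. by move=> u v w; apply: functional_extensionality_dep => i; apply: addrA. Qed.
Lemma dsum_addC : commutative dsum_add.
Proof. by move=> u v; apply: functional_extensionality_dep => i; apply: addrC. Qed.
Lemma dsum_add0 : left_id dsum_zero dsum_add.
Proof. by move=> u; apply: functional_extensionality_dep => i; apply: add0r. Qed.
Lemma dsum_addN : left_inverse dsum_zero dsum_opp dsum_add.
Proof. by move=> u; apply: functional_extensionality_dep => i; apply: addNr. Qed.
HB.instance Definition _ :=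
  GRing.isZmodule.Build dsum_type dsum_addA dsum_addC dsum_add0 dsum_addN.

Lemma dsum_scaleA c d u : dsum_scale c (dsum_scale d u) = dsum_scale (c * d) u.
Proof. by apply: functional_extensionality_dep => i; apply: scalerA. Qed.
Lemma dsum_scale1 : left_id 1 dsum_scale.
Proof. by move=> u; apply: functional_extensionality_dep => i; apply: scale1r. Qed.
Lemma dsum_scaleDr : right_distributive dsum_scale +%R.
Proof. by move=> c u v; apply: functional_extensionality_dep => i; apply: scalerDr. Qed.
Lemma dsum_scaleDl u : {morph dsum_scale^~ u : c d / c + d}.
Proof. by move=> c d; apply: functional_extensionality_dep => i; apply: scalerDl. Qed.
HB.instance Definition _ := GRing.Zmodule_isLmodule.Build C dsum_type
  dsum_scaleA dsum_scale1 dsum_scaleDr dsum_scaleDl.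

Definition dsum_par (u : dsum_type) : dsum_type := fun i => smod_par (u i).
Definition dsum_act x (u : dsum_type) : dsum_type := fun i => smod_act x (u i).

Lemma dsum_par_linear : linear dsum_par.
Proof.
by move=> c u v; apply: functional_extensionality_dep => i; apply: smod_par_linear.
Qed.
Lemma dsum_parK : involutive dsum_par.
Proof. by move=> u; apply: functional_extensionality_dep => i; apply: smod_parK. Qed.
Lemma dsum_act_linear x : linear (dsum_act x).
Proof.
by move=> c u v; apply: functional_extensionality_dep => i; apply: smod_act_linear.
Qed.
Lemma dsum_actP (c : C) (x y z : set_type g) u :
  val z = c *: val x + val y -> dsum_act z u = c *: dsum_act x u + dsum_act y u.
Proof.
by move=> hz; apply: functional_extensionality_dep => i; apply: smod_actP hz.
Qed.
Lemma dsum_act_par a (x : set_type g) u : homog a (val x) ->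
  dsum_par (dsum_act x u) = (-1) ^+ a *: dsum_act x (dsum_par u).
Proof.
by move=> hx; apply: functional_extensionality_dep => i; apply: smod_act_par hx.
Qed.
Lemma dsum_act_bracket a b (x y z : set_type g) u :
    homog a (val x) -> homog b (val y) ->
    val z = sbracket a b (val x) (val y) ->
  dsum_act z u = dsum_act x (dsum_act y u)
                 - (-1) ^+ (a && b) *: dsum_act y (dsum_act x u).
Proof.
move=> hx hy hz; apply: functional_extensionality_dep => i.
exact: smod_act_bracket hx hy hz.
Qed.

Definition dsum : smod := SMod dsum_par_linear dsum_parK dsum_act_linear
  dsum_actP dsum_act_par dsum_act_bracket.
End DirectSum.

Definition simple_sub (M : smod) (S : submod M) : Prop :=
  (exists2 v, S v & v <> 0) /\
  forall T : submod M, sub_set T `<=` sub_set S ->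
    sub_set T = [set 0] \/ sub_set T = sub_set S.

Definition soc (M : smod) : submod M :=
  gen_submod [set v | exists2 S : submod M, simple_sub S & S v].

Definition rad (M : smod) : submod M :=
  gen_submod [set v | exists2 S : submod M, sub_set S <> setT & S v].

(* Isomorphism up to parity. *)
Definition smod_iso (M N : smod) : Prop :=
  exists (p : bool) (phi : shom (pshift p M) N), bijective phi.

(* The submodule S is isomorphic to the direct sum of m z copies of F z, for z
   in I, each copy being taken up to parity. *)
Definition sub_iso_dsum (M : smod) (S : submod M) (I : finType)
    (F : I -> smod) (m : I -> nat) : Prop :=
  exists (p : {z : I & 'I_(m z)} -> bool)
         (phi : shom (dsum (fun k => pshift (p k) (F (tag k)))) M),
    injective phi /\ range phi = sub_set S.

(* U(g) is presented as the unital associative C-algebra generated by g, with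
   the linear relations of g and x y - (-1)^(|x||y|) y x = [x, y]. *)
Inductive uterm : Type :=
  | UGen of set_type g
  | UScal of C
  | UAdd of uterm & uterm
  | UMul of uterm & uterm.

Inductive ueq : uterm -> uterm -> Prop :=
  | ueq_refl t : ueq t t
  | ueq_sym s t : ueq s t -> ueq t s
  | ueq_trans s t u : ueq s t -> ueq t u -> ueq s u
  | ueq_add s s' t t' : ueq s s' -> ueq t t' -> ueq (UAdd s t) (UAdd s' t')
  | ueq_mul s s' t t' : ueq s s' -> ueq t t' -> ueq (UMul s t) (UMul s' t')
  | ueq_addA s t u : ueq (UAdd s (UAdd t u)) (UAdd (UAdd s t) u)
  | ueq_addC s t : ueq (UAdd s t) (UAdd t s)
  | ueq_add0 t : ueq (UAdd (UScal 0) t) t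
  | ueq_addN t : ueq (UAdd (UMul (UScal (-1)) t) t) (UScal 0)
  | ueq_mulA s t u : ueq (UMul s (UMul t u)) (UMul (UMul s t) u)
  | ueq_mul1 t : ueq (UMul (UScal 1) t) t
  | ueq_mulDl s t u : ueq (UMul (UAdd s t) u) (UAdd (UMul s u) (UMul t u))
  | ueq_mulDr s t u : ueq (UMul s (UAdd t u)) (UAdd (UMul s t) (UMul s u))
  | ueq_scalD c d : ueq (UScal (c + d)) (UAdd (UScal c) (UScal d))
  | ueq_scalM c d : ueq (UScal (c * d)) (UMul (UScal c) (UScal d))
  | ueq_scalC c t : ueq (UMul t (UScal c)) (UMul (UScal c) t)
  | ueq_genP c (x y z : set_type g) : val z = c *: val x + val y ->
      ueq (UGen z) (UAdd (UMul (UScal c) (UGen x)) (UGen y))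
  | ueq_bracket a b (x y z : set_type g) :
      homog a (val x) -> homog b (val y) ->
      val z = sbracket a b (val x) (val y) ->
      ueq (UGen z)
          (UAdd (UMul (UGen x) (UGen y))
                (UMul (UScal (- (-1) ^+ (a && b))) (UMul (UGen y) (UGen x)))).

Definition ueqb (s t : uterm) : bool := `[< ueq s t >].

HB.instance Definition _ := gen_eqMixin uterm.
HB.instance Definition _ := gen_choiceMixin uterm.

Lemma ueqb_refl : reflexive ueqb.
Proof. by move=> t; apply/asboolP/ueq_refl. Qed.
Lemma ueqb_sym : symmetric ueqb.
Proof. by move=> s t; apply/asboolP/asboolP => /ueq_sym. Qed.
Lemma ueqb_trans : transitive ueqb.
Proof.
by move=> t s u /asboolP hst /asboolP htu; apply/asboolP/(ueq_trans hst htu).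
Qed.

Canonical ueqb_equiv := EquivRel ueqb ueqb_refl ueqb_sym ueqb_trans.

Definition uea : Type := {eq_quot ueqb_equiv}.
HB.instance Definition _ := Choice.on uea.

Definition upi (t : uterm) : uea := \pi_{eq_quot ueqb_equiv} t.
Definition urepr (u : uea) : uterm := generic_quotient.repr (u : {eq_quot ueqb_equiv}).

Lemma ureprK : cancel urepr upi. Proof. exact: reprK. Qed.
Lemma upiP s t : upi s = upi t <-> ueq s t.
Proof. by split=> [/eqmodP/asboolP|?]; [| apply/eqmodP/asboolP]. Qed.
Lemma urepr_pi t : ueq (urepr (upi t)) t.
Proof. by apply/upiP; rewrite ureprK. Qed.
Lemma uea_ind (P : uea -> Prop) : (forall t, P (upi t)) -> forall u, P u.
Proof. by move=> hP u; rewrite -(ureprK u). Qed.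

Definition uadd u v := upi (UAdd (urepr u) (urepr v)).
Definition umul u v := upi (UMul (urepr u) (urepr v)).
Definition uopp u := upi (UMul (UScal (-1)) (urepr u)).

Lemma uaddE s t : uadd (upi s) (upi t) = upi (UAdd s t).
Proof. by apply/upiP/ueq_add; apply: urepr_pi. Qed.
Lemma umulE s t : umul (upi s) (upi t) = upi (UMul s t).
Proof. by apply/upiP/ueq_mul; apply: urepr_pi. Qed.
Lemma uoppE t : uopp (upi t) = upi (UMul (UScal (-1)) t).
Proof. by apply/upiP/ueq_mul; [apply: ueq_refl | apply: urepr_pi]. Qed.

Lemma uaddA : associative uadd.
Proof.
by elim/uea_ind=> s; elim/uea_ind=> t; elim/uea_ind=> u; rewrite !uaddE;
  apply/upiP/ueq_addA.
Qed.
Lemma uaddC : commutative uadd.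
Proof. by elim/uea_ind=> s; elim/uea_ind=> t; rewrite !uaddE; apply/upiP/ueq_addC. Qed.
Lemma uadd0 : left_id (upi (UScal 0)) uadd.
Proof. by elim/uea_ind=> s; rewrite uaddE; apply/upiP/ueq_add0. Qed.
Lemma uaddN : left_inverse (upi (UScal 0)) uopp uadd.
Proof. by elim/uea_ind=> s; rewrite uoppE uaddE; apply/upiP/ueq_addN. Qed.
HB.instance Definition _ := GRing.isZmodule.Build uea uaddA uaddC uadd0 uaddN.

Lemma upiD s t : upi (UAdd s t) = upi s + upi t.
Proof. by rewrite -uaddE. Qed.

Lemma umulA : associative umul.
Proof.
by elim/uea_ind=> s; elim/uea_ind=> t; elim/uea_ind=> u; rewrite !umulE;
  apply/upiP/ueq_mulA.
Qed.
Lemma umul1l : left_id (upi (UScal 1)) umul.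
Proof. by elim/uea_ind=> s; rewrite umulE; apply/upiP/ueq_mul1. Qed.
Lemma umul1r : right_id (upi (UScal 1)) umul.
Proof.
elim/uea_ind=> s; rewrite umulE; apply/upiP.
exact: ueq_trans (ueq_scalC _ _) (ueq_mul1 _).
Qed.
Lemma umulDl : left_distributive umul +%R.
Proof.
by elim/uea_ind=> s; elim/uea_ind=> t; elim/uea_ind=> u;
  rewrite -upiD !umulE -upiD; apply/upiP/ueq_mulDl.
Qed.
Lemma umulDr : right_distributive umul +%R.
Proof.
by elim/uea_ind=> s; elim/uea_ind=> t; elim/uea_ind=> u;
  rewrite -upiD !umulE -upiD; apply/upiP/ueq_mulDr.
Qed.
HB.instance Definition _ :=
  GRing.Zmodule_isPzRing.Build uea umulA umul1l umul1r umulDl umulDr.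

Lemma upiM s t : upi (UMul s t) = upi s * upi t.
Proof. by rewrite -umulE. Qed.

Definition uscale (c : C) (u : uea) : uea := upi (UScal c) * u.

Lemma uscaleA c d u : uscale c (uscale d u) = uscale (c * d) u.
Proof.
rewrite /uscale mulrA -upiM; congr (_ * _).
by apply/esym/upiP/ueq_scalM.
Qed.
Lemma uscale1 : left_id 1 uscale. Proof. by move=> u; apply: mul1r. Qed.
Lemma uscaleDr : right_distributive uscale +%R.
Proof. by move=> c u v; apply: mulrDr. Qed.
Lemma uscaleDl u : {morph uscale^~ u : c d / c + d}.
Proof.
by move=> c d; rewrite /uscale -mulrDl -upiD; congr (_ * _); apply/upiP/ueq_scalD.
Qed.
HB.instance Definition _ := GRing.Zmodule_isLmodule.Build C uea
  uscaleA uscale1 uscaleDr uscaleDl.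

Lemma uscaleE c (u : uea) : c *: u = upi (UScal c) * u. Proof. by []. Qed.

Definition ugen (x : set_type g) : uea := upi (UGen x).

Lemma uscalerAr c (u v : uea) : u * (c *: v) = c *: (u * v).
Proof.
rewrite !uscaleE !mulrA; congr (_ * _).
by elim/uea_ind: u => t; rewrite -!upiM; apply/upiP/ueq_scalC.
Qed.
Lemma uscalerAl c (u v : uea) : c *: (u * v) = c *: u * v.
Proof. by rewrite !uscaleE mulrA. Qed.

Lemma ugenP (c : C) (x y z : set_type g) :
  val z = c *: val x + val y -> ugen z = c *: ugen x + ugen y.
Proof. by move=> hz; rewrite uscaleE -upiM -upiD; apply/upiP/ueq_genP. Qed.

Lemma ugen_bracket a b (x y z : set_type g) :
    homog a (val x) -> homog b (val y) ->
    val z = sbracket a b (val x) (val y) ->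
  ugen z = ugen x * ugen y - (-1) ^+ (a && b) *: (ugen y * ugen x).
Proof.
move=> hx hy hz; rewrite -scaleNr uscaleE /ugen -!upiM -upiD.
exact/upiP/(ueq_bracket hx hy hz).
Qed.

Definition lie_part a (x : set_type g) : set_type g :=
  SigSub (mem_set (lie_hpart a (set_mem (valP x)))).

(* The automorphism of U(g) acting as (-1)^i on the part of parity i. *)
Fixpoint uterm_par (t : uterm) : uea :=
  match t with
  | UGen x => ugen (lie_part false x) - ugen (lie_part true x)
  | UScal c => upi (UScal c)
  | UAdd s t => uterm_par s + uterm_par t
  | UMul s t => uterm_par s * uterm_par t
  end.

Lemma val_lie_part a x : val (lie_part a x) = hpart a (val x).
Proof. by []. Qed.

Lemma ugen_eq0 (x : set_type g) : val x = 0 -> ugen x = 0.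
Proof.
move=> x0; have /ugenP : val x = 1 *: val x + val x by rewrite x0 scaler0 addr0.
by rewrite scale1r => /eqP; rewrite -subr_eq subrr => /eqP <-.
Qed.

Lemma uterm_par_homog a x : homog a (val x) ->
  uterm_par (UGen x) = (-1) ^+ a *: ugen x.
Proof.
move=> hx /=; have hx' := hpart_other hx.
have e : lie_part a x = x by apply: val_inj.
have e0 : ugen (lie_part (~~ a) x) = 0 by apply: ugen_eq0.
case: a hx hx' e e0 => /= _ _ -> ->.
  by rewrite sub0r scaleN1r.
by rewrite subr0 scale1r.
Qed.

Lemma uterm_par_eq s t : ueq s t -> uterm_par s = uterm_par t.
Proof.
elim=> {s t} //.
- by move=> s t u _ -> _ ->.
- by move=> s s' t t' _ /= -> _ ->.
- by move=> s s' t t' _ /= -> _ ->.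
- by move=> s t u /=; rewrite addrA.
- by move=> s t /=; rewrite addrC.
- by move=> t /=; rewrite [upi _](_ : _ = 0) // add0r.
- by move=> t /=; rewrite -uscaleE scaleN1r addNr.
- by move=> s t u /=; rewrite mulrA.
- by move=> t /=; rewrite -uscaleE scale1r.
- by move=> s t u /=; rewrite mulrDl.
- by move=> s t u /=; rewrite mulrDr.
- by move=> c d /=; rewrite -upiD; apply/upiP/ueq_scalD.
- by move=> c d /=; rewrite -upiM; apply/upiP/ueq_scalM.
- move=> c t /=; have := uscalerAr c (uterm_par t) 1.
  by rewrite !uscaleE !mulr1.
- move=> c x y z hz; rewrite [RHS]/= -uscaleE scalerBr addrACA -opprD.
  have e a : ugen (lie_part a z) = c *: ugen (lie_part a x) + ugen (lie_part a y).
    by apply: ugenP; rewrite val_lie_part hz hpart_is_linear.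
  by rewrite [LHS]/= !e.
- move=> a b x y z hx hy hz.
  have hz' : homog (a (+) b) (val z) by rewrite hz; apply: homog_bracket.
  have := uterm_par_homog hx; have := uterm_par_homog hy.
  have := uterm_par_homog hz'; rewrite /= => -> -> ->.
  rewrite -!uscaleE (ugen_bracket hx hy hz) scaleNr scalerBr.
  rewrite -!uscalerAl !uscalerAr !scalerA signr_addb.
  by congr (_ - _ *: _); rewrite mulrC [X in _ * X]mulrC.
Qed.

Definition upar (u : uea) : uea := uterm_par (urepr u).

Lemma uparE t : upar (upi t) = uterm_par t.
Proof. exact/uterm_par_eq/urepr_pi. Qed.
Lemma uparD u v : upar (u + v) = upar u + upar v.
Proof. by elim/uea_ind: u => s; elim/uea_ind: v => t; rewrite -upiD !uparE. Qed.
Lemma uparM u v : upar (u * v) = upar u * upar v.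
Proof. by elim/uea_ind: u => s; elim/uea_ind: v => t; rewrite -upiM !uparE. Qed.
Lemma upar_linear : linear upar.
Proof. by move=> c u v; rewrite uparD !uscaleE uparM uparE. Qed.
Lemma upar_gen a x : homog a (val x) -> upar (ugen x) = (-1) ^+ a *: ugen x.
Proof. by move=> hx; rewrite uparE (uterm_par_homog hx). Qed.
Lemma upar_lie_part a x :
  upar (ugen (lie_part a x)) = (-1) ^+ a *: ugen (lie_part a x).
Proof. by apply: upar_gen; rewrite val_lie_part; apply: hpart_id. Qed.
Lemma uparK : involutive upar.
Proof.
elim/uea_ind=> t; rewrite uparE; elim: t => [x|c|s IHs t IHt|s IHs t IHt] /=.
- rewrite -scaleN1r addrC upar_linear !upar_lie_part expr0 expr1 scale1r.
  rewrite !scaleN1r opprK addrC -[RHS]/(ugen x).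
  have /ugenP -> : val x = 1 *: val (lie_part false x) + val (lie_part true x).
    by rewrite scale1r !val_lie_part hpart_sum.
  by rewrite scale1r.
- by rewrite uparE.
- by rewrite uparD IHs IHt -upiD.
- by rewrite uparM IHs IHt -upiM.
Qed.

(* U(g) as a left g-supermodule. *)
Definition uact (x : set_type g) (u : uea) : uea := ugen x * u.

Lemma uact_linear x : linear (uact x).
Proof. by move=> c u v; rewrite /uact mulrDr uscalerAr. Qed.
Lemma uactP (c : C) (x y z : set_type g) u :
  val z = c *: val x + val y -> uact z u = c *: uact x u + uact y u.
Proof. by move=> hz; rewrite /uact (ugenP hz) mulrDl uscalerAl. Qed.
Lemma uact_par a (x : set_type g) u : homog a (val x) ->
  upar (uact x u) = (-1) ^+ a *: uact x (upar u).
Proof. by move=> hx; rewrite /uact uparM (upar_gen hx) uscalerAl. Qed.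
Lemma uact_bracket a b (x y z : set_type g) u :
    homog a (val x) -> homog b (val y) ->
    val z = sbracket a b (val x) (val y) ->
  uact z u = uact x (uact y u) - (-1) ^+ (a && b) *: uact y (uact x u).
Proof.
move=> hx hy hz; rewrite /uact (ugen_bracket hx hy hz).
by rewrite mulrBl -uscalerAl !mulrA.
Qed.

Definition uea_smod : smod :=
  SMod upar_linear uparK uact_linear uactP uact_par uact_bracket.

(* U(g) (x)_{U(b)} C_chi for a subalgebra b of g and its one-dimensional module
   C_chi: the quotient of U(g) (x) C = U(g) by the relations
   u b (x) 1 = u (x) b 1, that is u b = chi(b) u. *)
Definition induced (b : set 'M[C]_(n + n)) (chi : 'M[C]_(n + n) -> C) : smod :=
  quo (@gen_submod uea_smod
    [set w | exists u (x : set_type g),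
               b (val x) /\ w = u * ugen x - chi (val x) *: u]).

Definition simple_quo (M : smod) : smod := quo (rad M).

End Supermodules.

Definition in_pe X : Prop :=
  [/\ drsubmx X = - (ulsubmx X)^T,
      (ursubmx X)^T = ursubmx X & (dlsubmx X)^T = - dlsubmx X].

Lemma in_pe0 : in_pe 0.
Proof.
by split; rewrite /ulsubmx /ursubmx /dlsubmx /drsubmx !linear0 ?oppr0.
Qed.

Lemma in_peP (c : C) X Y : in_pe X -> in_pe Y -> in_pe (c *: X + Y).
Proof.
move=> [X1 X2 X3] [Y1 Y2 Y3].
have lin m1 m2 m3 m4 (A : 'M[C]_(m1 + m2, m3 + m4)) B :
    [/\ ulsubmx (c *: A + B) = c *: ulsubmx A + ulsubmx B,
        ursubmx (c *: A + B) = c *: ursubmx A + ursubmx B,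
        dlsubmx (c *: A + B) = c *: dlsubmx A + dlsubmx B &
        drsubmx (c *: A + B) = c *: drsubmx A + drsubmx B].
  by rewrite /ulsubmx /ursubmx /dlsubmx /drsubmx !linearP.
rewrite /in_pe; have [-> -> -> ->] := lin _ _ _ _ X Y.
by split; rewrite ?linearP /= ?X1 ?X2 ?X3 ?Y1 ?Y2 ?Y3 ?scalerN ?opprD.
Qed.

Lemma in_pe_hpart a X : in_pe X -> in_pe (hpart a X).
Proof.
move=> [X1 X2 X3]; rewrite /hpart; case: a;
  by split; rewrite ?block_mxKul ?block_mxKur ?block_mxKdl ?block_mxKdr
    ?trmx0 ?oppr0.
Qed.

Lemma in_pe_bracket a b X Y : homog a X -> homog b Y ->
  in_pe X -> in_pe Y -> in_pe (sbracket a b X Y).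
Proof.
move=> hX hY [X1 X2 X3] [Y1 Y2 Y3]; rewrite -hX -hY /hpart /sbracket.
case: a {hX}; case: b {hY} => /=;
  rewrite !mulmx_block !mul0mx !mulmx0 ?addr0 ?add0r scale_block_mx opp_block_mx
    add_block_mx ?scaler0 ?oppr0 ?addr0;
  split; rewrite ?block_mxKul ?block_mxKur ?block_mxKdl ?block_mxKdr
    ?trmx0 ?oppr0 ?expr0 ?expr1 ?scaleN1r ?scale1r ?opprK //
    ?linearD ?linearN /= ?trmx_mul ?X1 ?X2 ?X3 ?Y1 ?Y2 ?Y3
    ?linearN /= ?trmxK ?mulNmx ?mulmxN ?opprK ?X1 ?X2 ?X3 ?Y1 ?Y2 ?Y3
    ?mulNmx ?mulmxN ?opprD ?opprK //;
  by rewrite addrC.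
Qed.

Definition pe : lieSub := LieSub in_pe0 in_peP in_pe_hpart in_pe_bracket.

Definition in_pe_even X : Prop := in_pe X /\ homog false X.

Lemma in_pe_even0 : in_pe_even 0.
Proof. by split; [apply: in_pe0 | apply/linear_fun0/hpart_is_linear]. Qed.
Lemma in_pe_evenP (c : C) X Y :
  in_pe_even X -> in_pe_even Y -> in_pe_even (c *: X + Y).
Proof.
move=> [X1 X2] [Y1 Y2]; split; first exact: in_peP.
by rewrite /homog hpart_is_linear X2 Y2.
Qed.
Lemma in_pe_even_hpart a X : in_pe_even X -> in_pe_even (hpart a X).
Proof.
move=> [X1 X2]; case: a; last by rewrite X2.
by have -> := hpart_other X2; apply: in_pe_even0.
Qed.
Lemma in_pe_even_bracket a b X Y : homog a X -> homog b Y ->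
  in_pe_even X -> in_pe_even Y -> in_pe_even (sbracket a b X Y).
Proof.
move=> hX hY [X1 X2] [Y1 Y2]; split; first exact: in_pe_bracket.
case: a hX => hX.
  rewrite (homog_eq0 X2 hX) /sbracket mul0mx mulmx0 scaler0 subr0.
  exact/linear_fun0/hpart_is_linear.
case: b hY => hY; last exact: homog_bracket hX hY.
rewrite (homog_eq0 Y2 hY) /sbracket mul0mx mulmx0 scaler0 subr0.
exact/linear_fun0/hpart_is_linear.
Qed.

Definition pe_even : lieSub :=
  LieSub in_pe_even0 in_pe_evenP in_pe_even_hpart in_pe_even_bracket.

Definition pe_plus : set 'M[C]_(n + n) :=
  [set X | in_pe X /\ [/\ ulsubmx X = 0, drsubmx X = 0 & dlsubmx X = 0]].
Definition pe_minus : set 'M[C]_(n + n) :=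
  [set X | in_pe X /\ [/\ ulsubmx X = 0, drsubmx X = 0 & ursubmx X = 0]].

Definition borel_even : set 'M[C]_(n + n) :=
  [set X | in_pe_even X /\ forall i j : 'I_n, (j < i)%N -> ulsubmx X i j = 0].
Definition borel : set 'M[C]_(n + n) :=
  [set X + Y | X in borel_even & Y in pe_plus].
Definition borel_rev : set 'M[C]_(n + n) :=
  [set X + Y | X in borel_even & Y in pe_minus].

(* Weights are row vectors of coordinates in the basis epsilon_1, ..., epsilon_n.
   Each of the three Borel subalgebras acts on C_lambda through this formula:
   its diagonal part is sum_i (ulsubmx X i i) H_i, and its other root vectors
   act by zero. *)
Definition weight := 'rV[C]_n.
Implicit Types lam mu : weight.

Definition wchar lam X : C := \sum_(i < n) lam 0 i * ulsubmx X i i.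

Definition Delta lam : smod pe := induced pe borel (wchar lam).
Definition Delta_rev lam : smod pe := induced pe borel_rev (wchar lam).
Definition Delta_even lam : smod pe_even := induced pe_even borel_even (wchar lam).

Definition L lam : smod pe := simple_quo (Delta lam).
Definition L_rev lam : smod pe := simple_quo (Delta_rev lam).
Definition L_even lam : smod pe_even := simple_quo (Delta_even lam).

Definition wplus lam : weight := xget 0 [set nu | smod_iso (L nu) (L_rev lam)].

Definition eps (i : 'I_n) : weight := delta_mx 0 i.
Definition eta : weight := (1 - n%:R) *: \sum_(i < n) eps i.
Definition rho_even : weight :=
  2^-1 *: \sum_(i < n) \sum_(j < n | (i < j)%N) (eps i - eps j).

(* The pairing with the coroot of epsilon_i - epsilon_j. *)
Definition cpair lam (i j : 'I_n) : C := lam 0 i - lam 0 j.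

Definition integral lam : Prop :=
  forall i j : 'I_n, i != j -> exists m : int, cpair lam i j = m%:~R.
Definition dominant lam : Prop :=
  integral lam /\ forall i j : 'I_n, (i < j)%N -> 0 <= cpair (lam + rho_even) i j.

(* w maps epsilon_i to epsilon_(w i). *)
Definition wact (w : 'S_n) lam : weight := \sum_(i < n) lam 0 i *: eps (w i).
Definition dot (w : 'S_n) lam : weight := wact w (lam + rho_even) - rho_even.

Definition wlen (w : 'S_n) : nat :=
  #|[set p : 'I_n * 'I_n | (p.1 < p.2)%N && (w p.2 < w p.1)%N]|.
Definition bruhat_step : rel 'S_n := fun x y =>
  [exists p : 'I_n * 'I_n, y == (x * tperm p.1 p.2)%g] && (wlen x < wlen y)%N.
Definition bruhat_lt : rel 'S_n := fun x y => (x != y) && connect bruhat_step x y.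

End LieSuperalgebras.

(* Main.v *)
(* Let V be the cokernel of f0. The identity matrix acts on Delta(lambda) by
   |lambda| - 2 d in degree d with respect to g_{-1}, where |lambda| is the sum
   of the coordinates. As |gamma| = |lambda|, the highest weight vector of
   Delta(gamma) is mapped to degree 0, hence to a singular vector of
   Delta_even(lambda). Such a vector is unique up to a scalar, so that
   Delta(lambda) / Delta(gamma) is the Kac module
   K(V) = U(g) (x)_{U(g_0 + g_1)} V = Lambda(g_{-1}) (x) V.
   Every non-zero submodule of K(V) meets Lambda^top(g_{-1}) (x) V, which gives a
   bijection between the simple submodules of K(V) and those of V and matches the
   decompositions of the two socles. If L_even(nu) in V has highest weight vector
   v, then Lambda^top (x) v is a highest weight vector for the reverse Borel
   subalgebra, of weight nu + eta. In the twist of K(V) by the character -eta of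
   pe(n) it generates L^r(nu) = L(nu^+), hence in K(V) it generates
   L(nu^+ + eta).

   The uniqueness of singular vectors is obtained in a realisation of the Verma
   module of gl(n) by differential operators on polynomials in x_(s, k), k < s:
   the top degree part of a singular vector involves only the x_(i+1, i), and
   its weight then determines the exponents. *)

From Stdlib Require List.
From HB Require Import structures.
From mathcomp Require Import all_boot all_order all_algebra all_fingroup.
From mathcomp Require Import boolp classical_sets reals complex.
From mathcomp Require Import zify.
Require Import Defs.

Set Implicit Arguments.
Unset Strict Implicit.
Unset Printing Implicit Defensive.
Import GRing.Theory Num.Theory.
Local Open Scope ring_scope.

(** * Modules over the enveloping algebra *)

(** U(g) is presented by generators and relations, so its size is unknown at the outset: facts
    usually drawn from the PBW theorem, such as Verma modules being non-zero, are read off explicit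
    models on which the brackets are verified. K(V) is modelled on an exterior algebra with creation
    and annihilation operators. Spanning statements come from straightening words in lowering root
    vectors, and the isomorphism of Delta(lambda) / Delta(gamma) with K(V) is a pair of inverse maps
    produced by universal properties. Two obstacles shape the rest. The maps f and f0 are given
    independently of each other, so their highest weight vectors have to be proved proportional in
    Delta_even(lambda). And nu^+ is defined by a choice with default value 0, so the existence of
    such a weight has to be proved; it is found inside K(V), where depths below the highest weight
    are natural numbers, by taking a vector of least depth in the simple submodule. Submodules are
    graded throughout, hence highest weight vectors must be homogeneous, and this is why parities
    accompany most statements. *)

Section EnvelopingAction.
Variables (C : numClosedFieldType) (n : nat) (g : lieSub C n).
Implicit Types (M N P : smod g) (s t : uterm g) (u : uea g).

Fixpoint uev M t (v : M) : M :=
  match t with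
  | UGen x => smod_act x v
  | UScal c => c *: v
  | UAdd s t => uev s v + uev t v
  | UMul s t => uev s (uev t v)
  end.

Lemma uev_linear M t : linear (@uev M t).
Proof.
elim: t => [x|d|s IHs t IHt|s IHs t IHt] c v w /=.
- exact: smod_act_linear.
- by rewrite scalerDr !scalerA mulrC.
- by rewrite IHs IHt scalerDr addrACA.
- by rewrite IHt IHs.
Qed.

(** The operators of a supermodule satisfy every relation of the presentation of U(g), so [uev]
    descends to [umod]. *)
Lemma uev_eq M s t : ueq s t -> @uev M s = @uev M t.
Proof.
move=> st; apply: functional_extensionality_dep.
elim: st => {s t} /=.
- by [].
- by move=> s t _ IH v.
- by move=> s t r _ IH1 _ IH2 v; rewrite IH1.
- by move=> s s' t t' _ IH1 _ IH2 v; rewrite IH1 IH2.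
- by move=> s s' t t' _ IH1 _ IH2 v; rewrite IH2 IH1.
- by move=> s t r v; rewrite addrA.
- by move=> s t v; rewrite addrC.
- by move=> t v; rewrite scale0r add0r.
- by move=> t v; rewrite scaleN1r addNr scale0r.
- by [].
- by move=> t v; rewrite scale1r.
- by [].
- by move=> s t r v; rewrite (linear_funD _ _ (@uev_linear M s)).
- by move=> c d v; rewrite scalerDl.
- by move=> c d v; rewrite scalerA.
- by move=> c t v; rewrite (linear_funZ _ _ (@uev_linear M t)).
- by move=> c x y z hz v; rewrite (smod_actP _ hz).
- by move=> a b x y z hx hy hz v; rewrite (smod_act_bracket _ hx hy hz) scaleNr.
Qed.

Definition umod M u (v : M) : M := uev (urepr u) v.

Lemma umodE M t (v : M) : umod (upi t) v = uev t v.
Proof. by rewrite /umod (uev_eq _ (urepr_pi t)). Qed.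
Lemma umod_linear M u : linear (@umod M u).
Proof. exact: uev_linear. Qed.
Lemma umodM M u u' (v : M) : umod (u * u') v = umod u (umod u' v).
Proof. by elim/uea_ind: u => s; elim/uea_ind: u' => t; rewrite -upiM !umodE. Qed.
Lemma umodD M u u' (v : M) : umod (u + u') v = umod u v + umod u' v.
Proof. by elim/uea_ind: u => s; elim/uea_ind: u' => t; rewrite -upiD !umodE. Qed.
Lemma umodZ M c u (v : M) : umod (c *: u) v = c *: umod u v.
Proof. by rewrite uscaleE umodM umodE. Qed.
Lemma umod1 M (v : M) : umod 1 v = v.
Proof. by rewrite [1]/(upi _) umodE /= scale1r. Qed.
Lemma umod_gen M x (v : M) : umod (ugen x) v = smod_act x v.
Proof. by rewrite umodE. Qed.
Lemma umodN M u (v : M) : umod (- u) v = - umod u v.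
Proof. by rewrite -(scaleN1r u) umodZ scaleN1r. Qed.
Lemma umod0 M (v : M) : umod 0 v = 0.
Proof. by rewrite -(subrr 1) umodD umodN subrr. Qed.

Lemma act_parts M x (v : M) :
  smod_act x v = smod_act (lie_part false x) v + smod_act (lie_part true x) v.
Proof.
rewrite -[X in X + _]scale1r; apply: smod_actP.
by rewrite scale1r !val_lie_part hpart_sum.
Qed.

(** A generator need not be homogeneous, while the sign rule for [smod_par] concerns homogeneous
    elements; each generator is split into its even and odd parts, as in the definition of
    [upar]. *)
Lemma umod_par M u (v : M) : smod_par (umod u v) = umod (upar u) (smod_par v).
Proof.
elim/uea_ind: u => t; rewrite umodE uparE.
have lp := @smod_par_linear _ _ _ M.
elim: t v => [x|c|s IHs t IHt|s IHs t IHt] v /=.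
- rewrite act_parts (linear_funD _ _ lp) umodD umodN !umod_gen.
  rewrite (smod_act_par (a := false)) ?val_lie_part; last exact: hpart_id.
  rewrite (smod_act_par (a := true)) ?val_lie_part; last exact: hpart_id.
  by rewrite scale1r scaleN1r.
- by rewrite umodE (linear_funZ _ _ lp).
- by rewrite (linear_funD _ _ lp) umodD IHs IHt.
- by rewrite umodM IHs IHt.
Qed.

Lemma shom_umod M N (f : shom M N) u v : f (umod u v) = umod u (f v).
Proof.
elim/uea_ind: u => t; rewrite !umodE.
elim: t v => [x|c|s IHs t IHt|s IHs t IHt] v /=.
- exact: shom_act.
- exact/linear_funZ/shom_linear.
- by rewrite (linear_funD _ _ (shom_linear f)) IHs IHt.
- by rewrite IHs IHt.
Qed.

Lemma sub_umod M (S : submod M) u v : S v -> S (umod u v).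
Proof.
elim/uea_ind: u => t; rewrite !umodE.
elim: t v => [x|c|s IHs t IHt|s IHs t IHt] v Sv /=.
- exact: sub_act.
- by rewrite -[_ *: _]addr0; apply: subP Sv (sub0 S).
- by apply: subD; [apply: IHs|apply: IHt].
- by apply/IHs/IHt.
Qed.

Lemma umod_pshift a M u (v : M) : @umod (pshift a M) u v = umod u v.
Proof.
elim/uea_ind: u => t; rewrite !umodE.
elim: t v => [x|c|s IHs t IHt|s IHs t IHt] v //=; first by rewrite IHs IHt.
by rewrite IHs IHt.
Qed.

Lemma umod_uea u (w : uea g) : @umod (uea_smod g) u w = u * w.
Proof.
elim/uea_ind: u => t; rewrite umodE.
elim: t w => [x|c|s IHs t IHt|s IHs t IHt] w //=.
- by rewrite IHs IHt upiD mulrDl.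
- by rewrite IHs IHt upiM mulrA.
Qed.

Lemma sub_scale M (S : submod M) c v : S v -> S (c *: v).
Proof. by move=> Sv; rewrite -[_ *: _]addr0; apply: subP Sv (sub0 S). Qed.

Lemma sub_sum M (S : submod M) (I : Type) (r : seq I) (Q : pred I) (F : I -> M) :
  (forall i, Q i -> S (F i)) -> S (\sum_(i <- r | Q i) F i).
Proof.
move=> SF; apply: (big_ind (sub_set S)); [exact: sub0| |exact: SF].
by move=> v w; apply: subD.
Qed.

End EnvelopingAction.

(** * Kernels, images, quotients and the universal property of induced modules *)

Section Constructions.
Variables (C : numClosedFieldType) (n : nat) (g : lieSub C n).
Implicit Types (M N P : smod g).

Definition ker_submod M N (f : shom M N) : submod M.
Proof.
move: (shom_linear f) => lf.
refine (@SubMod _ _ g M (fun v => f v = 0) _ _ _ _).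
- exact: linear_fun0.
- by move=> c u v hu hv; rewrite lf hu hv scaler0 addr0.
- move=> v hv; rewrite shom_par hv; exact/linear_fun0/smod_par_linear.
- move=> x v hv; rewrite shom_act hv; exact/linear_fun0/smod_act_linear.
Defined.

Definition preim_submod M N (f : shom M N) (S : submod N) : submod M.
Proof.
move: (shom_linear f) => lf.
refine (@SubMod _ _ g M (fun v => S (f v)) _ _ _ _).
- by rewrite (linear_fun0 lf); apply: sub0.
- by move=> c u v hu hv; rewrite lf; apply: subP.
- by move=> v hv; rewrite shom_par; apply: sub_par.
- by move=> x v hv; rewrite shom_act; apply: sub_act.
Defined.

Definition image_submod M N (f : shom M N) (S : submod M) : submod N.
Proof.
move: (shom_linear f) => lf.
refine (@SubMod _ _ g N (fun w => exists2 v, S v & f v = w) _ _ _ _).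
- by exists 0; [apply: sub0|apply: linear_fun0].
- move=> c _ _ [u Su <-] [v Sv <-].
  by exists (c *: u + v); [apply: subP|rewrite lf].
- by move=> _ [v Sv <-]; exists (smod_par v); [apply: sub_par|rewrite shom_par].
- by move=> x _ [v Sv <-]; exists (smod_act x v);
    [apply: sub_act|rewrite shom_act].
Defined.

Definition zero_submod M : submod M.
Proof.
refine (@SubMod _ _ g M (fun v => v = 0) _ _ _ _) => //.
- by move=> c u v -> ->; rewrite scaler0 addr0.
- by move=> v ->; apply/linear_fun0/smod_par_linear.
- by move=> x v ->; apply/linear_fun0/smod_act_linear.
Defined.

Definition shom_comp M N P (f : shom N P) (h : shom M N) : shom M P.
Proof.
refine (@SHom _ _ g M P (f \o h) _ _ _) => [c u v|x v|v] /=.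
- by rewrite (shom_linear h) (shom_linear f).
- by rewrite !shom_act.
- by rewrite !shom_par.
Defined.

Definition quo_proj M (S : submod M) : shom M (quo S).
Proof.
refine (@SHom _ _ g M (quo S) (@quo_pi _ _ _ _ S) _ _ _) => [|x v|v] /=.
- exact: quo_pi_linear.
- by rewrite quo_actE.
- by rewrite quo_parE.
Defined.

Section QuotientHom.
Variables (M P : smod g) (S : submod M) (f : shom M P).
Hypothesis Sf : forall v, S v -> f v = 0.

Definition quo_hom_fun (q : quo S) : P := f (quo_repr q).
Lemma quo_hom_funE v : quo_hom_fun (quo_pi S v) = f v.
Proof.
apply/eqP; rewrite -subr_eq0 (linear_funB _ _ (shom_linear f)).
exact/eqP/Sf/quo_repr_pi.
Qed.
Definition quo_hom : shom (quo S) P.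
Proof.
refine (@SHom _ _ g (quo S) P quo_hom_fun _ _ _).
- move=> c; elim/quo_ind=> u; elim/quo_ind=> v.
  by rewrite -quo_pi_linear !quo_hom_funE (shom_linear f).
- by move=> x; elim/quo_ind=> v; rewrite /= quo_actE !quo_hom_funE shom_act.
- by elim/quo_ind=> v; rewrite /= quo_parE !quo_hom_funE shom_par.
Defined.
Lemma quo_homE v : quo_hom (quo_pi S v) = f v.
Proof. exact: quo_hom_funE. Qed.
End QuotientHom.

Lemma sgn_sq (q : bool) : (-1) ^+ q * (-1) ^+ q = 1 :> C.
Proof. by case: q; rewrite ?mulrNN mulr1. Qed.

(** Shifting twice is the identity, so a shift can be moved between source and target. Maps out of
    an induced module are built with the shift on the target, where the universal property sees an
    unshifted source. *)
Definition shom_shift a M P (f : shom (pshift a M) P) : shom M (pshift a P).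
Proof.
refine (@SHom _ _ g M (pshift a P) f (shom_linear f) (shom_act f) _).
move=> v /=; rewrite /pshift_par -shom_par /= /pshift_par.
by rewrite (linear_funZ _ _ (shom_linear f)) scalerA sgn_sq scale1r.
Defined.

Definition shom_unshift a M P (f : shom M (pshift a P)) : shom (pshift a M) P.
Proof.
refine (@SHom _ _ g (pshift a M) P f (shom_linear f) (shom_act f) _).
move=> v /=; rewrite /pshift_par (linear_funZ _ _ (shom_linear f)) shom_par /=.
by rewrite /pshift_par scalerA sgn_sq scale1r.
Defined.

(** The two parity involutions differ by a sign, so both modules have the same graded submodules. *)
Definition unshift_submod a M (S : submod (pshift a M)) : submod M.
Proof.
refine (@SubMod _ _ g M (sub_set S) (sub0 S) (@subP _ _ _ _ S) _ (@sub_act _ _ _ _ S)).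
move=> v Sv; have /= := sub_scale ((-1) ^+ a) (sub_par Sv).
by rewrite /pshift_par scalerA sgn_sq scale1r.
Defined.

Definition generates M (v : M) := forall w, exists u, w = umod u v.

Lemma generates_sub M (v : M) (S : submod M) : generates v -> S v -> forall w, S w.
Proof. by move=> gv Sv w; have [u ->] := gv w; apply: sub_umod. Qed.

Lemma eq_hom_gen M P (v : M) (f h : shom M P) :
  generates v -> f v = h v -> forall w, f w = h w.
Proof. by move=> gv fh w; have [u ->] := gv w; rewrite !shom_umod fh. Qed.

Section Universal.
Variables (b : set 'M[C]_(n + n)) (chi : 'M[C]_(n + n) -> C).

Definition ind_rel : submod (uea_smod g) := @gen_submod _ _ g (uea_smod g)
  [set w | exists (u : uea g) (x : set_type g),
             b (val x) /\ w = u * ugen x - chi (val x) *: u].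

Definition ind_gen : induced g b chi := @quo_pi _ _ _ (uea_smod g) _ (1 : uea g).

Lemma ind_gen_generates : generates ind_gen.
Proof.
elim/quo_ind=> w; exists w.
by rewrite -(shom_umod (quo_proj _)) umod_uea mulr1.
Qed.

Definition char_vector M (t : M) :=
  forall x : set_type g, b (val x) -> smod_act x t = chi (val x) *: t.

Lemma ind_gen_char : char_vector ind_gen.
Proof.
move=> x bx; rewrite -(shom_act (quo_proj _)) /=.
rewrite -(linear_funZ _ _ (@quo_pi_linear _ _ _ _ _)).
apply/quo_piP => S; apply; exists 1, x; split=> //.
by rewrite /uact mulr1 mul1r.
Qed.

Lemma ind_gen_par : smod_par ind_gen = ind_gen.
Proof. by rewrite -(shom_par (quo_proj _)) /= uparE. Qed.

(** The map is u |-> u t; it kills the relations u x - chi(x) u because [t] is a character vector.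
    As 1 is even in U(g), [t] must be fixed by the parity involution. *)
Lemma ind_hom P (t : P) : smod_par t = t -> char_vector t ->
  exists f : shom (induced g b chi) P, f ind_gen = t.
Proof.
move=> pt ct.
pose f (u : uea_smod g) : P := umod (u : uea g) t.
have lf : linear f by move=> c u v; rewrite /f umodD umodZ.
have af x v : f (smod_act x v) = smod_act x (f v).
  by rewrite /f /= /uact umodM umod_gen.
have pf v : f (smod_par v) = smod_par (f v) by rewrite /f umod_par pt.
pose F := SHom lf af pf.
have FS v : ind_rel v -> F v = 0.
  move=> h; apply: (h (ker_submod F)) => _ [u [x [bx ->]]] /=.
  by rewrite /f umodD umodM umod_gen umodN umodZ ct //
    (linear_funZ _ _ (@umod_linear _ _ _ _ u)) subrr.
exists (quo_hom FS); rewrite [LHS](quo_homE FS); exact: umod1.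
Qed.

Lemma ind_hom_shift (q : bool) P (t : P) : smod_par t = (-1) ^+ q *: t -> char_vector t ->
  exists f : shom (pshift q (induced g b chi)) P, f ind_gen = t.
Proof.
move=> pt ct.
have pt' : @smod_par _ _ _ (pshift q P) t = t.
  by rewrite /= /pshift_par pt scalerA sgn_sq scale1r.
by have [f ft] := @ind_hom (pshift q P) t pt' ct; exists (shom_unshift f).
Qed.
End Universal.

End Constructions.

(** * Highest weight modules *)

Section Eigenvectors.
Variables (K : fieldType) (V : lmodType K) (T : V -> V) (N : V -> Prop).
Hypothesis T_lin : linear T.
Hypothesis N0 : N 0.
Hypothesis N_lin : forall c u v, N u -> N v -> N (c *: u + v).
Hypothesis N_T : forall v, N v -> N (T v).
Variables (I : Type) (s : seq I) (a : I -> K) (u : I -> V).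

(** Lagrange interpolation: the product of T - b over the eigenvalues b different from c preserves
    N, kills the other components and multiplies the component of c by a non-zero scalar.
    Eigenvalues may be repeated. *)
Lemma eigen_component_in c : (forall i, T (u i) = a i *: u i) ->
  N (\sum_(i <- s) u i) -> N (\sum_(i <- s | a i == c) u i).
Proof.
move=> Tu Nu.
have TE : {morph T : x y / x + y}.
  by move=> x y; rewrite -{1}[x]scale1r T_lin scale1r.
have T0 : T 0 = 0.
  by apply: (@addrI _ (T 0)); rewrite -TE !addr0.
have TZ d x : T (d *: x) = d *: T x by rewrite -[d *: x]addr0 T_lin T0 addr0.
have NP (bs : seq K) : N (\sum_(i <- s) (\prod_(b <- bs) (a i - b)) *: u i).
  elim: bs => [|b bs IH].
    by under eq_bigr do rewrite big_nil scale1r.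
  have := N_lin (- b) IH (N_T IH); rewrite (big_morph T TE T0) scaler_sumr -big_split /=.
  congr N; apply: eq_bigr => i _; rewrite big_cons TZ Tu !scalerA -scalerDl.
  by congr (_ *: _); rewrite mulrBl addrC mulrC mulNr.
pose bs := [seq a i | i <- s & a i != c].
pose p := \prod_(b <- bs) (c - b).
have p0 : p != 0.
  rewrite /p /bs big_map big_filter; apply: (big_ind (fun x : K => x != 0)).
  - exact: oner_neq0.
  - by move=> x y x0 y0; rewrite mulf_neq0.
  - by move=> i; rewrite subr_eq0 eq_sym.
have : N (p *: \sum_(i <- s | a i == c) u i).
  have := NP bs; rewrite scaler_sumr big_mkcond [X in _ -> N X]big_mkcond /=.
  (* [t] runs over the tails of [s], while [bs] remains the list of the eigenvalues of all of
     [s]. *)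
  have E (t : seq I) : N (\sum_(i <- t) (\prod_(b <- bs) (a i - b)) *: u i) -> 
     (forall i, List.In i t -> List.In i s) -> 
     N (\sum_(i <- t) (if a i == c then p *: u i else 0)).
    move=> + ts; congr N.
    elim: t ts => [|i t IH] ts; first by rewrite !big_nil.
    rewrite !big_cons IH; last by move=> j jt; apply: ts; right.
    congr (_ + _); have si : List.In i s by apply: ts; left.
    case: eqVneq => [->//|ac].
    suff -> : \prod_(b <- bs) (a i - b) = 0 by rewrite scale0r.
    rewrite /bs big_map big_filter.
    elim: {+}s si => // j r IHr [->|ir].
      by rewrite big_cons ac subrr mul0r.
    by rewrite big_cons IHr //; case: ifP; rewrite ?mulr0.
  by move=> h; apply: E.
move=> h; have := N_lin p^-1 h N0.
by rewrite addr0 scalerA mulVf // scale1r.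
Qed.
End Eigenvectors.

Lemma sum_component_neq0 (K : eqType) (V : nmodType) (I : Type) (s : seq I)
    (a : I -> K) (u : I -> V) :
  \sum_(i <- s) u i <> 0 -> exists c, \sum_(i <- s | a i == c) u i <> 0.
Proof.
have [m] := ubnP (size s); elim: m s => // m IH [|i s] /= sz.
  by rewrite big_nil.
move=> s0; have [e|ne] := pselect (\sum_(j <- i :: s | a j == a i) u j = 0); last first.
  by exists (a i).
have e2 : \sum_(j <- i :: s) u j = \sum_(j <- [seq j <- i :: s | a j != a i]) u j.
  by rewrite [RHS]big_filter [LHS](bigID (fun j => a j == a i)) /= e add0r.
have [||c hc] := IH [seq j <- i :: s | a j != a i].
- rewrite /= eqxx /=; apply: (leq_ltn_trans _ (sz : (size s < m)%N)).
  by rewrite size_filter count_size.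
- by rewrite -e2.
exists c; apply: contra_not hc => h; rewrite big_filter_cond.
have [ec|nc] := eqVneq c (a i).
  by rewrite big_pred0 // => j; rewrite ec; case: (a j == a i).
rewrite -[RHS]h; apply: eq_bigl => j.
by have [->|_] := eqVneq (a j) c; rewrite ?nc ?andbF.
Qed.

Section HighestWeight.
Variables (C : numClosedFieldType) (n : nat) (g : lieSub C n).
Variables (b : set 'M[C]_(n + n)) (chi : 'M[C]_(n + n) -> C).
Variables (H : 'I_n -> set_type g) (hc : 'I_n -> C).
Variables (R : finType) (root : R -> set_type g) (rpar : R -> bool).
Variables (rwt : R -> 'rV[C]_n) (rht : R -> nat).

(** A height functional: [hc] is chosen so that every lowering root takes a negative integer as
    value. One number then measures the depth of a weight, and the three Borel subalgebras are
    covered by one argument. *)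
Definition hval (k : 'rV[C]_n) : C := \sum_i hc i * k 0 i.

Definition is_root (x : set_type g) (p : bool) (w : 'rV[C]_n) : Prop :=
  homog p (val x) /\ forall i,
    val (H i) *m val x - val x *m val (H i) = w 0 i *: val x.

Hypothesis H_even : forall i, homog false (val (H i)).
Hypothesis root_is_root : forall r, is_root (root r) (rpar r) (rwt r).
Hypothesis H_b : forall i, b (val (H i)).
Hypothesis rht_gt0 : forall r, (0 < rht r)%N.
Hypothesis rwt_ht : forall r, hval (rwt r) = - (rht r)%:R.
Hypothesis root_dec : forall x : set_type g, exists (y : set_type g) (c : R -> C),
  b (val y) /\ val x = val y + \sum_r c r *: val (root r).

Definition wvec (M : smod g) (k : 'rV[C]_n) (p : bool) (u : M) :=
  (forall i, smod_act (H i) u = k 0 i *: u) /\ smod_par u = (-1) ^+ p *: u.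

Lemma hvalD k k' : hval (k + k') = hval k + hval k'.
Proof. by rewrite -big_split /=; apply: eq_bigr => i _; rewrite mxE mulrDr. Qed.

Lemma lie_elt X : lie_set g X -> exists x : set_type g, val x = X.
Proof. by move=> gX; exists (SigSub (mem_set gX)). Qed.

Lemma lie_val (x : set_type g) : lie_set g (val x).
Proof. exact: set_mem (valP x). Qed.

Lemma wvec_root (M : smod g) x p w k q (u : M) :
  is_root x p w -> wvec k q u -> wvec (w + k) (p (+) q) (smod_act x u).
Proof.
move=> [hx xw] [uk uq]; have lx := @smod_act_linear _ _ _ M x; split=> [i|]; last first.
  rewrite (smod_act_par _ hx) uq (linear_funZ _ _ lx) scalerA.
  by rewrite signr_addb.
have [z hz] := lie_elt (lie_bracket (H_even i) hx (lie_val _) (lie_val _)).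
have hz' := hz; rewrite /sbracket andFb expr0 scale1r xw in hz.
have := smod_act_bracket u (H_even i) hx hz'.
have [o ho] := lie_elt (lie_sub0 g).
have -> : smod_act z u = w 0 i *: smod_act x u.
  rewrite (@smod_actP _ _ _ _ (w 0 i) x o z); last by rewrite hz ho addr0.
  suff -> : smod_act o u = 0 by rewrite addr0.
  have -> : smod_act o u = 0 *: smod_act x u + smod_act o u.
    by apply: smod_actP; rewrite scale0r add0r.
  rewrite (@smod_actP _ _ _ _ (-1) o o o) ?ho ?scaler0 ?addr0 //.
  by rewrite scaleN1r addNr scale0r addr0.
rewrite /= expr0 scale1r uk (linear_funZ _ _ lx) => /eqP.
rewrite eq_sym subr_eq -scalerDl => /eqP ->.
by rewrite mxE.
Qed.

Section Generated.
Variables (M : smod g) (v : M) (q : bool).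
Hypothesis v_par : smod_par v = (-1) ^+ q *: v.
Hypothesis v_char : char_vector b chi v.
Hypothesis v_gen : generates v.

Inductive root_span : M -> Prop :=
| rs_v : root_span v
| rs_f r w : root_span w -> root_span (smod_act (root r) w)
| rs_lin c u w : root_span u -> root_span w -> root_span (c *: u + w).

Lemma rs_0 : root_span 0.
Proof. by rewrite -(addNr v) -scaleN1r; apply: rs_lin; apply: rs_v. Qed.
Lemma rs_scale c u : root_span u -> root_span (c *: u).
Proof. by move=> hu; rewrite -[c *: u]addr0; apply: rs_lin hu rs_0. Qed.
Lemma rs_add u w : root_span u -> root_span w -> root_span (u + w).
Proof. by rewrite -{2}[u]scale1r; apply: rs_lin. Qed.

Lemma act_dec (x : set_type g) : exists (y : set_type g) (c : R -> C),
  b (val y) /\ forall N (w : smod_car N), smod_act x w =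
    smod_act (g := g) y w + \sum_r c r *: smod_act (root r) w.
Proof.
have [y [c [yb xy]]] := root_dec x; exists y, c; split=> // N w.
have [o ho] := lie_elt (lie_sub0 g).
suff /(_ (index_enum R)) [z hz hw] : forall s, exists2 z : set_type g,
    val z = val y + \sum_(r <- s) c r *: val (root r) &
    smod_act z w = smod_act y w + \sum_(r <- s) c r *: smod_act (root r) w.
  by rewrite -hw; congr (smod_act _ w); apply: val_inj; rewrite /= xy hz.
elim=> [|r s [z hz hw]]; first by exists y; rewrite big_nil addr0.
have [z' hz'] := lie_elt (lie_subP (c r) (lie_val (root r)) (lie_val z)).
exists z'; first by rewrite hz' hz big_cons addrCA.
by rewrite (smod_actP w hz') hw big_cons addrCA.
Qed.

(** Straightening without an order on the root vectors: moving x past [root r] leaves their bracket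
    acting on the shorter word [w], and the induction hypothesis covers every element of g. On [v],
    x is split into a Borel part, acting by a scalar, and lowering root vectors. *)
Lemma root_span_act w : root_span w -> forall x, root_span (smod_act x w).
Proof.
elim=> {w} [|r w sw IH|c u w _ IHu _ IHw] x; last first.
- by rewrite smod_act_linear; apply: rs_lin.
- rewrite act_parts.
  suff hom a (y : set_type g) : homog a (val y) -> root_span (smod_act y (smod_act (root r) w)).
    by apply: rs_add; apply: hom; rewrite val_lie_part; apply: hpart_id.
  move=> hy; have [hr _] := root_is_root r.
  have [z hz] := lie_elt (lie_bracket hy hr (lie_val _) (lie_val _)).
  have /eqP := smod_act_bracket w hy hr hz.
  rewrite eq_sym subr_eq => /eqP ->.
  by apply/rs_add/rs_scale/rs_f/IH/IH.
have [y [c [yb ->]]] := act_dec x.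
rewrite v_char //; apply/rs_add; first by apply/rs_scale/rs_v.
apply: (big_ind root_span); [exact: rs_0|exact: rs_add|].
by move=> r _; apply/rs_scale/rs_f/rs_v.
Qed.

Lemma root_span_par w : root_span w -> root_span (smod_par w).
Proof.
elim=> {w} [|r w sw IH|c u w _ IHu _ IHw].
- by rewrite v_par; apply/rs_scale/rs_v.
- by have [hr _] := root_is_root r; rewrite (smod_act_par _ hr); apply/rs_scale/rs_f.
- by rewrite smod_par_linear; apply: rs_lin.
Qed.

Lemma root_spanT w : root_span w.
Proof.
pose S := SubMod rs_0 rs_lin root_span_par (fun x w h => root_span_act h x).
exact: (generates_sub (S := S)) v_gen rs_v w.
Qed.

Definition top_weight : 'rV[C]_n := \row_i chi (val (H i)).

(** A weight vector with its bookkeeping, in the order ((weight, depth), (parity, vector)).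
    Decompositions are plain lists of such items, with repeated weights allowed, and no weight
    spaces are formed. *)
Definition witem := (('rV[C]_n * nat) * (bool * M))%type.
Definition good_item (it : witem) :=
  [/\ wvec it.1.1 it.2.1 it.2.2, hval it.1.1 = hval top_weight - it.1.2%:R &
      it.1.2 = 0%N -> exists c, it.2.2 = c *: v].

Lemma good_items_root (s : seq witem) r : (forall it, List.In it s -> good_item it) ->
  exists2 s' : seq witem, (forall it, List.In it s' -> good_item it) &
    smod_act (root r) (\sum_(it <- s) it.2.2) = \sum_(it <- s') it.2.2.
Proof.
elim: s => [|it s IH] gs.
  exists [::] => //; rewrite !big_nil; exact/linear_fun0/smod_act_linear.
have [it' h|s' gs' es] := IH; first by apply: gs; right.
have [wu hk _] : good_item it by apply: gs; left.
exists (((rwt r + it.1.1, (rht r + it.1.2)%N), (rpar r (+) it.2.1, smod_act (root r) it.2.2)) :: s').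
  move=> _ [<-|/gs' //]; split=> /=.
  - exact: wvec_root wu.
  - by rewrite hvalD rwt_ht hk natrD opprD addrCA.
  - by move/eqP; rewrite addn_eq0 eqn0Ngt rht_gt0.
by rewrite !big_cons (linear_funD _ _ (@smod_act_linear _ _ _ M _)) es.
Qed.

Lemma weight_decomposition w : exists2 s : seq witem,
  (forall it, List.In it s -> good_item it) & w = \sum_(it <- s) it.2.2.
Proof.
elim: {w} (root_spanT w) => [|r w _ [s gs ->]|c u w _ [s gs ->] _ [s' gs' ->]].
- exists [:: ((top_weight, 0%N), (q, v))]; last by rewrite big_seq1.
  move=> _ [<-|//]; split=> /=; last by move=> _; exists 1; rewrite scale1r.
    by split=> // i; rewrite v_char // mxE.
  by rewrite subr0.
- by have [s' gs' ->] := good_items_root r gs; exists s'.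
- exists ([seq (it.1, (it.2.1, c *: it.2.2)) | it <- s] ++ s').
    move=> it h0; have [h|/gs' //] := List.in_app_or _ _ _ h0.
    have [i [<- /gs [wi hi ci]]] := proj1 (List.in_map_iff _ _ _) h.
    split=> //=; last by move=> /ci [d ->]; exists (c * d); rewrite scalerA.
    case: wi => h1 h2; split=> [j|].
      rewrite (linear_funZ _ _ (@smod_act_linear _ _ _ M _)) h1 !scalerA.
      by rewrite mulrC.
    by rewrite (linear_funZ _ _ (@smod_par_linear _ _ _ M)) h2 !scalerA mulrC.
  by rewrite big_cat /= scaler_sumr big_map.
Qed.

Definition h_act (w : M) : M := \sum_i hc i *: smod_act (H i) w.

Lemma h_act_linear : linear h_act.
Proof.
move=> c u w; rewrite /h_act scaler_sumr -big_split /=; apply: eq_bigr => i _.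
by rewrite smod_act_linear scalerDr !scalerA mulrC.
Qed.

Lemma h_act_wvec k p u : wvec k p u -> h_act u = hval k *: u.
Proof.
by move=> [hu _]; rewrite /h_act scaler_suml; apply: eq_bigr => i _; rewrite hu scalerA.
Qed.

Lemma sub_h_act (S : submod M) w : S w -> S (h_act w).
Proof. by move=> Sw; apply: sub_sum => i _; apply/sub_scale/sub_act. Qed.

Lemma item_component (T : M -> M) (N : submod M) (s : seq witem) (a : witem -> C) c :
  linear T -> (forall w, N w -> N (T w)) ->
  (forall it, List.In it s -> T it.2.2 = a it *: it.2.2) ->
  N (\sum_(it <- s) it.2.2) -> N (\sum_(it <- s | a it == c) it.2.2).
Proof.
move=> lT NT Ta Ns.
(* The eigenvector equation is known for the members of [s] only, while [eigen_component_in] asks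
   for it at every index; the other items get the vector 0. *)
pose u (it : witem) := if `[< T it.2.2 = a it *: it.2.2 >] then it.2.2 else 0.
have E (P : pred witem) : \sum_(it <- s | P it) it.2.2 = \sum_(it <- s | P it) u it.
  elim: s Ta {Ns} => [|it s IH] Ta; first by rewrite !big_nil.
  rewrite !big_cons IH; last by move=> i hi; apply: Ta; right.
  by rewrite /u asboolT //; apply: Ta; left.
rewrite E; rewrite E in Ns.
apply: (@eigen_component_in _ _ T N) => //; [exact: sub0|exact: subP|].
move=> it; rewrite /u; case: asboolP => // _.
by rewrite scaler0; apply: linear_fun0.
Qed.

Definition below (w : M) := exists2 s : seq witem,
  (forall it, List.In it s -> good_item it /\ (0 < it.1.2)%N) & w = \sum_(it <- s) it.2.2.

Lemma good_h_act it : good_item it -> h_act it.2.2 = hval it.1.1 *: it.2.2.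
Proof. by move=> [/h_act_wvec]. Qed.

Lemma natr_inj0 k : (k%:R == 0 :> C) = (k == 0%N).
Proof. by rewrite pnatr_eq0. Qed.

Lemma hval_top it : good_item it -> (hval it.1.1 == hval top_weight) = (it.1.2 == 0%N).
Proof. by move=> [_ -> _]; rewrite -subr_eq0 addrAC subrr add0r oppr_eq0 natr_inj0. Qed.

(** The part of depth 0 of an element of [S] is again in [S], since its height separates it from the
    rest, and it is a multiple c v. A non-zero c would put [v] into [S]. *)
Lemma proper_below (S : submod M) w : ~ S v -> S w -> below w.
Proof.
move=> Sv Sw; have [s gs ws] := weight_decomposition w.
exists [seq it <- s | it.1.2 != 0%N].
  move=> it; rewrite /= lt0n => h.
  have : List.In it s /\ it.1.2 != 0%N.
    elim: s h {gs ws} => //= i s IH; case: ifP => [hi [<-|/IH [? ?]]|_ /IH [? ?]];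
      by split=> //; auto.
  by move=> [/gs].
rewrite big_filter ws (bigID (fun it : witem => it.1.2 == 0%N)) /= [X in X + _](_ : _ = 0) ?add0r //.
have eqP : \sum_(it <- s | it.1.2 == 0%N) it.2.2 =
           \sum_(it <- s | hval it.1.1 == hval top_weight) it.2.2.
  elim: s gs {ws} => [|it s IH] gs; first by rewrite !big_nil.
  rewrite !big_cons IH; last by move=> i hi; apply: gs; right.
  by rewrite hval_top //; apply: gs; left.
have [c hc0] : exists c, \sum_(it <- s | it.1.2 == 0%N) it.2.2 = c *: v.
  elim: s gs {ws eqP} => [|it s IH] gs; first by exists 0; rewrite big_nil scale0r.
  have [|c hc0] := IH; first by move=> i hi; apply: gs; right.
  rewrite big_cons hc0; case: eqP => [i0|_]; last by exists c.
  have [_ _ /(_ i0) [d ->]] : good_item it by apply: gs; left.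
  by exists (d + c); rewrite scalerDl.
have : S (\sum_(it <- s | it.1.2 == 0%N) it.2.2).
  rewrite eqP; apply: (item_component (T := h_act) (a := fun it => hval it.1.1)).
  - exact: h_act_linear.
  - exact: sub_h_act.
  - by move=> it /gs /good_h_act.
  - by rewrite -ws.
rewrite hc0; have [->|c0] := eqVneq c 0; first by rewrite scale0r.
by move=> /(sub_scale c^-1); rewrite scalerA mulVf // scale1r => /Sv.
Qed.

Lemma below0 : below 0. Proof. by exists [::] => //; rewrite big_nil. Qed.
Lemma belowD u w : below u -> below w -> below (u + w).
Proof.
move=> [s gs ->] [s' gs' ->]; exists (s ++ s'); last by rewrite big_cat.
by move=> it h; have [/gs|/gs'] := List.in_app_or _ _ _ h.
Qed.

Lemma top_not_below : v <> 0 -> ~ below v.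
Proof.
move=> v0 [s gs vs]; apply: v0.
(* Adding the item - v turns the expression of [v] into a list with sum 0. Its component at the top
   height is - v alone, which therefore lies in the zero submodule. *)
pose s' := ((top_weight, 0%N), (q, - v)) :: s.
have gtop : good_item ((top_weight, 0%N), (q, - v)).
  split=> /=; [split=> [i|]|by rewrite subr0|by exists (-1); rewrite scaleN1r].
    rewrite -scaleN1r (linear_funZ _ _ (@smod_act_linear _ _ _ M _)) v_char //.
    by rewrite !scalerA mulrC mxE.
  by rewrite -scaleN1r (linear_funZ _ _ (@smod_par_linear _ _ _ M)) v_par !scalerA mulrC.
have := @item_component h_act (zero_submod M) s' (fun it => hval it.1.1)
  (hval top_weight) h_act_linear.
rewrite /s' !big_cons /= eqxx -vs addNr.
have -> : \sum_(j <- s | hval j.1.1 == hval top_weight) j.2.2 = 0.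
  elim: s gs {vs s'} => [|it s IH] gs; first by rewrite big_nil.
  rewrite big_cons IH; last by move=> i hi; apply: gs; right.
  have [git k0] : good_item it /\ (0 < it.1.2)%N by apply: gs; left.
  by rewrite hval_top // eqn0Ngt k0.
rewrite addr0 => /(_ _ _ erefl) h.
apply: oppr_inj; rewrite oppr0; apply: h.
  by move=> w ->; apply/linear_fun0/h_act_linear.
move=> it [<-|/gs [/good_h_act //]]; exact: (good_h_act gtop).
Qed.

(** As [v] generates M, the proper submodules, which generate [rad], are those that miss [v]. Their
    finite sums already form a submodule, and all elements of it are [below]. *)
Inductive proper_sum : M -> Prop :=
| ps0 : proper_sum 0
| ps_add (S : submod M) u w : ~ S v -> S u -> proper_sum w -> proper_sum (u + w).

Lemma rad_not_top : v <> 0 -> ~ rad M v.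
Proof.
move=> v0.
have psD u w : proper_sum u -> proper_sum w -> proper_sum (u + w).
  elim=> [|S u1 w1 Sv Su _ IH] hw; first by rewrite add0r.
  by rewrite -addrA; apply: ps_add Sv Su (IH hw).
have psZ c u : proper_sum u -> proper_sum (c *: u).
  elim=> [|S u1 w1 Sv Su _ IH]; first by rewrite scaler0; apply: ps0.
  by rewrite scalerDr; apply: (ps_add Sv) (sub_scale _ Su) IH.
have psL c u w : proper_sum u -> proper_sum w -> proper_sum (c *: u + w).
  by move=> hu; apply/psD/psZ.
have psP u : proper_sum u -> proper_sum (smod_par u).
  have lp := @smod_par_linear _ _ _ M.
  elim=> [|S u1 w1 Sv Su _ IH]; first by rewrite (linear_fun0 lp); apply: ps0.
  by rewrite (linear_funD _ _ lp); apply: (ps_add Sv) (sub_par Su) IH.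
have psA x u : proper_sum u -> proper_sum (smod_act x u).
  have lp := @smod_act_linear _ _ _ M x.
  elim=> [|S u1 w1 Sv Su _ IH]; first by rewrite (linear_fun0 lp); apply: ps0.
  by rewrite (linear_funD _ _ lp); apply: (ps_add Sv) (sub_act x Su) IH.
have psB u : proper_sum u -> below u.
  elim=> [|S u1 w1 Sv Su _ IH]; first exact: below0.
  exact: belowD (proper_below Sv Su) IH.
move=> /(_ (SubMod ps0 psL psP psA)) h; apply: (top_not_below v0); apply: psB.
apply: h => u [S ST Su]; rewrite /= -[u]addr0.
apply: ps_add Su ps0 => Sv; apply: ST.
by apply/seteqP; split=> // w _; apply: generates_sub Sv w.
Qed.

Section Singular.
Variables (R' : finType) (proot : R' -> set_type g) (ppar : R' -> bool).
Variables (pwt : R' -> 'rV[C]_n) (pht : R' -> nat).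
Hypothesis proot_is_root : forall r, is_root (proot r) (ppar r) (pwt r).
Hypothesis pht_gt0 : forall r, (0 < pht r)%N.
Hypothesis pwt_ht : forall r, hval (pwt r) = (pht r)%:R.

(** Components are taken successively for the operators in [l]: [Some i] stands for [H i], and
    [None] for the parity involution. Once [l] lists all of them, the surviving items share one
    weight and one parity. *)
Lemma joint_component (N : submod M) (s : seq witem) (l : seq (option 'I_n)) :
  let ev j (it : witem) := if j is Some i then it.1.1 0 i else (-1) ^+ it.2.1 in
  (forall it, List.In it s -> good_item it) ->
  N (\sum_(it <- s) it.2.2) -> \sum_(it <- s) it.2.2 <> 0 ->
  exists s' : seq witem,
  [/\ forall it, List.In it s' -> good_item it,
      N (\sum_(it <- s') it.2.2), \sum_(it <- s') it.2.2 <> 0 &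
      forall j, j \in l -> exists c, forall it, List.In it s' -> ev j it = c].
Proof.
move=> ev gs Ns s0; elim: l => [|j l [s' [gs' Ns' s0' hl]]]; first by exists s.
have [c hc0] := sum_component_neq0 (ev j) s0'.
have inF it : List.In it [seq i <- s' | ev j i == c] -> List.In it s' /\ ev j it = c.
  elim: s' {gs' Ns' s0' hl hc0} => //= i t IH; case: eqP => [hi [<-|/IH [? ?]]|_ /IH [? ?]];
    by split=> //; auto.
exists [seq it <- s' | ev j it == c]; rewrite big_filter; split=> //.
- by move=> it /inF [/gs'].
- pose T : M -> M := fun w => if j is Some i then smod_act (H i) w else smod_par w.
  apply: (item_component (T := T)) => //.
  + by rewrite /T; case: (j) => [i|]; [apply: smod_act_linear|apply: smod_par_linear].
  + by rewrite /T => w; case: (j) => [i|]; [apply: sub_act|apply: sub_par].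
  + by rewrite /T /ev => it /gs' [[h1 h2] _ _]; case: (j) => [i|].
- move=> j'; rewrite inE => /orP [/eqP ->|/hl [d hd]].
    by exists c => it /inF [].
  by exists d => it /inF [/hd].
Qed.

Lemma wvec_component (N : submod M) u : N u -> u <> 0 ->
  exists w k m p, [/\ N w, w <> 0, wvec k p w & hval k = hval top_weight - m%:R].
Proof.
have [s gs ->] := weight_decomposition u => Ns s0.
have [s' [gs' Ns' s0' hl]] := joint_component (enum {: option 'I_n}) gs Ns s0.
case: s' gs' Ns' s0' hl => [|it0 s']; first by rewrite big_nil.
move=> gs' Ns' s0' hl; have [_ h0 _] := gs' it0 (or_introl erefl).
exists (\sum_(it <- it0 :: s') it.2.2), it0.1.1, it0.1.2, it0.2.1; split=> //.
have sumP (T : M -> M) c : linear T ->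
    (forall it, List.In it (it0 :: s') -> T it.2.2 = c *: it.2.2) ->
    T (\sum_(it <- it0 :: s') it.2.2) = c *: (\sum_(it <- it0 :: s') it.2.2).
  move=> lT; elim: (it0 :: s') => [|it t IH] hT.
    by rewrite big_nil scaler0 (linear_fun0 lT).
  rewrite big_cons (linear_funD _ _ lT) scalerDr IH; last by move=> i hi; apply: hT; right.
  by rewrite hT //; left.
split=> [i|]; apply: sumP.
- exact: smod_act_linear.
- move=> it iit; have [[-> _] _ _] := gs' _ iit.
  have [|c hE] := hl (Some i); first by rewrite mem_enum.
  by rewrite (hE _ iit) (hE it0 (or_introl erefl)).
- exact: smod_par_linear.
- move=> it iit; have [[_ ->] _ _] := gs' _ iit.
  have [|c hE] := hl None; first by rewrite mem_enum.
  by rewrite (hE _ iit) (hE it0 (or_introl erefl)).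
Qed.

(** Take a weight vector of minimal depth in [N]: a raising operator decreases the depth, so it must
    give 0. *)
Lemma exists_singular (N : submod M) u : N u -> u <> 0 ->
  exists w k p, [/\ N w, w <> 0, wvec k p w & forall r, smod_act (proot r) w = 0].
Proof.
move=> Nu u0.
pose P m := `[< exists w k p, [/\ N w, w <> 0, wvec k p w & hval k = hval top_weight - m%:R] >].
have exP : exists m, P m.
  by have [w [k [m [p h]]]] := wvec_component Nu u0; exists m; apply/asboolP; exists w, k, p.
case: (ex_minnP exP) => m /asboolP [w [k [p [Nw w0 wk hk]]]] min_m.
exists w, k, p; split=> // r; apply: contrapT => rw0.
have rk := wvec_root (proot_is_root r) wk.
have [s gs rs] := weight_decomposition (smod_act (proot r) w).
have hrk : hval (pwt r + k) = hval top_weight - m%:R + (pht r)%:R.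
  by rewrite hvalD pwt_ht hk addrC.
suff [m' m'm] : exists2 m', (m' < m)%N & hval (pwt r + k) = hval top_weight - m'%:R.
  move=> hm'; suff /min_m : P m' by rewrite leqNgt m'm.
  by apply/asboolP; exists (smod_act (proot r) w), (pwt r + k), (ppar r (+) p); split=> //; apply: sub_act.
(* The height of the raised vector occurs in its decomposition, for otherwise its component at that
   height, which is the vector itself, would be 0. Hence its depth is again a natural number. *)
have [it iit hit] : exists2 it, List.In it s & hval it.1.1 = hval (pwt r + k).
  apply: contrapT => nit; apply: rw0.
  pose s' := ((pwt r + k, 0%N), (ppar r (+) p, - smod_act (proot r) w)) :: s.
  have := @item_component h_act (zero_submod M) s' (fun it => hval it.1.1)
    (hval (pwt r + k)) h_act_linear.
  rewrite /s' !big_cons /= eqxx -rs addNr.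
  have -> : \sum_(j <- s | hval j.1.1 == hval (pwt r + k)) j.2.2 = 0.
    elim: s nit {gs rs s'} => [|it s IH] nit; first by rewrite big_nil.
    rewrite big_cons IH; last by move=> [i hi ei]; apply: nit; exists i => //; right.
    by case: eqP => // e; case: nit; exists it => //; left.
  rewrite addr0 => /(_ _ _ erefl) h.
  apply: oppr_inj; rewrite oppr0; apply: h.
    by move=> x ->; apply/linear_fun0/h_act_linear.
  move=> it [<-|/gs /good_h_act //] /=.
  by rewrite -scaleN1r (linear_funZ _ _ h_act_linear) (h_act_wvec rk) !scalerA mulrC.
have [_ hi _] := gs _ iit; exists it.1.2; last by rewrite -hit.
have /eqP : (m%:R : C) = (it.1.2 + pht r)%:R.
  move: hit; rewrite hi hrk -addrA => /addrI /eqP.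
  by rewrite eqr_oppLR opprD opprK eq_sym subr_eq natrD => /eqP.
by rewrite eqr_nat => /eqP ->; rewrite -[X in (X < _)%N]addn0 ltn_add2l.
Qed.
End Singular.
End Generated.

(** The map F sends the induced module onto [N]. If F mapped [rad] onto [N], then t = F r with r in
    [rad], and r - v would lie in the kernel of F, a proper submodule and so a part of [rad]; then v
    would be in [rad]. By simplicity F kills [rad], and its kernel, being proper, is contained in
    [rad]. *)
Lemma simple_quo_embed (P : smod g) (N : submod P) (t : P) (q : bool) :
  simple_sub N -> N t -> t <> 0 -> smod_par t = (-1) ^+ q *: t -> char_vector b chi t ->
  exists f : shom (pshift q (simple_quo (induced g b chi))) P,
    injective f /\ range f = sub_set N.
Proof.
move=> [_ N_simple] Nt t0 t_par t_char.
set D := induced g b chi; set v := ind_gen g b chi.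
have [F Fv] := ind_hom_shift t_par t_char.
have v0 : v <> 0 by move=> v0; apply: t0; rewrite -Fv -/v v0; apply/linear_fun0/(shom_linear F).
have rad_v : ~ rad D v.
  apply: (rad_not_top (q := false)) v0; first by rewrite scale1r; apply: ind_gen_par.
  - exact: ind_gen_char.
  - exact: ind_gen_generates.
pose F' := shom_shift F.
have FN w : N (F w).
  by have [u ->] := ind_gen_generates w; rewrite (shom_umod F') umod_pshift Fv; apply: sub_umod.
have rad_ker w : rad D w -> F w = 0.
  move=> rw.
  pose S := unshift_submod (image_submod F' (rad D)).
  have [|S0|SN] := N_simple S; first by move=> _ [u _ <-]; apply: FN.
    by have : sub_set S (F w); [exists w|rewrite S0].
  have : sub_set S t by rewrite SN.
  move=> [r rr Fr]; case: rad_v.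
  have : rad D (r - v).
    move=> T; apply; exists (ker_submod F'); last first.
      change (F (r - v) = 0); by rewrite -(linear_funB _ _ (shom_linear F)) Fr Fv subrr.
    move=> KT; apply: t0; rewrite -Fv.
    by have : sub_set (ker_submod F') v by rewrite KT.
  by move=> rv; rewrite -[v](subKr r); apply: subD rr _; apply: subN.
pose Q := quo_hom (f := F') rad_ker.
have QE w : Q (quo_pi _ w) = F w by exact: (quo_homE (f := F') rad_ker).
exists (shom_unshift Q); split.
- suff ker0 x : Q x = 0 -> x = 0.
    move=> x y /= /eqP; rewrite -subr_eq0 (linear_funB _ _ (shom_linear Q)) => /eqP /ker0 /eqP.
    by rewrite subr_eq0 => /eqP.
  elim/quo_ind: x => w; rewrite QE => Fw.
  rewrite -(linear_fun0 (@quo_pi_linear _ _ _ _ (rad D))).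
  apply/quo_piP; rewrite subr0 => T; apply; exists (ker_submod F') => // KT.
  apply: t0; rewrite -Fv.
  by have : sub_set (ker_submod F') v by rewrite KT.
- apply/seteqP; split=> [_ [x _ <-] /=|w Nw].
    by elim/quo_ind: x => w; have := FN w; rewrite -QE.
  have [|S0|SN] := N_simple (unshift_submod (im_submod Q)).
  + by move=> _ [x _ <-]; elim/quo_ind: x => x; have := FN x; rewrite -QE.
  + have : sub_set (unshift_submod (im_submod Q)) t by exists (quo_pi _ v) => //; rewrite QE.
    by rewrite S0.
  + by have : sub_set (unshift_submod (im_submod Q)) w by rewrite SN.
Qed.
End HighestWeight.

(** * Elements and Borel subalgebras of pe(n) *)

Section PeriplecticElements.
Variables (C : numClosedFieldType) (n : nat).
Implicit Types (A B D : 'M[C]_n).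

Lemma linear_fun_sum (U V : lmodType C) (f : U -> V) (I : Type) (r : seq I)
    (P : pred I) (F : I -> U) : linear f ->
  f (\sum_(i <- r | P i) F i) = \sum_(i <- r | P i) f (F i).
Proof.
move=> lf; apply: (big_morph f) => [x y|]; [exact: linear_funD|exact: linear_fun0].
Qed.

Lemma linear_fun_delta (V : lmodType C) (f : 'M[C]_n -> V) A : linear f ->
  f A = \sum_i \sum_j A i j *: f (delta_mx i j).
Proof.
move=> lf; rewrite {1}(matrix_sum_delta A) (linear_fun_sum _ _ _ lf).
apply: eq_bigr => i _; rewrite (linear_fun_sum _ _ _ lf).
by apply: eq_bigr => j _; rewrite (linear_funZ _ _ lf).
Qed.

(** pe(n) is parametrised linearly by unrestricted matrices: [mx1] symmetrises and [mxm]
    antisymmetrises, so that [delta_mx] can serve as argument. The price is a factor 2, whence the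
    halves in [in_pe_sum] and later. *)
Definition mx0 A : 'M[C]_(n + n) := block_mx A 0 0 (- A^T).
Definition mx1 B : 'M[C]_(n + n) := block_mx 0 (B + B^T) 0 0.
Definition mxm D : 'M[C]_(n + n) := block_mx 0 0 (D - D^T) 0.

Lemma mx0_linear : linear mx0.
Proof.
move=> c A B; rewrite /mx0 scale_block_mx add_block_mx !scaler0 !addr0.
by rewrite linearP /= opprD scalerN.
Qed.
Lemma mx1_linear : linear mx1.
Proof.
move=> c A B; rewrite /mx1 scale_block_mx add_block_mx !scaler0 !addr0.
by rewrite linearP /= scalerDr addrACA.
Qed.
Lemma mxm_linear : linear mxm.
Proof.
move=> c A B; rewrite /mxm scale_block_mx add_block_mx !scaler0 !addr0.
by rewrite linearP /= opprD scalerBr addrACA.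
Qed.

Lemma mx0_homog A : homog false (mx0 A).
Proof. by rewrite /homog /hpart /mx0 block_mxKul block_mxKdr. Qed.
Lemma mx1_homog A : homog true (mx1 A).
Proof. by rewrite /homog /hpart /mx1 block_mxKur block_mxKdl. Qed.
Lemma mxm_homog A : homog true (mxm A).
Proof. by rewrite /homog /hpart /mxm block_mxKur block_mxKdl. Qed.

Lemma mx0_pe A : in_pe (mx0 A).
Proof. by split; rewrite /mx0 ?block_mxKul ?block_mxKur ?block_mxKdl ?block_mxKdr ?trmx0 ?oppr0. Qed.
Lemma mx1_pe A : in_pe (mx1 A).
Proof.
split; rewrite /mx1 ?block_mxKul ?block_mxKur ?block_mxKdl ?block_mxKdr ?trmx0 ?oppr0 //.
by rewrite linearD /= trmxK addrC.
Qed.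
Lemma mxm_pe A : in_pe (mxm A).
Proof.
split; rewrite /mxm ?block_mxKul ?block_mxKur ?block_mxKdl ?block_mxKdr ?trmx0 ?oppr0 //.
by rewrite linearB /= trmxK opprB.
Qed.
Lemma mx0_pe_even A : in_pe_even (mx0 A).
Proof. by split; [apply: mx0_pe|apply: mx0_homog]. Qed.

Lemma bracket00 A B : sbracket false false (mx0 A) (mx0 B) = mx0 (A *m B - B *m A).
Proof.
rewrite /sbracket /= expr0 scale1r /mx0 !mulmx_block !mul0mx !mulmx0 !addr0 !add0r.
rewrite opp_block_mx add_block_mx !subr0 !mulNmx !mulmxN !opprK; congr block_mx.
by rewrite linearB /= !trmx_mul opprB.
Qed.
Lemma bracket01 A B : sbracket false true (mx0 A) (mx1 B) = mx1 (A *m B + B *m A^T).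
Proof.
rewrite /sbracket /= expr0 scale1r /mx0 /mx1 !mulmx_block !mul0mx !mulmx0 !addr0 !add0r.
rewrite opp_block_mx add_block_mx !subr0 !mulmxN !opprK; congr block_mx.
by rewrite [(_ *m _ + _)^T]linearD /= !trmx_mul trmxK mulmxDr mulmxDl [X in _ = _ + X]addrC addrACA.
Qed.
Lemma bracket0m A D : sbracket false true (mx0 A) (mxm D) = mxm (- (A^T *m D + D *m A)).
Proof.
rewrite /sbracket /= expr0 scale1r /mx0 /mxm !mulmx_block !mul0mx !mulmx0 !addr0 !add0r.
rewrite opp_block_mx add_block_mx !subr0 !mulNmx; congr block_mx.
rewrite [(- _)^T]linearN /= [(_ *m _ + _)^T]linearD /= !trmx_mul trmxK.
rewrite mulmxBr mulmxBl !opprB ?opprK !opprD ?opprK.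
by rewrite [_ - D *m A]addrC [A^T *m D^T - _]addrC addrACA [_ + D^T *m A]addrC.
Qed.
Lemma bracket1m B D : sbracket true true (mx1 B) (mxm D) = mx0 ((B + B^T) *m (D - D^T)).
Proof.
rewrite /sbracket /= expr1 scaleN1r opprK /mx0 /mx1 /mxm !mulmx_block !mul0mx !mulmx0 !addr0 !add0r.
rewrite add_block_mx !addr0 !add0r; congr block_mx.
by rewrite trmx_mul [(_ - _)^T]linearB [(_ + _)^T]linearD /= !trmxK -mulNmx opprB [B^T + B]addrC.
Qed.
Lemma bracketmm D D' : sbracket true true (mxm D) (mxm D') = 0.
Proof.
rewrite /sbracket /= expr1 scaleN1r opprK /mxm !mulmx_block !mul0mx !mulmx0 !addr0.
by rewrite add_block_mx !addr0 block_mx0.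
Qed.

Lemma in_pe_sum X : in_pe X ->
  X = mx0 (ulsubmx X) + mx1 (2^-1 *: ursubmx X) + mxm (2^-1 *: dlsubmx X).
Proof.
move=> [X1 X2 X3]; rewrite /mx0 /mx1 /mxm !add_block_mx !addr0 !add0r -{1}[X]submxK X1.
have half m (Z : 'M[C]_m) : 2^-1 *: Z + 2^-1 *: Z = Z.
  by rewrite -scalerDl -mulr2n -[_ *+ 2]mulr_natr mulVf ?scale1r // pnatr_eq0.
rewrite ![(_ *: _)^T]linearZ /= X2 X3. by rewrite scalerN opprK !half.
Qed.

Definition e0 A : set_type (pe C n) := SigSub (mem_set (mx0_pe A)).
Definition e1 A : set_type (pe C n) := SigSub (mem_set (mx1_pe A)).
Definition em A : set_type (pe C n) := SigSub (mem_set (mxm_pe A)).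
Definition z0 A : set_type (pe_even C n) := SigSub (mem_set (mx0_pe_even A)).

Section Operators.
Variable M : smod (pe C n).
Implicit Type v : M.

Lemma act_linear_in (f : 'M[C]_n -> 'M[C]_(n + n)) (e : 'M[C]_n -> set_type (pe C n)) v :
  linear f -> (forall A, val (e A) = f A) -> linear (fun A => smod_act (e A) v).
Proof. by move=> lf ef c A B; apply: smod_actP; rewrite !ef lf. Qed.

Lemma act0_linear v : linear (fun A => smod_act (e0 A) v).
Proof. exact: act_linear_in mx0_linear _. Qed.
Lemma act1_linear v : linear (fun A => smod_act (e1 A) v).
Proof. exact: act_linear_in mx1_linear _. Qed.
Lemma actm_linear v : linear (fun A => smod_act (em A) v).
Proof. exact: act_linear_in mxm_linear _. Qed.

Lemma act_pe (x : set_type (pe C n)) v : smod_act x v =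
  smod_act (e0 (ulsubmx (val x))) v + smod_act (e1 (2^-1 *: ursubmx (val x))) v
  + smod_act (em (2^-1 *: dlsubmx (val x))) v.
Proof.
have [z hz] : exists z : set_type (pe C n),
    val z = mx0 (ulsubmx (val x)) + mx1 (2^-1 *: ursubmx (val x)).
  apply: lie_elt; rewrite -[mx0 _]scale1r; apply: in_peP; [exact: mx0_pe|exact: mx1_pe].
rewrite -[X in X + _]scale1r -[X in 1 *: (X + _)]scale1r.
rewrite -(@smod_actP _ _ _ _ 1 _ _ z v) ?hz ?scale1r //.
rewrite -[X in X + _]scale1r; apply: smod_actP; rewrite hz scale1r.
by apply: in_pe_sum; exact: (lie_val x).
Qed.

Lemma act0m A D v : smod_act (em (- (A^T *m D + D *m A))) v =
  smod_act (e0 A) (smod_act (em D) v) - smod_act (em D) (smod_act (e0 A) v).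
Proof.
rewrite (@smod_act_bracket _ _ _ M false true (e0 A) (em D)) /= ?scale1r ?bracket0m //;
  [exact: mx0_homog|exact: mxm_homog].
Qed.
Lemma act01 A B v : smod_act (e1 (A *m B + B *m A^T)) v =
  smod_act (e0 A) (smod_act (e1 B) v) - smod_act (e1 B) (smod_act (e0 A) v).
Proof.
rewrite (@smod_act_bracket _ _ _ M false true (e0 A) (e1 B)) /= ?scale1r ?bracket01 //;
  [exact: mx0_homog|exact: mx1_homog].
Qed.
Lemma act1m B D v : smod_act (e0 ((B + B^T) *m (D - D^T))) v =
  smod_act (e1 B) (smod_act (em D) v) + smod_act (em D) (smod_act (e1 B) v).
Proof.
rewrite (@smod_act_bracket _ _ _ M true true (e1 B) (em D)) /= ?(scaleN1r, opprK) ?bracket1m //;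
  [exact: mx1_homog|exact: mxm_homog].
Qed.
Lemma actmm D D' v :
  smod_act (em D) (smod_act (em D') v) + smod_act (em D') (smod_act (em D) v) = 0.
Proof.
have : smod_act (em 0) v = 0 by exact: (linear_fun0 (actm_linear v)).
rewrite (@smod_act_bracket _ _ _ M true true (em D) (em D')) /= ?scaleN1r ?opprK //;
  [exact: mxm_homog|exact: mxm_homog|].
by rewrite bracketmm; apply/linear_fun0/mxm_linear.
Qed.
End Operators.

Section EvenOperators.
Variable M : smod (pe_even C n).
Implicit Type v : M.

Lemma actz_linear v : linear (fun A => smod_act (z0 A) v).
Proof. by move=> c A B; apply: smod_actP; rewrite /= mx0_linear. Qed.

Lemma act_pe_even (x : set_type (pe_even C n)) v :
  smod_act x v = smod_act (z0 (ulsubmx (val x))) v.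
Proof.
congr (smod_act _ v); apply: val_inj; rewrite /=.
have [] : in_pe_even (val x) by exact: (lie_val x).
by move=> [X1 _ _] hX; rewrite -[LHS]hX /hpart X1.
Qed.

Lemma actzz A B v : smod_act (z0 (A *m B - B *m A)) v =
  smod_act (z0 A) (smod_act (z0 B) v) - smod_act (z0 B) (smod_act (z0 A) v).
Proof.
rewrite (@smod_act_bracket _ _ _ M false false (z0 A) (z0 B)) /= ?scale1r ?bracket00 //;
  [exact: mx0_homog|exact: mx0_homog].
Qed.

Lemma actz_par A v : smod_par (smod_act (z0 A) v) = smod_act (z0 A) (smod_par v).
Proof. by rewrite (smod_act_par (a := false)) ?scale1r //; apply: mx0_homog. Qed.
End EvenOperators.

End PeriplecticElements.
Arguments mx0_linear {C n}.
Arguments mx1_linear {C n}.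
Arguments mxm_linear {C n}.

(** * Characters of the Borel subalgebras, root vectors and heights *)

Section BorelCharacters.
Variables (C : numClosedFieldType) (n : nat).
Implicit Types (A B D : 'M[C]_n) (k lam : weight C n).

Definition upmx A := forall i j : 'I_n, (j < i)%N -> A i j = 0.
Definition wtr k A : C := \sum_i k 0 i * A i i.

Lemma ul_mx0 A : ulsubmx (mx0 A) = A. Proof. exact: block_mxKul. Qed.
Lemma ul_mx1 A : ulsubmx (mx1 A) = 0. Proof. exact: block_mxKul. Qed.
Lemma ul_mxm A : ulsubmx (mxm A) = 0. Proof. exact: block_mxKul. Qed.

Lemma block_ulD (X Y : 'M[C]_(n + n)) : ulsubmx (X + Y) = ulsubmx X + ulsubmx Y.
Proof. by apply/matrixP => i j; rewrite !mxE. Qed.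
Lemma block_dlD (X Y : 'M[C]_(n + n)) : dlsubmx (X + Y) = dlsubmx X + dlsubmx Y.
Proof. by apply/matrixP => i j; rewrite !mxE. Qed.
Lemma block_urD (X Y : 'M[C]_(n + n)) : ursubmx (X + Y) = ursubmx X + ursubmx Y.
Proof. by apply/matrixP => i j; rewrite !mxE. Qed.

Lemma mx0_borel_even A : upmx A -> borel_even (mx0 A).
Proof. by move=> uA; split; [apply: mx0_pe_even|rewrite ul_mx0]. Qed.
Lemma mx1_plus A : pe_plus (mx1 A).
Proof. by split; [apply: mx1_pe|rewrite /mx1 ?block_mxKul ?block_mxKdr ?block_mxKdl]. Qed.
Lemma mxm_minus A : pe_minus (mxm A).
Proof. by split; [apply: mxm_pe|rewrite /mxm ?block_mxKul ?block_mxKdr ?block_mxKur]. Qed.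

Lemma upmx0 : upmx 0. Proof. by move=> i j _; rewrite mxE. Qed.
Lemma mx00 : mx0 (0 : 'M[C]_n) = 0. Proof. exact/linear_fun0/mx0_linear. Qed.
Lemma mx10 : mx1 (0 : 'M[C]_n) = 0. Proof. exact/linear_fun0/mx1_linear. Qed.
Lemma mxm0 : mxm (0 : 'M[C]_n) = 0. Proof. exact/linear_fun0/mxm_linear. Qed.

Lemma borel_sum A B : upmx A -> borel (mx0 A + mx1 B).
Proof. by move=> uA; exists (mx0 A); [exact: mx0_borel_even|exists (mx1 B) => //; exact: mx1_plus]. Qed.
Lemma borel_rev_sum A B : upmx A -> borel_rev (mx0 A + mxm B).
Proof. by move=> uA; exists (mx0 A); [exact: mx0_borel_even|exists (mxm B) => //; exact: mxm_minus]. Qed.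

Lemma wchar_mx0 k A : wchar k (mx0 A) = wtr k A.
Proof. by rewrite /wchar ul_mx0. Qed.

Section Even.
Variable M : smod (pe_even C n).
Lemma char_evenP k (w : M) : char_vector (@borel_even C n) (wchar k) w <->
  forall A, upmx A -> smod_act (z0 A) w = wtr k A *: w.
Proof.
split=> [h A uA|h x [hx ux]].
  by rewrite h ?wchar_mx0 //; apply: mx0_borel_even.
by rewrite act_pe_even h.
Qed.
End Even.

Section Full.
Variable M : smod (pe C n).

Lemma char_borelP k (w : M) : char_vector (@borel C n) (wchar k) w <->
  (forall A, upmx A -> smod_act (e0 A) w = wtr k A *: w) /\
  (forall B, smod_act (e1 B) w = 0).
Proof.
split=> [h|[h0 h1] x [X [hX uX] [Y [hY [Y1 Y2 Y3]] e]]].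
  split=> [A uA|B].
    by rewrite h ?wchar_mx0 //= -[mx0 A]addr0 -mx10; apply: borel_sum.
  rewrite h; last by rewrite /= -[mx1 B]add0r -mx00; apply: borel_sum upmx0.
  rewrite /wchar ul_mx1 big1 ?scale0r // => i _; by rewrite mxE mulr0.
have [_ hX0] := hX.
have dlX : dlsubmx X = 0 by rewrite -hX0 /hpart block_mxKdl.
have ule : ulsubmx (val x) = ulsubmx X.
  by rewrite -e block_ulD ?Y1 ?addr0.
have dle : dlsubmx (val x) = 0.
  by rewrite -e block_dlD ?Y3 ?dlX ?addr0.
rewrite act_pe h1 dle scaler0 (linear_fun0 (actm_linear w)) !addr0 /wchar ule.
exact: h0.
Qed.

Lemma char_borel_revP k (w : M) : char_vector (@borel_rev C n) (wchar k) w <->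
  (forall A, upmx A -> smod_act (e0 A) w = wtr k A *: w) /\
  (forall B, smod_act (em B) w = 0).
Proof.
split=> [h|[h0 h1] x [X [hX uX] [Y [hY [Y1 Y2 Y3]] e]]].
  split=> [A uA|B].
    by rewrite h ?wchar_mx0 //= -[mx0 A]addr0 -mxm0; apply: borel_rev_sum.
  rewrite h; last by rewrite /= -[mxm B]add0r -mx00; apply: borel_rev_sum upmx0.
  rewrite /wchar ul_mxm big1 ?scale0r // => i _; by rewrite mxE mulr0.
have [_ hX0] := hX.
have urX : ursubmx X = 0 by rewrite -hX0 /hpart block_mxKur.
have ule : ulsubmx (val x) = ulsubmx X.
  by rewrite -e block_ulD ?Y1 ?addr0.
have ure : ursubmx (val x) = 0.
  by rewrite -e block_urD ?Y3 ?urX ?addr0.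
rewrite act_pe h1 ure scaler0 (linear_fun0 (act1_linear w)) !addr0 /wchar ule.
exact: h0.
Qed.
End Full.

Notation pairs := ('I_n * 'I_n)%type.
Implicit Types p : pairs.

Definition lowE p : 'M[C]_n := if (p.2 < p.1)%N then delta_mx p.1 p.2 else 0.
Definition upE p : 'M[C]_n := if (p.1 < p.2)%N then delta_mx p.1 p.2 else 0.
Definition dE p : 'M[C]_n := delta_mx p.1 p.2.

Lemma eps_eval (i j : 'I_n) : eps C i 0 j = (i == j)%:R.
Proof. by rewrite mxE eqxx eq_sym. Qed.

Lemma delta_kk_mul p i : delta_mx i i *m dE p = (p.1 == i)%:R *: dE p.
Proof. by rewrite mul_delta_mx_cond scaler_nat [i == _]eq_sym; case: (eqVneq p.1 i) => [<-|]. Qed.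
Lemma mul_delta_kk p i : dE p *m delta_mx i i = (p.2 == i)%:R *: dE p.
Proof. by rewrite mul_delta_mx_cond scaler_nat; case: (eqVneq p.2 i) => [<-|]. Qed.

Definition Hz (i : 'I_n) : set_type (pe_even C n) := z0 (delta_mx i i).
Definition H0 (i : 'I_n) : set_type (pe C n) := e0 (delta_mx i i).

Lemma bracket00_wt A p i : A = dE p \/ A = 0 ->
  mx0 (delta_mx i i) *m mx0 A - mx0 A *m mx0 (delta_mx i i) = (eps C p.1 - eps C p.2) 0 i *: mx0 A.
Proof.
have := bracket00 (delta_mx i i) A; rewrite /sbracket /= scale1r => ->.
case=> ->; last by rewrite mul0mx mulmx0 subr0 mx00 scaler0.
rewrite delta_kk_mul mul_delta_kk -scalerBl -(linear_funZ _ _ mx0_linear).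
by rewrite !mxE !eqxx ![i == _]eq_sym.
Qed.

Lemma bracket01_wt p i :
  mx0 (delta_mx i i) *m mx1 (dE p) - mx1 (dE p) *m mx0 (delta_mx i i) = (eps C p.1 + eps C p.2) 0 i *: mx1 (dE p).
Proof.
have := bracket01 (delta_mx i i) (dE p); rewrite /sbracket /= scale1r => ->.
rewrite trmx_delta delta_kk_mul mul_delta_kk -scalerDl -(linear_funZ _ _ mx1_linear).
by rewrite !mxE !eqxx ![i == _]eq_sym.
Qed.

Lemma bracket0m_wt p i :
  mx0 (delta_mx i i) *m mxm (dE p) - mxm (dE p) *m mx0 (delta_mx i i) = (- (eps C p.1 + eps C p.2)) 0 i *: mxm (dE p).
Proof.
have := bracket0m (delta_mx i i) (dE p); rewrite /sbracket /= scale1r => ->.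
rewrite trmx_delta delta_kk_mul mul_delta_kk -scalerDl -scaleNr -(linear_funZ _ _ mxm_linear).
by rewrite !mxE !eqxx ![i == _]eq_sym.
Qed.

(* Pairs that give no root carry the zero root vector; the weight assigned to
   them only has to have a prescribed height. *)
Definition root_wt0 (up : bool) (c : 'I_n -> C) p : 'rV[C]_n :=
  if (if up then p.1 < p.2 else p.2 < p.1)%N then eps C p.1 - eps C p.2
  else (-1) ^+ (~~ up) *: ((c p.1)^-1 *: eps C p.1).
Definition root_ht0 (up : bool) p : nat :=
  if (if up then p.1 < p.2 else p.2 < p.1)%N then (if up then p.2 - p.1 else p.1 - p.2)%N else 1%N.

Lemma hval_eps (c : 'I_n -> C) i : hval c (eps C i) = c i.
Proof.
rewrite /hval (bigD1 i) //= eps_eval eqxx mulr1 big1 ?addr0 // => j ji.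
by rewrite eps_eval eq_sym (negbTE ji) mulr0.
Qed.
Lemma hvalZ (c : 'I_n -> C) a k : hval c (a *: k) = a * hval c k.
Proof. by rewrite /hval mulr_sumr; apply: eq_bigr => i _; rewrite mxE mulrCA. Qed.
Lemma hvalN (c : 'I_n -> C) k : hval c (- k) = - hval c k.
Proof. by rewrite -scaleN1r hvalZ mulN1r. Qed.

Lemma root_ht0_gt0 up p : (0 < root_ht0 up p)%N.
Proof. by rewrite /root_ht0; case: up; case: ifP => //; rewrite subn_gt0. Qed.

Lemma root_wt0_ht (up : bool) (c : 'I_n -> C) p :
  (forall i, c i != 0) -> (forall i j : 'I_n, (j < i)%N -> c i - c j = - (i - j)%:R) ->
  hval c (root_wt0 up c p) = (-1) ^+ (~~ up) * (root_ht0 up p)%:R.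
Proof.
move=> c0 cd; rewrite /root_wt0 /root_ht0; case: up => /=; case: ifP => h.
- by rewrite hvalD hvalN !hval_eps expr0 mul1r -opprB cd // opprK.
- by rewrite !hvalZ hval_eps mulVf.
- by rewrite hvalD hvalN !hval_eps cd // mulN1r.
- by rewrite !hvalZ hval_eps mulVf.
Qed.

(** Coefficients of the two height functionals. Both drop by one as the index grows, so epsilon_i -
    epsilon_j with j < i has height j - i. The values of [cpos] are positive, which makes the
    weights - epsilon_i - epsilon_j of g_{-1} lowering; those of [cneg] are negative, which does the
    same for the weights of g_1 with respect to the reverse Borel subalgebra. *)
Definition cpos (i : 'I_n) : C := (n - i)%:R.
Definition cneg (i : 'I_n) : C := - i.+1%:R.

Lemma cpos_neq0 i : cpos i != 0. Proof. by rewrite pnatr_eq0 subn_eq0 -ltnNge. Qed.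
Lemma cneg_neq0 i : cneg i != 0. Proof. by rewrite oppr_eq0 pnatr_eq0. Qed.
Lemma cposB (i j : 'I_n) : (j < i)%N -> cpos i - cpos j = - (i - j)%:R.
Proof.
move=> ji; rewrite /cpos !natrB ?(ltnW (ltn_ord _)) //; last exact: ltnW.
by rewrite opprB addrC addrA subrK opprB.
Qed.
Lemma cnegB (i j : 'I_n) : (j < i)%N -> cneg i - cneg j = - (i - j)%:R.
Proof.
move=> ji; rewrite /cneg opprK -!natr1 natrB ?(ltnW ji) // opprB opprD.
by rewrite [j%:R + 1]addrC addrA subrK addrC.
Qed.

Lemma low_part A : exists2 U : 'M[C]_n, upmx U & A = U + \sum_p A p.1 p.2 *: lowE p.
Proof.
exists (A - \sum_p A p.1 p.2 *: lowE p); last by rewrite subrK.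
move=> i j ji; rewrite !mxE summxE (bigD1 (i, j)) //= /lowE /= ji mxE.
rewrite mxE !eqxx mulr1 big1 ?addr0 ?subrr // => -[i' j'] /= ne.
rewrite mxE; case: ifP => _; rewrite mxE ?mulr0 //.
case: eqVneq => [ei|]; rewrite ?mulr0 //=; case: eqVneq => [ej|]; rewrite ?mulr0 //=.
by move: ne; rewrite ei ej eqxx.
Qed.

Lemma dE_sum A : A = \sum_p A p.1 p.2 *: dE p.
Proof. by rewrite {1}(matrix_sum_delta A) pair_bigA. Qed.

Section Roots.
Definition root_b (r : pairs + pairs) : set_type (pe C n) :=
  match r with inl p => e0 (lowE p) | inr p => em (dE p) end.
Definition root_br (r : pairs + pairs) : set_type (pe C n) :=
  match r with inl p => e0 (lowE p) | inr p => e1 (dE p) end.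
Definition proot_b (r : pairs + pairs) : set_type (pe C n) :=
  match r with inl p => e0 (upE p) | inr p => e1 (dE p) end.
Definition root_par (r : pairs + pairs) : bool := if r is inl _ then false else true.

Lemma is_root0 up c p A : A = (if up then upE p else lowE p) ->
  is_root H0 (e0 A) false (root_wt0 up c p).
Proof.
move=> ->; split=> [|i]; first exact: mx0_homog.
rewrite /root_wt0 /upE /lowE; case: up; case: ifP => _ /=.
- by apply: bracket00_wt; left.
- by rewrite mx00 mulmx0 mul0mx subr0 scaler0.
- by apply: bracket00_wt; left.
- by rewrite mx00 mulmx0 mul0mx subr0 scaler0.
Qed.
Lemma is_rootz c p : is_root Hz (z0 (lowE p)) false (root_wt0 false c p).
Proof. by have [h1 h2] := @is_root0 false c p _ erefl; split. Qed.

Definition wt_b (r : pairs + pairs) : 'rV[C]_n :=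
  match r with inl p => root_wt0 false cpos p | inr p => - (eps C p.1 + eps C p.2) end.
Definition ht_b (r : pairs + pairs) : nat :=
  match r with inl p => root_ht0 false p | inr p => ((n - p.1) + (n - p.2))%N end.
Definition wt_br (r : pairs + pairs) : 'rV[C]_n :=
  match r with inl p => root_wt0 false cneg p | inr p => eps C p.1 + eps C p.2 end.
Definition ht_br (r : pairs + pairs) : nat :=
  match r with inl p => root_ht0 false p | inr p => (p.1.+1 + p.2.+1)%N end.
Definition pwt_b (r : pairs + pairs) : 'rV[C]_n :=
  match r with inl p => root_wt0 true cpos p | inr p => eps C p.1 + eps C p.2 end.
Definition pht_b (r : pairs + pairs) : nat :=
  match r with inl p => root_ht0 true p | inr p => ((n - p.1) + (n - p.2))%N end.

Lemma root_bP r : is_root H0 (root_b r) (root_par r) (wt_b r).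
Proof.
case: r => p /=; first exact: is_root0.
by split; [exact: mxm_homog|exact: bracket0m_wt].
Qed.
Lemma root_brP r : is_root H0 (root_br r) (root_par r) (wt_br r).
Proof.
case: r => p /=; first exact: is_root0.
by split; [exact: mx1_homog|exact: bracket01_wt].
Qed.
Lemma proot_bP r : is_root H0 (proot_b r) (root_par r) (pwt_b r).
Proof.
case: r => p /=; first exact: is_root0.
by split; [exact: mx1_homog|exact: bracket01_wt].
Qed.

Lemma ht_b_gt0 r : (0 < ht_b r)%N.
Proof. by case: r => p /=; rewrite ?root_ht0_gt0 // addn_gt0 subn_gt0 ltn_ord. Qed.
Lemma ht_br_gt0 r : (0 < ht_br r)%N.
Proof. by case: r => p /=; rewrite ?root_ht0_gt0. Qed.
Lemma pht_b_gt0 r : (0 < pht_b r)%N.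
Proof. by case: r => p /=; rewrite ?root_ht0_gt0 // addn_gt0 subn_gt0 ltn_ord. Qed.

Lemma wt_b_ht r : hval cpos (wt_b r) = - (ht_b r)%:R.
Proof.
case: r => p /=; last by rewrite hvalN hvalD !hval_eps natrD.
by rewrite root_wt0_ht ?mulN1r //; [exact: cpos_neq0|exact: cposB].
Qed.
Lemma pwt_b_ht r : hval cpos (pwt_b r) = (pht_b r)%:R.
Proof.
case: r => p /=; last by rewrite hvalD !hval_eps natrD.
by rewrite root_wt0_ht ?mul1r //; [exact: cpos_neq0|exact: cposB].
Qed.
Lemma wt_br_ht r : hval cneg (wt_br r) = - (ht_br r)%:R.
Proof.
case: r => p /=; last by rewrite hvalD !hval_eps natrD opprD.
by rewrite root_wt0_ht ?mulN1r //; [exact: cneg_neq0|exact: cnegB].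
Qed.

Lemma upmx_diag i : upmx (delta_mx i i : 'M[C]_n).
Proof.
move=> a b ba; rewrite mxE; case: eqP => //= ai; case: eqP => //= bi.
by move: ba; rewrite ai bi ltnn.
Qed.

Lemma H0_borel i : borel (val (H0 i)).
Proof. by rewrite /= -[mx0 _]addr0 -mx10; apply/borel_sum/upmx_diag. Qed.
Lemma H0_borel_rev i : borel_rev (val (H0 i)).
Proof. by rewrite /= -[mx0 _]addr0 -mxm0; apply/borel_rev_sum/upmx_diag. Qed.
Lemma Hz_borel_even i : borel_even (val (Hz i)).
Proof. exact/mx0_borel_even/upmx_diag. Qed.

Lemma root_b_dec (x : set_type (pe C n)) : exists (y : set_type (pe C n)) (c : pairs + pairs -> C),
  borel (val y) /\ val x = val y + \sum_r c r *: val (root_b r).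
Proof.
have [U uU eU] := low_part (ulsubmx (val x)).
have [y hy] : exists y : set_type (pe C n), val y = mx0 U + mx1 (2^-1 *: ursubmx (val x)).
  by apply: lie_elt; rewrite -[mx0 _]scale1r; apply: in_peP; [exact: mx0_pe|exact: mx1_pe].
exists y, (fun r => match r with inl p => ulsubmx (val x) p.1 p.2
                    | inr p => (2^-1 *: dlsubmx (val x)) p.1 p.2 end).
split; first by rewrite hy; apply: borel_sum.
rewrite hy big_sumType /= [LHS]in_pe_sum; last exact: (lie_val x).
rewrite {1}eU (linear_funD _ _ mx0_linear) (linear_fun_sum _ _ _ mx0_linear).
rewrite [in mxm _](dE_sum (_ *: dlsubmx _)) (linear_fun_sum _ _ _ mxm_linear).
rewrite -!addrA; congr (_ + _); rewrite addrCA; congr (_ + _); congr (_ + _); apply: eq_bigr => p _.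
  by rewrite (linear_funZ _ _ mx0_linear).
by rewrite (linear_funZ _ _ mxm_linear).
Qed.
Lemma root_br_dec (x : set_type (pe C n)) : exists (y : set_type (pe C n)) (c : pairs + pairs -> C),
  borel_rev (val y) /\ val x = val y + \sum_r c r *: val (root_br r).
Proof.
have [U uU eU] := low_part (ulsubmx (val x)).
have [y hy] : exists y : set_type (pe C n), val y = mx0 U + mxm (2^-1 *: dlsubmx (val x)).
  by apply: lie_elt; rewrite -[mx0 _]scale1r; apply: in_peP; [exact: mx0_pe|exact: mxm_pe].
exists y, (fun r => match r with inl p => ulsubmx (val x) p.1 p.2
                    | inr p => (2^-1 *: ursubmx (val x)) p.1 p.2 end).
split; first by rewrite hy; apply: borel_rev_sum.
rewrite hy big_sumType /= [LHS]in_pe_sum; last exact: (lie_val x).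
rewrite {1}eU (linear_funD _ _ mx0_linear) (linear_fun_sum _ _ _ mx0_linear).
rewrite [in mx1 _](dE_sum (_ *: ursubmx _)) (linear_fun_sum _ _ _ mx1_linear).
rewrite addrAC -!addrA; congr (_ + _); rewrite addrCA; congr (_ + _); congr (_ + _); apply: eq_bigr => p _.
  by rewrite (linear_funZ _ _ mx0_linear).
by rewrite (linear_funZ _ _ mx1_linear).
Qed.
Lemma root_z_dec (x : set_type (pe_even C n)) : exists (y : set_type (pe_even C n)) (c : pairs -> C),
  borel_even (val y) /\ val x = val y + \sum_r c r *: val (z0 (lowE r)).
Proof.
have [U uU eU] := low_part (ulsubmx (val x)).
exists (z0 U), (fun p => ulsubmx (val x) p.1 p.2).
split; first exact: mx0_borel_even.
have [hx e] : in_pe_even (val x) by exact: (lie_val x).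
have -> : val x = mx0 (ulsubmx (val x)).
  by case: hx => X1 _ _; rewrite -[LHS]e /hpart X1.
rewrite ul_mx0 {1}eU (linear_funD _ _ mx0_linear) (linear_fun_sum _ _ _ mx0_linear).
by congr (_ + _); apply: eq_bigr => p _; rewrite (linear_funZ _ _ mx0_linear).
Qed.
End Roots.

Lemma rad_even_not_top lam : ind_gen (pe_even C n) (@borel_even C n) (wchar lam) <> 0 ->
  ~ rad (Delta_even lam) (ind_gen (pe_even C n) (@borel_even C n) (wchar lam)).
Proof.
apply: (@rad_not_top C n (pe_even C n) (@borel_even C n) (wchar lam) Hz cpos _
  (fun p => z0 (lowE p)) (fun _ => false) (root_wt0 false cpos) (root_ht0 false)
  _ _ _ _ _ _ (Delta_even lam) _ false).
- by move=> i; apply: mx0_homog.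
- exact: is_rootz.
- exact: Hz_borel_even.
- exact: root_ht0_gt0.
- move=> p; rewrite root_wt0_ht ?mulN1r //; [exact: cpos_neq0|exact: cposB].
- exact: root_z_dec.
- by rewrite scale1r; apply: ind_gen_par.
- exact: ind_gen_char.
- exact: ind_gen_generates.
Qed.

Lemma L_embed lam (P : smod (pe C n)) (N : submod P) (t : P) (q : bool) :
  simple_sub N -> N t -> t <> 0 -> smod_par t = (-1) ^+ q *: t ->
  char_vector (@borel C n) (wchar lam) t ->
  exists f : shom (pshift q (L lam)) P, injective f /\ range f = sub_set N.
Proof.
apply: (@simple_quo_embed C n (pe C n) (@borel C n) (wchar lam) H0 cpos _
  root_b root_par wt_b ht_b).
- by move=> i; apply: mx0_homog.
- exact: root_bP.
- exact: H0_borel.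
- exact: ht_b_gt0.
- exact: wt_b_ht.
- exact: root_b_dec.
Qed.

Lemma L_rev_embed lam (P : smod (pe C n)) (N : submod P) (t : P) (q : bool) :
  simple_sub N -> N t -> t <> 0 -> smod_par t = (-1) ^+ q *: t ->
  char_vector (@borel_rev C n) (wchar lam) t ->
  exists f : shom (pshift q (L_rev lam)) P, injective f /\ range f = sub_set N.
Proof.
apply: (@simple_quo_embed C n (pe C n) (@borel_rev C n) (wchar lam) H0 cneg _
  root_br root_par wt_br ht_br).
- by move=> i; apply: mx0_homog.
- exact: root_brP.
- exact: H0_borel_rev.
- exact: ht_br_gt0.
- exact: wt_br_ht.
- exact: root_br_dec.
Qed.

(** Applied inside a simple submodule, this yields a weight k for which the submodule is L(k); the
    existence of the weight chosen by [wplus] rests on it. *)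
Lemma exists_borel_singular lam (M : smod (pe C n)) (v : M) (q : bool) (N : submod M) u :
  smod_par v = (-1) ^+ q *: v -> char_vector (@borel C n) (wchar lam) v -> generates v ->
  N u -> u <> 0 ->
  exists w k (r : bool), [/\ N w, w <> 0, smod_par w = (-1) ^+ r *: w &
    char_vector (@borel C n) (wchar k) w].
Proof.
move=> vp vc vg Nu u0.
have [w [k [p [Nw w0 [wk wp] we]]]] := @exists_singular C n (pe C n) (@borel C n) (wchar lam)
  H0 cpos _ root_b root_par wt_b ht_b (fun i => mx0_homog _) root_bP H0_borel ht_b_gt0 wt_b_ht
  root_b_dec M v q vp vc vg _ proot_b root_par pwt_b pht_b proot_bP pht_b_gt0 pwt_b_ht N u Nu u0.
exists w, k, p; split=> //; apply/char_borelP; split=> [A uA|B].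
  rewrite (linear_fun_delta _ (act0_linear w)) /wtr scaler_suml; apply: eq_bigr => i _.
  rewrite (bigD1 i) //= big1 ?addr0 => [|j ji]; first by rewrite wk scalerA mulrC.
  have [ij|ij|e] := ltngtP i j; last by move: ji; rewrite -val_eqE /= e eqxx.
    by have := we (inl (i, j)); rewrite /= /upE /= ij => ->; rewrite scaler0.
  by rewrite uA // scale0r.
rewrite (linear_fun_delta _ (act1_linear w)) big1 // => i _; rewrite big1 // => j _.
by have := we (inr (i, j)); rewrite /= /dE /= => ->; rewrite scaler0.
Qed.
End BorelCharacters.

(** * Fock spaces *)

Section EndomorphismRing.
Variables (C : numClosedFieldType) (V : lmodType C).

(** Linear operators are bundled so as to form a ring; the relations in the Kac module and in the
    model of the Verma module become identities between ring elements. *)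
Record endo := Endo { endo_fun :> V -> V; endo_linear : linear endo_fun }.

Lemma endoP (f h : endo) : f =1 h -> f = h.
Proof.
case: f h => f lf [h lh] /= fh.
have e : f = h by apply: functional_extensionality_dep.
by case: h / e lh {fh} => lh; rewrite (Prop_irrelevance lf lh).
Qed.

HB.instance Definition _ := gen_eqMixin endo.
HB.instance Definition _ := gen_choiceMixin endo.

Lemma endo0_linear : linear (fun _ : V => 0 : V).
Proof. by move=> c u v; rewrite scaler0 addr0. Qed.
Lemma endoD_linear (f h : endo) : linear (fun v => f v + h v).
Proof. by move=> c u v; rewrite !endo_linear scalerDr addrACA. Qed.
Lemma endoN_linear (f : endo) : linear (fun v => - f v).
Proof. by move=> c u v; rewrite endo_linear opprD scalerN. Qed.
Lemma endoM_linear (f h : endo) : linear (fun v => f (h v)).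
Proof. by move=> c u v; rewrite !endo_linear. Qed.
Lemma endo1_linear : linear (fun v : V => v). Proof. by []. Qed.
Lemma endoZ_linear (c : C) (f : endo) : linear (fun v => c *: f v).
Proof. by move=> d u v; rewrite endo_linear scalerDr !scalerA mulrC. Qed.

Definition endo_zero := Endo endo0_linear.
Definition endo_add f h := Endo (endoD_linear f h).
Definition endo_opp f := Endo (endoN_linear f).
Definition endo_mul f h := Endo (endoM_linear f h).
Definition endo_one := Endo endo1_linear.
Definition endo_scale c f := Endo (endoZ_linear c f).

Lemma endo_addA : associative endo_add.
Proof. by move=> f h k; apply: endoP => v /=; rewrite addrA. Qed.
Lemma endo_addC : commutative endo_add.
Proof. by move=> f h; apply: endoP => v /=; rewrite addrC. Qed.
Lemma endo_add0 : left_id endo_zero endo_add.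
Proof. by move=> f; apply: endoP => v /=; rewrite add0r. Qed.
Lemma endo_addN : left_inverse endo_zero endo_opp endo_add.
Proof. by move=> f; apply: endoP => v /=; rewrite addNr. Qed.
HB.instance Definition _ :=
  GRing.isZmodule.Build endo endo_addA endo_addC endo_add0 endo_addN.

Lemma endo_mulA : associative endo_mul.
Proof. by move=> f h k; apply: endoP. Qed.
Lemma endo_mul1l : left_id endo_one endo_mul.
Proof. by move=> f; apply: endoP. Qed.
Lemma endo_mul1r : right_id endo_one endo_mul.
Proof. by move=> f; apply: endoP. Qed.
Lemma endo_mulDl : left_distributive endo_mul +%R.
Proof. by move=> f h k; apply: endoP. Qed.
Lemma endo_mulDr : right_distributive endo_mul +%R.
Proof. by move=> f h k; apply: endoP => v; apply: (linear_funD _ _ (endo_linear f)). Qed.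
HB.instance Definition _ := GRing.Zmodule_isPzRing.Build endo
  endo_mulA endo_mul1l endo_mul1r endo_mulDl endo_mulDr.

Lemma endo_scaleA c d f : endo_scale c (endo_scale d f) = endo_scale (c * d) f.
Proof. by apply: endoP => v /=; rewrite scalerA. Qed.
Lemma endo_scale1 : left_id 1 endo_scale.
Proof. by move=> f; apply: endoP => v /=; rewrite scale1r. Qed.
Lemma endo_scaleDr : right_distributive endo_scale +%R.
Proof. by move=> c f h; apply: endoP => v /=; rewrite scalerDr. Qed.
Lemma endo_scaleDl f : {morph endo_scale^~ f : c d / c + d}.
Proof. by move=> c d; apply: endoP => v /=; rewrite scalerDl. Qed.
HB.instance Definition _ := GRing.Zmodule_isLmodule.Build C endo
  endo_scaleA endo_scale1 endo_scaleDr endo_scaleDl.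

Lemma endoDE (f h : endo) v : (f + h) v = f v + h v. Proof. by []. Qed.
Lemma endoNE (f : endo) v : (- f) v = - f v. Proof. by []. Qed.
Lemma endoBE (f h : endo) v : (f - h) v = f v - h v. Proof. by []. Qed.
Lemma endoME (f h : endo) v : (f * h) v = f (h v). Proof. by []. Qed.
Lemma endoZE (c : C) (f : endo) v : (c *: f) v = c *: f v. Proof. by []. Qed.
Lemma endo0E v : (0 : endo) v = 0. Proof. by []. Qed.
Lemma endo1E v : (1 : endo) v = v. Proof. by []. Qed.
Lemma endo_sumE (I : Type) (r : seq I) (P : pred I) (F : I -> endo) v :
  (\sum_(i <- r | P i) F i) v = \sum_(i <- r | P i) F i v.
Proof. exact: (big_morph (fun f : endo => f v)). Qed.
Lemma endo_scalerAl (c : C) (f h : endo) : c *: (f * h) = c *: f * h.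
Proof. exact: endoP. Qed.
Lemma endo_scalerAr (c : C) (f h : endo) : c *: (f * h) = f * (c *: h).
Proof. by apply: endoP => v /=; rewrite (linear_funZ _ _ (endo_linear f)). Qed.
Lemma endo_of0 (f : endo) : f 0 = 0. Proof. exact: linear_fun0 (endo_linear f). Qed.
Lemma endo_ofD (f : endo) u v : f (u + v) = f u + f v.
Proof. exact: linear_funD (endo_linear f). Qed.
Lemma endo_ofN (f : endo) u : f (- u) = - f u.
Proof. by rewrite -scaleN1r (linear_funZ _ _ (endo_linear f)) scaleN1r. Qed.
Lemma endo_ofZ (f : endo) c u : f (c *: u) = c *: f u.
Proof. exact: linear_funZ (endo_linear f). Qed.
End EndomorphismRing.

Section Fock.
Variables (C : numClosedFieldType) (V : lmodType C).

(* The exterior algebra on k generators with coefficients in V, with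
   w = w.1 + theta_k w.2. *)
Fixpoint fock (k : nat) : lmodType C :=
  if k is k'.+1 then (fock k' * fock k')%type : lmodType C else V.

Fixpoint fvac k (v : V) : fock k :=
  if k is k'.+1 return fock k then (fvac k' v, 0) else v.
Fixpoint ftop k (v : V) : fock k :=
  if k is k'.+1 return fock k then (0, ftop k' v) else v.
(** In w.1 + theta_k' w.2 the generator theta_j has to pass theta_k' before it reaches w.2, whence
    the sign. For j >= k the recursion ends in 0. *)
Fixpoint fcreate k (j : nat) : fock k -> fock k :=
  if k is k'.+1 return fock k -> fock k then
    fun w => if j == k' then (0, w.1) else (fcreate j w.1, - fcreate j w.2)
  else fun=> 0.
Fixpoint fannih k (j : nat) : fock k -> fock k :=
  if k is k'.+1 return fock k -> fock k then
    fun w => if j == k' then (w.2, 0) else (fannih j w.1, - fannih j w.2)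
  else fun=> 0.
Fixpoint fmap k (a : V -> V) : fock k -> fock k :=
  if k is k'.+1 return fock k -> fock k then fun w => (fmap a w.1, fmap a w.2) else a.
Fixpoint fpar k (a : V -> V) : fock k -> fock k :=
  if k is k'.+1 return fock k -> fock k then fun w => (fpar a w.1, - fpar a w.2) else a.
Fixpoint fall k (S : V -> Prop) : fock k -> Prop :=
  if k is k'.+1 return fock k -> Prop then fun w => fall S w.1 /\ fall S w.2 else S.

Lemma fock_eq k (u w : fock k.+1) : u.1 = w.1 -> u.2 = w.2 -> u = w.
Proof. by case: u w => [? ?] [? ?] /= -> ->. Qed.

Lemma fcreate_linear k j : linear (@fcreate k j).
Proof.
elim: k => [|k IH] c u v /=; first by rewrite scaler0 addr0.
by case: eqP => _; apply: (@fock_eq k) => /=; rewrite ?scaler0 ?addr0 // IH ?opprD ?scalerN.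
Qed.
Lemma fannih_linear k j : linear (@fannih k j).
Proof.
elim: k => [|k IH] c u v /=; first by rewrite scaler0 addr0.
by case: eqP => _; apply: (@fock_eq k) => /=; rewrite ?scaler0 ?addr0 // IH ?opprD ?scalerN.
Qed.
Lemma fmap_linear k (a : V -> V) : linear a -> linear (@fmap k a).
Proof.
move=> la; elim: k => [|k IH] c u v /=; first exact: la.
by apply: (@fock_eq k); rewrite /= IH.
Qed.
Lemma fpar_linear k (a : V -> V) : linear a -> linear (@fpar k a).
Proof.
move=> la; elim: k => [|k IH] c u v /=; first exact: la.
by apply: (@fock_eq k); rewrite /= IH ?opprD ?scalerN.
Qed.
Lemma fvac_linear k : linear (@fvac k).
Proof. by elim: k => [|k IH] c u v //=; apply: (@fock_eq k); rewrite /= ?IH ?scaler0 ?addr0. Qed.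
Lemma ftop_linear k : linear (@ftop k).
Proof. by elim: k => [|k IH] c u v //=; apply: (@fock_eq k); rewrite /= ?IH ?scaler0 ?addr0. Qed.

Definition Th k j : endo (fock k) := Endo (@fcreate_linear k j).
Definition Dl k j : endo (fock k) := Endo (@fannih_linear k j).
Definition Mp k (a : endo V) : endo (fock k) := Endo (@fmap_linear k a (endo_linear a)).

Lemma Th_anti k i j : Th k i * Th k j = - (Th k j * Th k i).
Proof.
apply: endoP => w /=; elim: k w => [|k IH] w /=; first by rewrite oppr0.
have lc m (x : fock k) : @fcreate k m (- x) = - fcreate m x by exact: (endo_ofN (Th k m)).
have l0 m : @fcreate k m 0 = 0 by exact: (endo_of0 (Th k m)).
case: (eqVneq i k) => [ei|ik]; case: (eqVneq j k) => [ej|jk] //=; rewrite ?ei ?ej ?eqxx ?(negbTE ik) ?(negbTE jk) /=.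
- by apply: (@fock_eq k) => /=; rewrite oppr0.
- by apply: (@fock_eq k) => /=; rewrite ?l0 ?oppr0 ?opprK.
- by apply: (@fock_eq k) => /=; rewrite ?l0 ?oppr0 ?opprK.
- by apply: (@fock_eq k) => /=; rewrite ?lc ?opprK IH.
Qed.

Lemma Dl_Th k i j : (i < k)%N -> (j < k)%N ->
  Dl k i * Th k j = (i == j)%:R - Th k j * Dl k i.
Proof.
move=> ik jk; apply: endoP => w; elim: k ik jk w => [|k IH] // ik jk w.
have lc m (x : fock k) : @fcreate k m (- x) = - fcreate m x by exact: (endo_ofN (Th k m)).
have la m (x : fock k) : @fannih k m (- x) = - fannih m x by exact: (endo_ofN (Dl k m)).
have l0 m : @fcreate k m 0 = 0 by exact: (endo_of0 (Th k m)).
have l0' m : @fannih k m 0 = 0 by exact: (endo_of0 (Dl k m)).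
have nE (b : bool) m (x : fock m) : (b%:R : endo (fock m)) x = x *+ b by case: b.
rewrite endoBE nE /=.
case: (eqVneq i k) => [ei|nik]; case: (eqVneq j k) => [ej|njk] /=; rewrite ?ei ?ej ?eqxx /=.
- by case: w => w1 w2; apply: (@fock_eq k) => /=; rewrite ?subr0 ?sub0r ?opprK ?subrr.
- have kj : (k == j) = false by rewrite eq_sym (negbTE njk).
  rewrite ?kj ?(negbTE njk) /= mulr0n sub0r; apply: (@fock_eq k) => /=; rewrite ?l0 ?oppr0 ?opprK //.
- rewrite ?(negbTE nik) /= mulr0n sub0r; apply: (@fock_eq k) => /=; rewrite ?l0' ?oppr0 ?opprK //.
- have ik' : (i < k)%N by rewrite ltn_neqAle nik -ltnS.
  have jk' : (j < k)%N by rewrite ltn_neqAle njk -ltnS.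
  have := IH ik' jk' w.1; have := IH ik' jk' w.2; rewrite !endoBE !nE /= => h2 h1.
  by apply: (@fock_eq k); rewrite /= ?h1 ?la ?lc ?h2 ?opprK; case: (i == j).
Qed.

Lemma Mp_Th k a j : Mp k a * Th k j = Th k j * Mp k a.
Proof.
apply: endoP => w /=; elim: k w => [|k IH] w /=; first by rewrite endo_of0.
have l0 : @fmap k a 0 = 0 by exact: (endo_of0 (Mp k a)).
have lN x : @fmap k a (- x) = - fmap a x by exact: (endo_ofN (Mp k a)).
by case: eqP => _ /=; apply: (@fock_eq k) => /=; rewrite ?l0 ?lN ?IH.
Qed.
Lemma Mp_linear k : linear (@Mp k).
Proof.
by move=> c a b; apply: endoP => w /=; elim: k w => [|k IH] w //=; rewrite !IH.
Qed.

Lemma Mp_vac k a v : Mp k a (fvac k v) = fvac k (a v).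
Proof.
elim: k => [|k IH] //=; apply: (@fock_eq k) => /=; [exact: IH|exact: (endo_of0 (Mp k a))].
Qed.
Lemma Dl_vac k j v : Dl k j (fvac k v) = 0.
Proof.
elim: k => [|k IH] //=; case: eqP => _; apply: (@fock_eq k) => //=.
by rewrite [fannih _ 0](endo_of0 (Dl k j)) oppr0.
Qed.
Lemma Mp_top k a v : Mp k a (ftop k v) = ftop k (a v).
Proof.
elim: k => [|k IH] //=; apply: (@fock_eq k) => /=; [exact: (endo_of0 (Mp k a))|exact: IH].
Qed.
Lemma Th_top k j v : (j < k)%N -> Th k j (ftop k v) = 0.
Proof.
elim: k => [|k IH] //= jk; case: eqVneq => [//|nj]; apply: (@fock_eq k) => /=.
  exact: (endo_of0 (Th k j)).
have jk' : (j < k)%N by rewrite ltn_neqAle nj -ltnS.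
by have /= -> := IH jk'; rewrite oppr0.
Qed.

Lemma fock_ind k (P : fock k -> Prop) : (forall v, P (fvac k v)) ->
  (forall u w, P u -> P w -> P (u + w)) -> (forall j w, (j < k)%N -> P w -> P (Th k j w)) ->
  forall w, P w.
Proof.
elim: k P => [|k IH] P Pv PD PT w; first exact: Pv.
have P0 (u : fock k) : P ((u, 0) : fock k.+1).
  apply: (IH (fun u => P ((u, 0) : fock k.+1))) => [v|u1 u2 h1 h2|j u1 jk h1].
  - exact: Pv.
  - suff -> : ((u1 + u2, 0) : fock k.+1) = ((u1, 0) : fock k.+1) + (u2, 0) by apply: PD.
    by apply: (@fock_eq k) => /=; rewrite ?addr0.
  - have := PT j _ (ltnW jk) h1; rewrite /= (ltn_eqF jk).
    by rewrite [fcreate _ 0](endo_of0 (Th k j)) oppr0.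
case: w => w1 w2; have -> : ((w1, w2) : fock k.+1) = (w1, 0) + Th k.+1 k (w2, 0).
  by rewrite /= eqxx; apply: (@fock_eq k) => /=; rewrite ?addr0 ?add0r.
by apply: PD (P0 _) (PT _ _ _ (P0 _)).
Qed.

(** Everything is spanned by creation operators applied to vacuum vectors, so an operator that
    commutes, or anticommutes, with all creation operators is determined by its values on the
    vacuum. The relations among [O0] and [O1] below are proved in this way. *)
Lemma fock_eq0 k (s : bool) (T : endo (fock k)) :
  (forall j, (j < k)%N -> T * Th k j = (-1) ^+ s *: (Th k j * T)) ->
  (forall v, T (fvac k v) = 0) -> T = 0.
Proof.
move=> hT hv; apply: endoP => w; elim/fock_ind: w => [v|u w|j w jk].
- exact: hv.
- by rewrite endo_ofD => -> ->; rewrite addr0.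
- by move=> h; rewrite -endoME hT // endoZE endoME h endo_of0 scaler0.
Qed.

Lemma fpar_Th k (a : V -> V) j w : linear a ->
  fpar a (Th k j w) = - Th k j (fpar a w).
Proof.
move=> la; elim: k w => [|k IH] w /=; first by rewrite (linear_fun0 la) oppr0.
have l0 : @fpar k a 0 = 0 by exact: (linear_fun0 (fpar_linear la)).
have lN x : @fpar k a (- x) = - fpar a x by rewrite -scaleN1r (linear_funZ _ _ (fpar_linear la)) scaleN1r.
have lc m (x : fock k) : @fcreate k m (- x) = - fcreate m x by exact: (endo_ofN (Th k m)).
by case: eqP => _ /=; apply: (@fock_eq k) => /=; rewrite ?l0 ?lN ?lc ?oppr0 ?[fpar _ (fcreate _ _)]IH.
Qed.
Lemma fpar_Dl k (a : V -> V) j w : linear a ->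
  fpar a (Dl k j w) = - Dl k j (fpar a w).
Proof.
move=> la; elim: k w => [|k IH] w /=; first by rewrite (linear_fun0 la) oppr0.
have l0 : @fpar k a 0 = 0 by exact: (linear_fun0 (fpar_linear la)).
have lN x : @fpar k a (- x) = - fpar a x by rewrite -scaleN1r (linear_funZ _ _ (fpar_linear la)) scaleN1r.
have lc m (x : fock k) : @fannih k m (- x) = - fannih m x by exact: (endo_ofN (Dl k m)).
by case: eqP => _ /=; apply: (@fock_eq k) => /=; rewrite ?l0 ?lN ?lc ?oppr0 ?opprK ?[fpar _ (fannih _ _)]IH.
Qed.
Lemma fpar_Mp k (p : V -> V) (a : endo V) w : (forall v, p (a v) = a (p v)) ->
  fpar p (Mp k a w) = Mp k a (fpar p w).
Proof.
move=> pa; elim: k w => [|k IH] w; first exact: pa.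
have lN x : @fmap k a (- x) = - fmap a x by exact: (endo_ofN (Mp k a)).
by apply: (@fock_eq k) => /=; rewrite ?lN [fpar _ (fmap _ _)]IH.
Qed.
Lemma fparK k (p : V -> V) : linear p -> involutive p -> involutive (@fpar k p).
Proof.
move=> lp pK; elim: k => [|k IH] w; first exact: pK.
apply: (@fock_eq k); rewrite /= ?IH //.
by rewrite -[- fpar p w.2]scaleN1r (linear_funZ _ _ (fpar_linear lp)) IH scaleN1r opprK.
Qed.
Lemma fpar_vac k p v : linear p -> fpar p (fvac k v) = fvac k (p v).
Proof. by move=> lp; elim: k => [|k IH] //=; rewrite IH (linear_fun0 (fpar_linear lp)) oppr0. Qed.
Lemma fpar_top k p v : linear p -> fpar p (ftop k v) = (-1) ^+ k *: ftop k (p v).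
Proof.
move=> lp; elim: k => [|k IH] /=; first by rewrite scale1r.
rewrite IH (linear_fun0 (fpar_linear lp)); apply: (@fock_eq k) => /=; rewrite ?scaler0 //.
by rewrite exprS mulN1r scaleNr.
Qed.

(* Multiplying by the missing generators carries some component to the top. *)
Lemma fock_reach_top k (P : fock k -> Prop) w :
  (forall j u, (j < k)%N -> P u -> P (Th k j u)) -> (forall u, P u -> P (- u)) ->
  P w -> w <> 0 -> exists2 v, v <> 0 & P (ftop k v).
Proof.
elim: k P w => [|k IH] P w PT PN Pw w0; first by exists w.
have step (u : fock k) : P ((0, u) : fock k.+1) -> u <> 0 -> exists2 v, v <> 0 & P (ftop k.+1 v).
  move=> Pu u0; apply: (IH (fun u => P ((0, u) : fock k.+1)) u) => // [j x jk Px|x Px].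
    have := PN _ (PT j _ (ltnW jk) Px); rewrite /= (ltn_eqF jk) [fcreate _ 0](endo_of0 (Th k j)).
    by congr P; apply: (@fock_eq k) => /=; rewrite ?oppr0 ?opprK.
  by have := PN _ Px; congr P; apply: (@fock_eq k) => /=; rewrite ?oppr0.
case: w Pw w0 => w1 w2 Pw w0.
(* If w.1 vanishes, the last generator is already present; otherwise multiplication by it moves w.1
   into the second component and discards w.2. *)
have [e1|n1] := pselect (w1 = 0).
  rewrite e1 in Pw w0; apply: step Pw _ => e2; by apply: w0; rewrite e2.
apply: step n1; have := PT k _ (ltnSn k) Pw.
by rewrite /= eqxx.
Qed.

(** The operator counts generators, hence has no negative eigenvalue. On the second component it is
    shifted by one, so the eigenvalue -c of a pair becomes -(c + 1) for w.2; negative eigenvalues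
    are therefore excluded in the same induction that treats 0. *)
Lemma fock_number k (c : nat) w : (\sum_(j < k) Th k j * Dl k j) w = - c%:R *: w ->
  exists v, w = fvac k v.
Proof.
suff [h1 h2] : (forall c w, (\sum_(j < k) Th k j * Dl k j) w = - c.+1%:R *: w -> w = 0) /\
    (forall w, (\sum_(j < k) Th k j * Dl k j) w = 0 -> exists v, w = fvac k v).
  case: c => [|c]; first by rewrite oppr0 scale0r; apply: h2.
  move/h1 ->; exists 0; exact/esym/linear_fun0/fvac_linear.
elim: k {c w} => [|k [IH1 IH2]].
  split=> [c w|w]; last by exists w.
  rewrite big_ord0 endo0E => /esym/eqP; rewrite scaler_eq0 oppr_eq0 pnatr_eq0 /=.
  by move/eqP.
have E (w : fock k.+1) : (\sum_(j < k.+1) Th k.+1 j * Dl k.+1 j) w =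
    ((\sum_(j < k) Th k j * Dl k j) w.1, (\sum_(j < k) Th k j * Dl k j) w.2 + w.2).
  rewrite endo_sumE big_ord_recr /= eqxx.
  have -> : \sum_(j < k) (Th k.+1 (widen_ord (leqnSn k) j) * Dl k.+1 (widen_ord (leqnSn k) j)) w =
     (((\sum_(j < k) Th k j * Dl k j) w.1, (\sum_(j < k) Th k j * Dl k j) w.2) : fock k.+1).
    rewrite !endo_sumE.
    have aux (m : nat) (r : seq 'I_m) : m = k -> \sum_(j <- r) (Th k.+1 j * Dl k.+1 j) w =
      ((\sum_(j <- r) (Th k j * Dl k j) w.1, \sum_(j <- r) (Th k j * Dl k j) w.2) : fock k.+1).
      move=> mk; elim: r => [|j r IHr]; first by rewrite !big_nil.
      rewrite !big_cons IHr /=; have jk : (j : nat) == k = false by apply/ltn_eqF; rewrite -[X in (_ < X)%N]mk.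
      by rewrite jk; apply: (@fock_eq k) => //=; rewrite [fcreate _ (- _)](endo_ofN (Th k j)) opprK.
    exact: aux.
  by apply: (@fock_eq k) => /=; rewrite ?addr0.
split=> [c [w1 w2]|[w1 w2]]; rewrite E /=.
  move=> [e1 e2]; rewrite (IH1 c w1 e1) (IH1 c.+1 w2) //.
  by rewrite -[c.+2%:R]natr1 opprD scalerDl -e2 scaleN1r addrK.
move=> [/IH2 [v ->] e2]; exists v; rewrite (IH1 0%N w2) //.
by move/eqP: e2; rewrite addr_eq0 scaleN1r => /eqP.
Qed.

Lemma fall_top k (S : V -> Prop) v : S 0 -> fall S (ftop k v) <-> S v.
Proof.
move=> S0; have z m : fall S (0 : fock m) by elim: m.
elim: k => [|k [h1 h2]] //=; split=> [[_ /h1]|/h2] //; by split.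
Qed.
End Fock.

(** * Kac modules *)

Section AntisymmetricBasis.
Variables (C : numClosedFieldType) (n : nat).
Implicit Types (A B D S : 'M[C]_n).

Definition apairs : seq ('I_n * 'I_n) :=
  [seq p : 'I_n * 'I_n <- index_enum _ | (p.1 < p.2)%N].
Definition adim := size apairs.
Definition apr (j : 'I_adim) : 'I_n * 'I_n := tnth (in_tuple apairs) j.
Definition abase (p : 'I_n * 'I_n) : 'M[C]_n := delta_mx p.1 p.2 - delta_mx p.2 p.1.
Definition acoef D (j : 'I_adim) : C := D (apr j).1 (apr j).2.
Definition antisym D := D^T = - D.
Definition sym S := S^T = S.

Lemma apr_lt j : ((apr j).1 < (apr j).2)%N.
Proof. by have := mem_tnth j (in_tuple apairs); rewrite mem_filter => /andP []. Qed.

Lemma apr_inj : injective apr.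
Proof.
apply/tuple_uniqP; exact: filter_uniq (index_enum_uniq _).
Qed.

Lemma sum_apr (V : zmodType) (F : 'I_n * 'I_n -> V) :
  \sum_j F (apr j) = \sum_(p : 'I_n * 'I_n | (p.1 < p.2)%N) F p.
Proof. by rewrite -[RHS]big_filter big_tnth. Qed.

Lemma abase_antisym p : antisym (abase p).
Proof. by rewrite /antisym /abase linearB /= !trmx_delta opprB. Qed.

Lemma abase_eval (p : 'I_n * 'I_n) (a b : 'I_n) : (p.1 < p.2)%N -> (a < b)%N ->
  abase p a b = (p == (a, b))%:R.
Proof.
case: p => p1 p2 /= lp lab; rewrite !mxE.
have -> : (a == p2) && (b == p1) = false.
  apply/negP => /andP [/eqP ea /eqP eb]; move: lab; rewrite ea eb => lab.
  by have := ltn_trans lp lab; rewrite ltnn.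
by rewrite subr0 xpair_eqE [a == _]eq_sym [b == _]eq_sym.
Qed.

Lemma acoef_abase j l : acoef (abase (apr l)) j = (j == l)%:R.
Proof.
rewrite /acoef abase_eval ?apr_lt // -surjective_pairing (inj_eq apr_inj).
by rewrite eq_sym.
Qed.

Lemma antisym_sum D : antisym D -> D = \sum_j acoef D j *: abase (apr j).
Proof.
move=> aD; rewrite (sum_apr (fun p => D p.1 p.2 *: abase p)).
set M := \sum_(p | _) _.
have aM : antisym M.
  rewrite /antisym /M linear_sum /= -sumrN; apply: eq_bigr => p _.
  by rewrite linearZ /= abase_antisym scalerN.
have up (a b : 'I_n) : (a < b)%N -> D a b = M a b.
  move=> ab; rewrite /M summxE (bigD1 (a, b)) //= mxE abase_eval //= eqxx mulr1.
  rewrite big1 ?addr0 // => p /andP [lp np].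
  by rewrite mxE abase_eval // (negbTE np) mulr0.
have anti (X : 'M[C]_n) a b : antisym X -> X a b = - X b a.
  by move=> aX; have := congr1 (fun Y : 'M[C]_n => Y b a) aX; rewrite !mxE.
have diag (X : 'M[C]_n) a : antisym X -> X a a = 0.
  move=> /(anti _ a a) /eqP; rewrite -addr_eq0 -mulr2n mulrn_eq0 /= => /eqP //.
apply/matrixP => a b; have [ab|ba|/val_inj ->] := ltngtP a b.
- exact: up.
- by rewrite (anti D) // (anti M) // up.
- by rewrite !diag.
Qed.

(* The adjoint action of gl(n) on the block C of pe(n), by which it acts on
   g_{-1}. *)
Definition adm A D : 'M[C]_n := - (A^T *m D + D *m A).

Lemma adm_antisym A D : antisym D -> antisym (adm A D).
Proof.
move=> aD; rewrite /antisym /adm linearN /= [(_ + _)^T]linearD /= !trmx_mul trmxK aD.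
by rewrite mulNmx mulmxN opprK !opprD opprK [in RHS]addrC opprK.
Qed.

Lemma adm_linear A : linear (adm A).
Proof.
move=> c D D'; rewrite /adm mulmxDr mulmxDl -scalemxAr -scalemxAl.
by rewrite scalerN scalerDr !opprD addrACA.
Qed.

Lemma adm_linear_l D : linear (fun A => adm A D).
Proof.
move=> c A A'; rewrite /adm linearP /= mulmxDr mulmxDl -scalemxAr -scalemxAl.
by rewrite scalerN scalerDr !opprD addrACA.
Qed.

Lemma adm_bracket A A' D :
  adm A (adm A' D) - adm A' (adm A D) = adm (A *m A' - A' *m A) D.
Proof.
rewrite /adm [(_ - _)^T]linearB /= !trmx_mul mulmxBl mulmxBr.
rewrite !mulmxN !mulNmx !mulmxDr !mulmxDl !opprD !opprK !mulmxA.
rewrite [LHS](AC ((2*2)*(2*2)) ((5*1)*((8*4)*((2*7)*(3*6))))) /=.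
by rewrite !subrr !addr0.
Qed.

(** The Jacobi identity for S in g_1 and D, D' in g_{-1}: as [D, D'] = 0, the bracket of [S, D] = S
    D with D' is antisymmetric in D and D'. *)
Lemma adm_cyclic S D D' : antisym D -> antisym D' -> sym S ->
  adm (S *m D) D' = - adm (S *m D') D.
Proof.
move=> aD aD' sS; rewrite /adm !trmx_mul aD aD' sS !mulNmx !mulmxA.
by rewrite !opprD !opprK addrC.
Qed.

(** The Jacobi identity for A, S and D: A acts as a derivation on [S, D] = S D. *)
Lemma adm_sym A S D : antisym D ->
  A *m (S *m D) - S *m D *m A - S *m adm A D = (A *m S + S *m A^T) *m D.
Proof.
move=> _; rewrite /adm mulmxN opprK mulmxDr mulmxDl !mulmxA.
by rewrite [LHS](AC (2*2) ((1*3)*(4*2))) /= subrr addr0.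
Qed.

(** The Jacobi identity for S, S' in g_1 and D in g_{-1}, where [S, S'] = 0. *)
Lemma sym_cyclic S S' D : antisym D -> sym S -> sym S' ->
  (S *m D) *m S' + S' *m (S *m D)^T + ((S' *m D) *m S + S *m (S' *m D)^T) = 0.
Proof.
move=> aD sS sS'; rewrite !trmx_mul aD sS sS' !mulNmx !mulmxN !mulmxA.
by rewrite addrACA [X in _ + X]addrC addrACA !subrr addr0.
Qed.
End AntisymmetricBasis.

(** This and the next two rearrangements are stated in an abstract group, so that [AC] permutes
    variables instead of large operators. *)
Lemma zmod_cancel (Z : zmodType) (x y z a b c d : Z) :
  x + a + b + c - (y + b + a + d) - (z + (c - d)) = x - y - z.
Proof.
rewrite !opprD !opprK.
rewrite [LHS](AC ((4*4)*(1*2)) ((1*5*9)*((2*7)*((3*6)*((4*10)*(8*11)))))) /=.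
by rewrite !subrr addNr !addr0.
Qed.

Lemma zmod_cancel1 (Z : zmodType) (x y z a p q r : Z) :
  - x - a + p - (- y + q - a + r) - (- z + (p - q - r)) = - (x - y - z).
Proof.
rewrite !opprD !opprK.
rewrite [LHS](AC ((3*4)*(1*3)) ((1*4*8)*((2*6)*((3*9)*((5*10)*(7*11)))))) /=.
by rewrite !subrr !addNr !addr0.
Qed.
Lemma zmod_cancel2 (Z : zmodType) (x y p q u v : Z) :
  u - v + (q - p) = 0 -> x - u + p + (y - q + v) = x + y.
Proof.
move=> h; rewrite [LHS](AC (3*3) ((1*4)*((6*2)*(3*5)))) /=.
by rewrite -[v - u]opprB -[p - q]opprB -opprD h oppr0 addr0.
Qed.

Section KacModule.
Variables (C : numClosedFieldType) (n : nat) (V : smod (pe_even C n)).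
Implicit Types (A B D S : 'M[C]_n).
Let N := adim n.
Local Notation W := (endo (fock V N)).
Local Notation th j := (Th V N j).
Local Notation dl j := (Dl V N j).
Local Notation base := (@abase C n).
Local Notation Dt j := (base (apr j)).

Definition act_endo A : endo V := Endo (@smod_act_linear _ _ _ V (z0 A)).

Lemma act_endo_linear : linear act_endo.
Proof. by move=> c A B; apply: endoP => v; apply: actz_linear. Qed.
Definition TH D : W := \sum_j acoef D j *: th j.
Definition MA A : W := Mp N (act_endo A).
(* TH D, O0 A and O1 S are the actions of the blocks C = D, A and B = S on
   Lambda(g_{-1}) (x) V; moving S past two creation operators gives a double
   sum in which every pair is met twice, whence 1/2. O0 and O1 are locked, lest
   rewriting rules for sums see through them. *)
Definition O0 : 'M[C]_n -> W :=
  locked (fun A => MA A + \sum_j TH (adm A (Dt j)) * dl j).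
Definition O1 : 'M[C]_n -> W := locked (fun S => \sum_j MA (S *m Dt j) * dl j
  + 2^-1 *: \sum_j \sum_l TH (adm (S *m Dt j) (Dt l)) * dl l * dl j).

Lemma O0E A : O0 A = MA A + \sum_j TH (adm A (Dt j)) * dl j.
Proof. by rewrite /O0 -lock. Qed.
Lemma O1E S : O1 S = \sum_j MA (S *m Dt j) * dl j
  + 2^-1 *: \sum_j \sum_l TH (adm (S *m Dt j) (Dt l)) * dl l * dl j.
Proof. by rewrite /O1 -lock. Qed.

Lemma TH_linear : linear TH.
Proof.
move=> c D D'; rewrite /TH scaler_sumr -big_split; apply: eq_bigr => j _ /=.
by rewrite /acoef !mxE scalerA -scalerDl.
Qed.
Lemma THN D : TH (- D) = - TH D.
Proof. by rewrite -(scaleN1r D) (linear_funZ _ _ TH_linear) scaleN1r. Qed.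
Lemma MA_linear : linear MA.
Proof. by move=> c A B; rewrite /MA act_endo_linear Mp_linear. Qed.
Lemma O0_linear : linear O0.
Proof.
move=> c A B; rewrite !O0E MA_linear scalerDr addrACA; congr (_ + _).
rewrite scaler_sumr -big_split; apply: eq_bigr => j _ /=.
by rewrite adm_linear_l TH_linear mulrDl endo_scalerAl.
Qed.
Lemma O1_linear : linear O1.
Proof.
move=> c A B; rewrite !O1E scalerDr addrACA; congr (_ + _).
  rewrite scaler_sumr -big_split; apply: eq_bigr => j _ /=.
  by rewrite mulmxDl -scalemxAl MA_linear mulrDl endo_scalerAl.
rewrite scalerA mulrC -scalerA -scalerDr; congr (_ *: _).
rewrite scaler_sumr -big_split; apply: eq_bigr => j _ /=.
rewrite scaler_sumr -big_split; apply: eq_bigr => l _ /=.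
by rewrite mulmxDl -scalemxAl adm_linear_l TH_linear !mulrDl !endo_scalerAl.
Qed.

Lemma O0B A B : O0 (A - B) = O0 A - O0 B.
Proof. by rewrite (linear_funB _ _ O0_linear). Qed.

Lemma TH_base (j : 'I_N) : TH (Dt j) = th j.
Proof.
rewrite /TH (bigD1 j) //= acoef_abase eqxx scale1r big1 ?addr0 // => l lj.
by rewrite acoef_abase (negbTE lj) scale0r.
Qed.

Lemma TH_anti_th D l : TH D * th l = - (th l * TH D).
Proof.
rewrite /TH mulr_suml mulr_sumr -sumrN; apply: eq_bigr => j _.
by rewrite -endo_scalerAl Th_anti scalerN -endo_scalerAr.
Qed.
Lemma TH_anti D D' : TH D * TH D' = - (TH D' * TH D).
Proof.
rewrite [TH D']/TH mulr_suml mulr_sumr -sumrN; apply: eq_bigr => j _.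
by rewrite -endo_scalerAr TH_anti_th scalerN -endo_scalerAl opprK.
Qed.

Lemma dl_th (j l : 'I_N) : dl j * th l = (j == l)%:R - th l * dl j.
Proof. by rewrite Dl_Th // val_eqE. Qed.

Lemma sum_kron (X : 'I_N -> W) (l : 'I_N) : \sum_j X j * (j == l)%:R = X l.
Proof.
rewrite (bigD1 l) //= eqxx mulr1 big1 ?addr0 // => j jl.
by rewrite (negbTE jl) mulr0.
Qed.

Lemma MA_th A l : MA A * th l = th l * MA A.
Proof. exact: Mp_Th. Qed.
Lemma O0_th A (l : 'I_N) : O0 A * th l = th l * O0 A + TH (adm A (Dt l)).
Proof.
rewrite !O0E mulrDl mulrDr MA_th -addrA; congr (_ + _).
rewrite mulr_suml mulr_sumr -[TH (adm A (Dt l))](sum_kron (fun j => TH (adm A (Dt j)))).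
rewrite -big_split; apply: eq_bigr => j _ /=.
rewrite -mulrA dl_th mulrBr [X in _ - X]mulrA TH_anti_th.
by rewrite mulNr opprK addrC mulrA.
Qed.

Lemma O0_TH A D : antisym D -> O0 A * TH D = TH D * O0 A + TH (adm A D).
Proof.
move=> aD; rewrite [adm A D](congr1 (adm A) (antisym_sum aD)) (linear_fun_sum _ _ _ (adm_linear A)).
rewrite (linear_fun_sum _ _ _ TH_linear) [TH D]/TH mulr_sumr mulr_suml -big_split.
apply: eq_bigr => j _ /=.
rewrite -endo_scalerAr O0_th scalerDr endo_scalerAl; congr (_ + _).
by rewrite (linear_funZ _ _ (adm_linear A)) (linear_funZ _ _ TH_linear).
Qed.

(** Either of the two annihilators in the double sum can meet theta_l. By [adm_cyclic] the two
    contributions coincide; this absorbs the factor 1/2 and leaves the exterior part of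
    [O0 (S *m Dt l)]. *)
Lemma O1_th S (l : 'I_N) : sym S -> O1 S * th l = - (th l * O1 S) + O0 (S *m Dt l).
Proof.
move=> sS; rewrite O1E O0E mulrDl mulrDr opprD [in RHS]addrACA; congr (_ + _).
  rewrite mulr_suml mulr_sumr -[MA (S *m Dt l)](sum_kron (fun j => MA (S *m Dt j))).
  rewrite -sumrN -big_split; apply: eq_bigr => j _ /=.
  rewrite -mulrA dl_th mulrBr [LHS]addrC; congr (- _ + _).
  by rewrite mulrA -MA_th -mulrA.
rewrite -endo_scalerAl -endo_scalerAr -scalerN.
set X0 := \sum_j TH (adm (S *m Dt l) (Dt j)) * dl j.
rewrite (_ : X0 = 2^-1 *: (X0 *+ 2)); last first.
  by rewrite -scaler_nat scalerA mulVf ?scale1r // pnatr_eq0.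
rewrite -scalerDr; congr (_ *: _); rewrite mulr2n {1}addrC.
set X := fun j m : 'I_N => TH (adm (S *m Dt j) (Dt m)).
(* Moving theta_l to the left past two annihilators and one creation operator gives two contractions
   and the total sign -1. *)
have e (j m : 'I_N) : X j m * dl m * dl j * th l =
    (X j m * dl m) * (j == l)%:R - (X j m * (m == l)%:R) * dl j - th l * (X j m * dl m * dl j).
  rewrite -(mulrA (X j m * dl m) (dl j) (th l)) dl_th mulrBr -addrA; congr (_ + _).
  rewrite (mulrA (X j m * dl m) (th l) (dl j)) -(mulrA (X j m) (dl m) (th l)) dl_th.
  rewrite mulrBr mulrBl (mulrA (X j m) (th l) (dl m)) {2}/X TH_anti_th !mulNr opprK opprD.
  by rewrite !mulrA.
rewrite mulr_suml.
under eq_bigr => j _ do [rewrite mulr_suml; under eq_bigr do rewrite e].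
under eq_bigr => j _ do rewrite !big_split /= !sumrN.
rewrite !big_split /= !sumrN; congr (_ + _); last first.
  by rewrite mulr_sumr; congr (- _); apply: eq_bigr => j _; rewrite mulr_sumr.
congr (_ + _).
  by rewrite exchange_big /=; apply: eq_bigr => m _; rewrite (sum_kron (fun j => X j m * dl m)).
rewrite -sumrN; apply: eq_bigr => j _; rewrite -mulr_suml (sum_kron (X j)) /X.
rewrite (adm_cyclic (abase_antisym _ _) (abase_antisym _ _) sS).
by rewrite THN mulNr opprK.
Qed.

Lemma O1_TH S D : sym S -> antisym D -> O1 S * TH D = - (TH D * O1 S) + O0 (S *m D).
Proof.
move=> sS aD; rewrite [S *m D](congr1 (mulmx S) (antisym_sum aD)) mulmx_sumr (linear_fun_sum _ _ _ O0_linear).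
rewrite [TH D]/TH mulr_sumr mulr_suml -sumrN -big_split.
apply: eq_bigr => j _ /=.
rewrite -endo_scalerAr O1_th // scalerDr scalerN endo_scalerAl; congr (_ + _).
by rewrite -scalemxAr (linear_funZ _ _ O0_linear).
Qed.

Definition vac (v : V) : fock V N := fvac N v.

Lemma O0_vac A v : O0 A (vac v) = vac (smod_act (z0 A) v).
Proof.
rewrite !O0E endoDE endo_sumE big1 ?addr0; last first.
  by move=> j _; rewrite endoME Dl_vac endo_of0.
exact: Mp_vac.
Qed.
Lemma O1_vac S v : O1 S (vac v) = 0.
Proof.
rewrite !O1E endoDE endoZE !endo_sumE !big1 ?scaler0 ?addr0 // => j _.
  by rewrite endo_sumE big1 // => l _; rewrite endoME Dl_vac endo_of0.
by rewrite endoME Dl_vac endo_of0.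
Qed.

Lemma endo_eq0 (s : bool) (T : W) :
  (forall j : 'I_N, T * th j = (-1) ^+ s *: (th j * T)) ->
  (forall v, T (vac v) = 0) -> T = 0.
Proof. by move=> hT; apply: (fock_eq0 (s := s)) => j jN; have := hT (Ordinal jN). Qed.

(** The difference of the two sides commutes with every theta_l, by [adm_bracket], and kills the
    vacuum because V is a module over gl(n). *)
Lemma O0_bracket A B : O0 (A *m B - B *m A) = O0 A * O0 B - O0 B * O0 A.
Proof.
apply/esym/eqP; rewrite -subr_eq0; apply/eqP; apply: (endo_eq0 (s := false)) => [l|v].
  have e A' B' : O0 A' * O0 B' * th l = th l * (O0 A' * O0 B') + TH (adm A' (Dt l)) * O0 B'
      + TH (adm B' (Dt l)) * O0 A' + TH (adm A' (adm B' (Dt l))).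
    rewrite -mulrA O0_th mulrDr (mulrA (O0 A') (th l)) O0_th mulrDl.
    by rewrite (O0_TH _ (adm_antisym _ (abase_antisym _ _))) addrA mulrA.
  rewrite scale1r !mulrBl !mulrBr !e O0_th -adm_bracket (linear_funD _ _ TH_linear) THN.
  exact: zmod_cancel.
by rewrite !endoBE !endoME !O0_vac (linear_funB _ _ (fvac_linear N)) (linear_funB _ _ (fvac_linear N)) actzz subrr (linear_fun0 (fvac_linear N)).
Qed.

(** The difference anticommutes with every theta_l, by [adm_sym] and [O0_bracket], and each of its
    terms kills the vacuum. *)
Lemma O0_O1 A S : sym S -> O1 (A *m S + S *m A^T) = O0 A * O1 S - O1 S * O0 A.
Proof.
move=> sS.
have sS' : sym (A *m S + S *m A^T).
  by rewrite /sym linearD /= !trmx_mul trmxK sS addrC.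
apply/esym/eqP; rewrite -subr_eq0; apply/eqP; apply: (endo_eq0 (s := true)) => [l|v].
  have aD := abase_antisym C (apr l); have aA := adm_antisym A aD.
  have e1 : O0 A * O1 S * th l =
      - (th l * (O0 A * O1 S)) - TH (adm A (Dt l)) * O1 S + O0 A * O0 (S *m Dt l).
    by rewrite -mulrA O1_th // mulrDr mulrN (mulrA (O0 A) (th l)) O0_th mulrDl opprD -mulrA.
  have e2 : O1 S * O0 A * th l = - (th l * (O1 S * O0 A)) + O0 (S *m Dt l) * O0 A
      - TH (adm A (Dt l)) * O1 S + O0 (S *m adm A (Dt l)).
    by rewrite -mulrA O0_th mulrDr (mulrA (O1 S) (th l)) O1_th // mulrDl O1_TH // mulNr -mulrA addrA.
  have e3 : O0 ((A *m S + S *m A^T) *m Dt l) =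
      O0 A * O0 (S *m Dt l) - O0 (S *m Dt l) * O0 A - O0 (S *m adm A (Dt l)).
    by rewrite -(adm_sym A S aD) O0B O0_bracket.
  rewrite expr1 scaleN1r !mulrBl e1 e2 O1_th // e3 !mulrBr.
  exact: zmod_cancel1.
by rewrite !endoBE !endoME O0_vac !O1_vac endo_of0 !subr0.
Qed.
(** Commuting the anticommutator with theta_l leaves commutators of [O0] with [O1], which cancel by
    [O0_O1] and [sym_cyclic]. *)
Lemma O1_anti S S' : sym S -> sym S' -> O1 S * O1 S' = - (O1 S' * O1 S).
Proof.
move=> sS sS'; apply/eqP; rewrite -subr_eq0 opprK; apply/eqP; apply: (endo_eq0 (s := false)) => [l|v].
  have aD := abase_antisym C (apr l).
  have e S1 S2 : sym S1 -> sym S2 -> O1 S1 * O1 S2 * th l =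
      th l * (O1 S1 * O1 S2) - O0 (S1 *m Dt l) * O1 S2 + O1 S1 * O0 (S2 *m Dt l).
    by move=> s1 s2; rewrite -mulrA O1_th // mulrDr mulrN (mulrA (O1 S1) (th l)) O1_th // mulrDl mulNr opprD opprK -mulrA.
  rewrite mulrDl !e // scale1r (mulrDr (th l) (O1 S * O1 S')). apply: zmod_cancel2.
  by rewrite -!O0_O1 // -(linear_funD _ _ O1_linear) (sym_cyclic aD) // (linear_fun0 O1_linear).
by rewrite !endoDE !endoME !O1_vac !endo_of0 addr0.
Qed.

Lemma O1N S : O1 (- S) = - O1 S.
Proof. by rewrite -(scaleN1r S) (linear_funZ _ _ O1_linear) scaleN1r. Qed.

Lemma O0_odd A S D : sym S -> antisym D ->
  O1 (A *m S + S *m A^T) + TH (adm A D) =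
  O0 A * (O1 S + TH D) - (O1 S + TH D) * O0 A.
Proof.
move=> sS aD; rewrite (mulrDr (O0 A) (O1 S)) (mulrDl (O1 S)) O0_O1 // O0_TH //.
rewrite (opprD (O1 S * _)) [RHS](AC ((1*2)*2) (((1*4)*3)*(2*5))) /=.
by rewrite subrr addr0.
Qed.

Lemma pe_blocks a (x : set_type (pe C n)) : homog a (val x) ->
  [/\ if a then ulsubmx (val x) = 0 else ursubmx (val x) = 0 /\ dlsubmx (val x) = 0,
      sym (ursubmx (val x)), antisym (dlsubmx (val x)) &
      val x = block_mx (ulsubmx (val x)) (ursubmx (val x)) (dlsubmx (val x)) (- (ulsubmx (val x))^T)].
Proof.
move=> hx; have [X1 X2 X3] : in_pe (val x) by exact: (lie_val x).
split=> //; last by rewrite -X1 submxK.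
by case: a hx => <-; rewrite /hpart ?block_mxKul ?block_mxKur ?block_mxKdl.
Qed.

Definition kac_act (x : set_type (pe C n)) (w : fock V N) : fock V N :=
  (O0 (ulsubmx (val x)) + O1 (ursubmx (val x)) + TH (dlsubmx (val x))) w.

Lemma kac_act_linear x : linear (kac_act x).
Proof. exact: endo_linear. Qed.

Lemma kac_actP (c : C) (x y z : set_type (pe C n)) w :
  val z = c *: val x + val y -> kac_act z w = c *: kac_act x w + kac_act y w.
Proof.
move=> hz; rewrite /kac_act hz -endoZE -endoDE; congr (endo_fun _ w).
have -> : ulsubmx (c *: val x + val y) = c *: ulsubmx (val x) + ulsubmx (val y).
  by apply/matrixP => i j; rewrite !mxE.
have -> : ursubmx (c *: val x + val y) = c *: ursubmx (val x) + ursubmx (val y).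
  by apply/matrixP => i j; rewrite !mxE.
have -> : dlsubmx (c *: val x + val y) = c *: dlsubmx (val x) + dlsubmx (val y).
  by apply/matrixP => i j; rewrite !mxE.
rewrite O0_linear O1_linear TH_linear (scalerDr c (O0 _ + O1 _) (TH _)).
rewrite (scalerDr c (O0 _) (O1 _)).
by rewrite [LHS](AC ((2*2)*2) ((1*3*5)*(2*4*6))).
Qed.

Definition kac_par (w : fock V N) : fock V N := fpar (@smod_par _ _ _ V) w.
Lemma kac_par_linear : linear kac_par.
Proof. exact/fpar_linear/smod_par_linear. Qed.
Lemma kac_parK : involutive kac_par.
Proof. apply: fparK; [exact: smod_par_linear|exact: smod_parK]. Qed.

Lemma kac_par_th j w : kac_par (th j w) = - th j (kac_par w).
Proof. exact/fpar_Th/smod_par_linear. Qed.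
Lemma kac_par_dl j w : kac_par (dl j w) = - dl j (kac_par w).
Proof. exact/fpar_Dl/smod_par_linear. Qed.
Lemma kac_par_MA A w : kac_par (MA A w) = MA A (kac_par w).
Proof. by apply: fpar_Mp => v; apply: actz_par. Qed.
Lemma kac_par_TH D w : kac_par (TH D w) = - TH D (kac_par w).
Proof.
rewrite /TH !endo_sumE (linear_fun_sum _ _ _ kac_par_linear) -sumrN.
apply: eq_bigr => j _.
by rewrite !endoZE (linear_funZ _ _ kac_par_linear) kac_par_th scalerN.
Qed.
Lemma kac_par_O0 A w : kac_par (O0 A w) = O0 A (kac_par w).
Proof.
rewrite !O0E !endoDE (linear_funD _ _ kac_par_linear) kac_par_MA; congr (_ + _).
rewrite !endo_sumE (linear_fun_sum _ _ _ kac_par_linear); apply: eq_bigr => j _.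
by rewrite !endoME kac_par_TH kac_par_dl endo_ofN opprK.
Qed.
Lemma kac_par_O1 S w : kac_par (O1 S w) = - O1 S (kac_par w).
Proof.
rewrite !O1E !endoDE (linear_funD _ _ kac_par_linear) opprD; congr (_ + _).
  rewrite !endo_sumE (linear_fun_sum _ _ _ kac_par_linear) -sumrN; apply: eq_bigr => j _.
  by rewrite !endoME kac_par_MA kac_par_dl endo_ofN.
rewrite !endoZE (linear_funZ _ _ kac_par_linear) -scalerN; congr (_ *: _).
rewrite !endo_sumE (linear_fun_sum _ _ _ kac_par_linear) -sumrN; apply: eq_bigr => j _.
rewrite !endo_sumE (linear_fun_sum _ _ _ kac_par_linear) -sumrN; apply: eq_bigr => l _.
by rewrite !endoME kac_par_TH kac_par_dl endo_ofN kac_par_dl !endo_ofN !opprK.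
Qed.

Lemma kac_act_par a (x : set_type (pe C n)) w : homog a (val x) ->
  kac_par (kac_act x w) = (-1) ^+ a *: kac_act x (kac_par w).
Proof.
move=> hx; have [h _ _ _] := pe_blocks hx; rewrite /kac_act.
case: a h {hx} => [->|[-> ->]].
  rewrite (linear_fun0 O0_linear) add0r !endoDE (linear_funD _ _ kac_par_linear).
  by rewrite kac_par_O1 kac_par_TH expr1 scaleN1r opprD.
by rewrite (linear_fun0 O1_linear) (linear_fun0 TH_linear) !addr0 kac_par_O0 scale1r.
Qed.

Lemma kac_act_bracket a b (x y z : set_type (pe C n)) w :
    homog a (val x) -> homog b (val y) ->
    val z = sbracket a b (val x) (val y) ->
  kac_act z w = kac_act x (kac_act y w) - (-1) ^+ (a && b) *: kac_act y (kac_act x w).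
Proof.
move=> hx hy; rewrite /kac_act -!endoME -endoZE -endoBE.
have [x1 x2 x3 ex] := pe_blocks hx; have [y1 y2 y3 ey] := pe_blocks hy.
move: x1 x2 x3 ex y1 y2 y3 ey.
set A := ulsubmx (val x); set S := ursubmx (val x); set D := dlsubmx (val x).
set A' := ulsubmx (val y); set S' := ursubmx (val y); set D' := dlsubmx (val y).
move=> x1 sS aD ex y1 sS' aD' ey.
rewrite ex ey /sbracket !mulmx_block scale_block_mx opp_block_mx add_block_mx => ez.
rewrite ez !block_mxKul !block_mxKur !block_mxKdl; congr (endo_fun _ w).
have z0 := linear_fun0 O0_linear; have z1 := linear_fun0 O1_linear.
have zm := linear_fun0 TH_linear.
case: a x1 {hx ex ez} => [eA|[eS eD]]; case: b y1 {hy ey} => [eA'|[eS' eD']] /=; rewrite ?expr0.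
- rewrite expr1 !scaleN1r !opprK eA eA' !(trmx0, oppr0, mul0mx, mulmx0, add0r, addr0, z0, z1, zm).
  rewrite (linear_funD _ _ O0_linear) !mulrDl !mulrDr.
  have c2 := O1_TH sS aD'; have c3 := O1_TH sS' aD.
  rewrite (O1_anti sS sS') (TH_anti D D') c2 c3.
  rewrite [RHS](AC (((1*2)*2)*((1*2)*2)) ((3*8)*((6*1)*((9*2)*((4*7)*(10*5)))))) /=.
  by rewrite !subrr !addr0.
- rewrite !scale1r eA eS' eD' !(trmx0, oppr0, mul0mx, mulmx0, add0r, addr0, sub0r, z0, z1, zm).
  rewrite -[RHS]opprB -O0_odd // opprD -O1N -THN; congr (O1 _ + TH _).
    by rewrite mulmxN opprD addrC.
  by rewrite /adm mulNmx !opprK addrC.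
- rewrite !scale1r eA' eS eD !(trmx0, oppr0, mul0mx, mulmx0, add0r, addr0, sub0r, z0, z1, zm).
  by rewrite -O0_odd // mulmxN opprK mulNmx -opprD.
- rewrite !scale1r eS eD eS' eD' !(mul0mx, mulmx0, add0r, addr0, subr0, oppr0, z1, zm).
  exact: O0_bracket.
Qed.

Definition kac : smod (pe C n) := SMod kac_par_linear kac_parK kac_act_linear
  kac_actP kac_act_par kac_act_bracket.

Lemma kac_e0 A (w : kac) : smod_act (e0 A) w = O0 A w.
Proof.
rewrite /= /kac_act /= /mx0 block_mxKul block_mxKur block_mxKdl.
by rewrite (linear_fun0 O1_linear) (linear_fun0 TH_linear) !addr0.
Qed.
Lemma kac_e1 B (w : kac) : smod_act (e1 B) w = O1 (B + B^T) w.
Proof.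
rewrite /= /kac_act /= /mx1 block_mxKul block_mxKur block_mxKdl.
by rewrite (linear_fun0 O0_linear) (linear_fun0 TH_linear) add0r addr0.
Qed.
Lemma kac_em D (w : kac) : smod_act (em D) w = TH (D - D^T) w.
Proof.
rewrite /= /kac_act /= /mxm block_mxKul block_mxKur block_mxKdl.
by rewrite (linear_fun0 O0_linear) (linear_fun0 O1_linear) !add0r.
Qed.
Lemma kac_em_dE (j : 'I_N) (w : kac) : smod_act (em (dE C (apr j))) w = th j w.
Proof. by rewrite kac_em /dE trmx_delta TH_base. Qed.

(** * Universal property of the Kac module *)

Section Extension.
Variables (P : smod (pe C n)) (phi : V -> P).
Hypothesis phi_linear : linear phi.
Hypothesis phi_act : forall A v, phi (smod_act (z0 A) v) = smod_act (e0 A) (phi v).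
Hypothesis phi_par : forall v, phi (smod_par v) = smod_par (phi v).
Hypothesis phi_kill : forall B v, smod_act (e1 B) (phi v) = 0.

(** The action on P that corresponds to creating theta_j. Since [fock] numbers its generators by
    natural numbers, indices out of range are sent to 0. *)
Definition em_creation (j : nat) (p : P) : P :=
  if insub j is Some o then smod_act (em (dE C (apr (o : 'I_N)))) p else 0.
Fixpoint ext k : fock V k -> P :=
  if k is k'.+1 return fock V k -> P then fun w => ext w.1 + em_creation k' (ext w.2) else phi.

Lemma creP_linear j : linear (em_creation j).
Proof.
move=> c p q; rewrite /em_creation; case: insub => [o|]; last by rewrite scaler0 addr0.
exact: smod_act_linear.
Qed.
Lemma creP_anti i j p : em_creation i (em_creation j p) = - em_creation j (em_creation i p).
Proof.
rewrite /em_creation; case: (insub i) => [o|]; case: (insub j) => [o'|]; rewrite ?oppr0 //.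
- by apply/eqP; rewrite -addr_eq0; apply/eqP/actmm.
- by rewrite (linear_fun0 (@smod_act_linear _ _ _ P _)).
- by rewrite (linear_fun0 (@smod_act_linear _ _ _ P _)) oppr0.
Qed.
Lemma creP_sq j p : em_creation j (em_creation j p) = 0.
Proof.
by have /eqP := creP_anti j j p; rewrite -addr_eq0 -mulr2n -scaler_nat scaler_eq0 pnatr_eq0 => /eqP.
Qed.

Lemma ext_linear k : linear (@ext k).
Proof.
elim: k => [|k IH] c u w /=; first exact: phi_linear.
by rewrite IH IH creP_linear scalerDr addrACA.
Qed.
Lemma ext_vac k v : @ext k (fvac k v) = phi v.
Proof.
elim: k => [|k IH] //=.
by rewrite IH (linear_fun0 (@ext_linear k)) (linear_fun0 (creP_linear k)) addr0.
Qed.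
Lemma ext_th k j w : (j < k)%N -> @ext k (Th V k j w) = em_creation j (ext w).
Proof.
elim: k w => [|k IH] w //= jk; have lc := creP_linear.
have [->|nj] := eqVneq j k.
  by rewrite (linear_fun0 (@ext_linear k)) add0r (linear_funD _ _ (lc k)) creP_sq addr0.
have jk' : (j < k)%N by rewrite ltn_neqAle nj -ltnS.
rewrite -[- fcreate _ _]scaleN1r (linear_funZ _ _ (@ext_linear k)).
rewrite [ext (fcreate j w.1)](IH w.1 jk') [ext (fcreate j w.2)](IH w.2 jk') (linear_funD _ _ (lc j)).
by rewrite (linear_funZ _ _ (lc k)) scaleN1r (creP_anti j).
Qed.

Lemma act_em_eq D D' p : D - D^T = D' - D'^T ->
  smod_act (g := pe C n) (s := P) (em D) p = smod_act (em D') p.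
Proof. by move=> h; congr (smod_act _ p); apply: val_inj; rewrite /= /mxm h. Qed.

Lemma crePE (j : 'I_N) p : em_creation j p = smod_act (em (dE C (apr j))) p.
Proof. by rewrite /em_creation insubT // => h; congr (smod_act (em (dE C (apr _))) p); apply: val_inj. Qed.

Lemma half_antisym D : antisym D -> 2^-1 *: D - (2^-1 *: D)^T = D.
Proof.
move=> aD; rewrite linearZ /= aD scalerN opprK -scalerDl -mulr2n -[_ *+ 2]mulr_natr.
by rewrite mulVf ?scale1r // pnatr_eq0.
Qed.

Lemma ext_TH D (w : fock V N) : antisym D ->
  ext (TH D w) = smod_act (em (2^-1 *: D)) (ext w).
Proof.
move=> aD; rewrite (@act_em_eq (2^-1 *: D) (\sum_j acoef D j *: dE C (apr j))).
  rewrite (linear_fun_sum _ _ _ (actm_linear _)) /TH endo_sumE (linear_fun_sum _ _ _ (@ext_linear N)).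
  apply: eq_bigr => j _; rewrite endoZE (linear_funZ _ _ (@ext_linear N)).
  by rewrite (linear_funZ _ _ (actm_linear _)) ext_th // crePE.
rewrite half_antisym // {1}(antisym_sum aD) linear_sum /= -sumrB.
by apply: eq_bigr => j _; rewrite linearZ /= /dE trmx_delta -scalerBr.
Qed.

(** Both sides agree on the vacuum and obey the same rule for moving past a creation operator,
    [O0_th] in the model and [act0m] in P; [ext_O1] follows the same pattern. *)
Lemma ext_O0 A (w : fock V N) : ext (O0 A w) = smod_act (e0 A) (ext w).
Proof.
elim/fock_ind: w => [v|u w IHu IHw|j w jN IH].
- by rewrite [O0 A _]O0_vac !ext_vac phi_act.
- rewrite endo_ofD !(linear_funD _ _ (@ext_linear N)) IHu IHw.
  by rewrite (linear_funD _ _ (@smod_act_linear _ _ _ P _)).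
- have := O0_th A (Ordinal jN) => /(congr1 (fun f : W => f w)).
  rewrite endoDE !endoME /= => ->; rewrite (linear_funD _ _ (@ext_linear N)).
  rewrite [ext (Th V N j _)]ext_th // [in RHS]ext_th // IH.
  rewrite ext_TH; last exact/adm_antisym/abase_antisym.
  rewrite !(crePE (Ordinal jN)).
  have /eqP := act0m A (dE C (apr (Ordinal jN))) (ext w).
  rewrite eq_sym subr_eq => /eqP ->; rewrite addrC; congr (_ + _).
  apply: act_em_eq.
  rewrite half_antisym; last exact/adm_antisym/abase_antisym.
  rewrite /adm [(- _)^T]linearN /= [(_ *m _ + _)^T]linearD /= !trmx_mul trmxK /abase /dE trmx_delta.
  by rewrite mulmxBr mulmxBl addrACA opprK [in RHS](addrC (_ *m A)) !opprD !opprK.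
Qed.

Lemma ext_O1 S (w : fock V N) : sym S -> ext (O1 S w) = smod_act (e1 (2^-1 *: S)) (ext w).
Proof.
move=> sS; elim/fock_ind: w => [v|u w IHu IHw|j w jN IH].
- by rewrite [O1 S _]O1_vac (linear_fun0 (@ext_linear N)) ext_vac phi_kill.
- rewrite endo_ofD !(linear_funD _ _ (@ext_linear N)) IHu IHw.
  by rewrite (linear_funD _ _ (@smod_act_linear _ _ _ P _)).
- have := O1_th (Ordinal jN) sS => /(congr1 (fun f : W => f w)).
  rewrite endoDE endoNE !endoME /= => ->; rewrite (linear_funD _ _ (@ext_linear N)) ext_O0.
  rewrite -scaleN1r (linear_funZ _ _ (@ext_linear N)) scaleN1r.
  rewrite [ext (Th V N j _)]ext_th // [in RHS]ext_th // IH.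
  rewrite !(crePE (Ordinal jN)) addrC; apply/eqP; rewrite subr_eq -act1m; apply/eqP.
  congr (smod_act (e0 _) _); rewrite /dE trmx_delta -/(abase C _); congr (_ *m _).
  by rewrite linearZ /= sS -scalerDl -mulr2n -[_ *+ 2]mulr_natr mulVf ?scale1r // pnatr_eq0.
Qed.

Lemma ext_par k w : @ext k (fpar (@smod_par _ _ _ V) w) = smod_par (ext w).
Proof.
have lp := @smod_par_linear _ _ _ P.
elim: k w => [|k IH] w //=.
rewrite -[- fpar _ _]scaleN1r (linear_funZ _ _ (@ext_linear k)) !IH (linear_funD _ _ lp).
congr (_ + _); rewrite (linear_funZ _ _ (creP_linear k)) /em_creation; case: insub => [o|].
  by rewrite (smod_act_par (a := true)) //; apply: mxm_homog.
by rewrite scaler0 (linear_fun0 lp).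
Qed.

(** Frobenius reciprocity: it supplies for [kac V] the maps out of the module induced from g_0 +
    g_1, where g_1 acts on V by 0. *)
Lemma kac_extend : exists F : shom kac P, forall v, F (vac v) = phi v.
Proof.
have act x w : @ext N (kac_act x w) = smod_act x (ext w).
  have [X1 X2 X3] : in_pe (val x) by exact: (lie_val x).
  rewrite [RHS]act_pe /kac_act !endoDE !(linear_funD _ _ (@ext_linear N)).
  by rewrite ext_O0 ext_O1 // ext_TH.
exists (@SHom _ _ _ kac P (@ext N) (@ext_linear N) act (@ext_par N)) => v.
exact: ext_vac.
Qed.
End Extension.

Lemma th_in_sub (T : submod kac) (j : nat) w : (j < N)%N -> T w -> T (th j w).
Proof. by move=> jN Tw; have := kac_em_dE (Ordinal jN) w => /= <-; apply: sub_act. Qed.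

(** The vacuum vectors are reached by gl(n), and creation operators are actions of elements of
    g_{-1}. *)
Lemma vac_generates (v : V) : generates v -> generates (vac v : kac).
Proof.
move=> gv; pose P (w : kac) := exists u, w = umod u (vac v : kac).
have act x (w : kac) : P w -> P (smod_act x w).
  by move=> [u ->]; exists (ugen x * u); rewrite umodM umod_gen.
have PD (u w : kac) : P u -> P w -> P (u + w).
  by move=> [a ->] [b ->]; exists (a + b); rewrite umodD.
have PZ c (u : kac) : P u -> P (c *: u).
  by move=> [a ->]; exists (c *: a); rewrite umodZ.
have Puev t v' : P (vac v') -> P (vac (uev t v')).
  elim: t v' => [x|c|s IHs t IHt|s IHs t IHt] v' Pv' /=.
  - by rewrite act_pe_even -O0_vac -kac_e0; apply: act.
  - by rewrite /vac (linear_funZ _ _ (fvac_linear N)); apply: PZ.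
  - by rewrite /vac (linear_funD _ _ (fvac_linear N)); apply: PD; [apply: IHs|apply: IHt].
  - exact/IHs/IHt.
elim/fock_ind => [v'|u w|j w jN Pw].
- by have [u ->] := gv v'; apply: Puev; exists 1; rewrite umod1.
- exact: PD.
- by have := kac_em_dE (Ordinal jN) w => /= <-; apply: act.
Qed.

Definition top (v : V) : fock V N := ftop N v.

Lemma top_linear : linear top. Proof. exact: ftop_linear. Qed.

Lemma TH_top D v : TH D (top v) = 0.
Proof.
rewrite /TH endo_sumE big1 // => j _.
by rewrite endoZE Th_top // scaler0.
Qed.

Lemma th_dl_top (i j : 'I_N) v : th i (dl j (top v)) = (i == j)%:R *: top v.
Proof.
have := dl_th j i => /(congr1 (fun f : W => f (top v))).
rewrite endoBE !endoME Th_top // endo_of0 => /esym/eqP.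
rewrite subr_eq0 eq_sym => /eqP ->; rewrite eq_sym; case: eqP => _.
  by rewrite scale1r.
by rewrite scale0r.
Qed.

(** The diagonal entries of A acting on g_{-1}, in the basis E_ij - E_ji with i < j; only these
    contribute on Lambda^top. *)
Lemma acoef_adm A (p : 'I_n * 'I_n) : (p.1 < p.2)%N ->
  adm A (base p) p.1 p.2 = - (A p.1 p.1 + A p.2 p.2).
Proof.
case: p => p1 p2 /= lt12; have ne : (p1 == p2) = false by rewrite -val_eqE (ltn_eqF lt12).
have mr (M : 'M[C]_n) i j a b : (M *m delta_mx i j) a b = M a i * (b == j)%:R.
  rewrite mxE (bigD1 i) //= mxE eqxx big1 ?addr0 // => k ki.
  by rewrite mxE (negbTE ki) mulr0.
have ml (M : 'M[C]_n) i j a b : (delta_mx i j *m M) a b = (a == i)%:R * M j b.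
  rewrite mxE (bigD1 j) //= mxE eqxx andbT big1 ?addr0 // => k kj.
  by rewrite mxE (negbTE kj) andbF mul0r.
rewrite /adm /abase mulmxBr mulmxBl mxE; congr (- _).
rewrite mxE [X in X + _]mxE [X in _ + X]mxE.
rewrite [(- (A^T *m _)) _ _]mxE [(- (_ *m A)) _ _]mxE !mr !ml /= !eqxx (eq_sym p2) ne !mxE.
by rewrite mulr0 mul0r !subr0 mulr1 mul1r.
Qed.

(** Every index occurs in n - 1 of the pairs. *)
Lemma sum_pairs (a : 'I_n -> C) :
  \sum_(p : 'I_n * 'I_n | (p.1 < p.2)%N) (a p.1 + a p.2) = (n%:R - 1) * \sum_i a i.
Proof.
rewrite big_split /=.
have -> : \sum_(p : 'I_n * 'I_n | (p.1 < p.2)%N) a p.2 = \sum_(p : 'I_n * 'I_n | (p.2 < p.1)%N) a p.1.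
  by rewrite (reindex_inj (h := fun p : 'I_n * 'I_n => (p.2, p.1))) //= => -[? ?] [? ?] [-> ->].
have -> : \sum_(p : 'I_n * 'I_n | (p.1 < p.2)%N) a p.1 + \sum_(p : 'I_n * 'I_n | (p.2 < p.1)%N) a p.1
   = \sum_(p : 'I_n * 'I_n | p.1 != p.2) a p.1.
  rewrite [RHS](bigID (fun p : 'I_n * 'I_n => (p.1 < p.2)%N)) /=; congr (_ + _); apply: eq_bigl => -[p1 p2] /=.
    by rewrite -val_eqE; case: ltngtP.
  by rewrite -val_eqE; case: ltngtP.
have -> : \sum_(p : 'I_n * 'I_n | p.1 != p.2) a p.1 = \sum_i \sum_(j | i != j) a i.
  by rewrite pair_big_dep.
rewrite mulr_sumr; apply: eq_bigr => i _.
have : \sum_(j : 'I_n) a i = n%:R * a i by rewrite sumr_const card_ord mulr_natl.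
rewrite (bigD1 i) //= => h; rewrite mulrBl mul1r -h [a i + _]addrC addrK.
by apply: eq_bigl => j; rewrite eq_sym.
Qed.

(** On Lambda^top(g_{-1}) the matrix A acts by its trace on g_{-1}, which is (1 - n) tr A: this is
    the weight [eta]. *)
Lemma O0_top A v : O0 A (top v) = top (smod_act (z0 A) v) + ((1 - n%:R) * \tr A) *: top v.
Proof.
rewrite O0E endoDE [MA A _]Mp_top endo_sumE; congr (_ + _).
have -> : (1 - n%:R) * \tr A = \sum_(j < N) acoef (adm A (Dt j)) j.
  rewrite (sum_apr (fun p => adm A (base p) p.1 p.2)).
  rewrite (eq_bigr (fun p : 'I_n * 'I_n => - (A p.1 p.1 + A p.2 p.2))); last by move=> p; apply: acoef_adm.
  by rewrite sumrN (sum_pairs (fun i => A i i)) -mulNr opprB.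
rewrite scaler_suml; apply: eq_bigr => j _.
rewrite endoME /TH endo_sumE (bigD1 j) // endoZE [th j _]th_dl_top eqxx scale1r.
rewrite big1 => [|i ij]; first exact: addr0.
by rewrite endoZE [th i _]th_dl_top (negbTE ij) scale0r scaler0.
Qed.

Lemma kac_par_top v : kac_par (top v) = (-1) ^+ N *: top (smod_par v).
Proof. exact/fpar_top/smod_par_linear. Qed.

Lemma sub_reaches_top (T : submod kac) w : T w -> w <> 0 -> exists2 v, v <> 0 & T (top v).
Proof.
apply: (@fock_reach_top C V N T) => [j u jN|u]; first exact: th_in_sub.
by move=> Tu; apply: subN.
Qed.
End KacModule.

(** * Uniqueness of singular vectors in Verma modules of gl(n) *)

Section Commutators.
Variable R : pzRingType.
Implicit Types a b c : R.

Definition cm a b := a * b - b * a.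

Lemma cmDl a b c : cm (a + b) c = cm a c + cm b c.
Proof. by rewrite /cm mulrDl mulrDr opprD addrACA. Qed.
Lemma cmDr a b c : cm c (a + b) = cm c a + cm c b.
Proof. by rewrite /cm mulrDl mulrDr opprD addrACA. Qed.
Lemma cmNl a b : cm (- a) b = - cm a b.
Proof. by rewrite /cm mulNr mulrN opprB opprK addrC. Qed.
Lemma cmNr a b : cm a (- b) = - cm a b.
Proof. by rewrite /cm mulNr mulrN opprB opprK addrC. Qed.
Lemma cmMl a b c : cm (a * b) c = a * cm b c + cm a c * b.
Proof. by rewrite /cm mulrBr mulrBl !mulrA addrA subrK. Qed.
Lemma cmMr a b c : cm a (b * c) = cm a b * c + b * cm a c.
Proof. by rewrite /cm mulrBr mulrBl !mulrA addrA subrK. Qed.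
Lemma cm0r a : cm a 0 = 0. Proof. by rewrite /cm mulr0 mul0r subrr. Qed.
Lemma cm0l a : cm 0 a = 0. Proof. by rewrite /cm mulr0 mul0r subrr. Qed.
Lemma cmxx a : cm a a = 0. Proof. by rewrite /cm subrr. Qed.
Lemma cmC a b : cm a b = - cm b a. Proof. by rewrite /cm opprB. Qed.
Lemma cm_sumr (I : Type) (r : seq I) (P : pred I) (F : I -> R) a :
  cm a (\sum_(i <- r | P i) F i) = \sum_(i <- r | P i) cm a (F i).
Proof. by apply: (big_morph (cm a)) => [x y|]; rewrite ?cmDr ?cm0r. Qed.
Lemma cm_suml (I : Type) (r : seq I) (P : pred I) (F : I -> R) a :
  cm (\sum_(i <- r | P i) F i) a = \sum_(i <- r | P i) cm (F i) a.
Proof. by apply: (big_morph (cm^~ a)) => [x y|]; rewrite ?cmDl ?cm0l. Qed.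

Lemma sum_mulrb (r : nat) (F : nat -> R) (k : nat) : (k < r)%N ->
  \sum_(i < r) F i *+ (i == k :> nat) = F k.
Proof.
move=> kr; rewrite (bigD1 (Ordinal kr)) //= eqxx mulr1n big1 ?addr0 // => i ik.
by rewrite [_ == k](negbTE ik).
Qed.

(* One step gl(r) -> gl(r+1): E acts on the coefficients, X and D are the
   multiplications and derivations for r new variables, and Lm is the Euler
   operator shifted by the weight of the new Cartan element. *)
Section Step.
Variables (r : nat) (E : nat -> nat -> R) (X D : nat -> R) (Lm : R).
Hypothesis EE : forall i j k l, (i < r)%N -> (j < r)%N -> (k < r)%N -> (l < r)%N ->
  cm (E i j) (E k l) = E i l *+ (j == k) - E k j *+ (l == i).
Hypothesis EX : forall i j k, cm (E i j) (X k) = 0.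
Hypothesis ED : forall i j k, cm (E i j) (D k) = 0.
Hypothesis ELm : forall i j, cm (E i j) Lm = 0.
Hypothesis XX : forall i j, cm (X i) (X j) = 0.
Hypothesis DD : forall i j, cm (D i) (D j) = 0.
Hypothesis DX : forall i j, cm (D i) (X j) = (i == j)%:R.
Hypothesis LmX : forall i, (i < r)%N -> cm Lm (X i) = X i.
Hypothesis DLm : forall i, (i < r)%N -> cm (D i) Lm = D i.

Definition stepS i := \sum_(k < r) E i k * D k.

(** Polynomials in the X_j with coefficients in a gl(r)-module, on which E_(r,j) is multiplication
    by X_j. Commuting with the X_k forces the term - X_j D_i in E_(i,j). The operator E_(i,r) kills
    constants, and its bracket with X_l is E_(i,l) - X_l D_i, minus Lm when i = l. *)
Definition step i j : R :=
  if (i < r)%N then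
    if (j < r)%N then E i j - X j * D i
    else if j == r then stepS i - Lm * D i else 0
  else if i == r then
    if (j < r)%N then X j else if j == r then Lm else 0
  else 0.

Definition step_rel i j k l :=
  cm (step i j) (step k l) = step i l *+ (j == k) - step k j *+ (l == i).

Lemma step_rel_sym i j k l : step_rel i j k l -> step_rel k l i j.
Proof.
by rewrite /step_rel cmC => /eqP; rewrite eqr_oppLR opprB => /eqP ->; rewrite !(eq_sym l) !(eq_sym j).
Qed.

Lemma XE i j k : cm (X k) (E i j) = 0. Proof. by rewrite cmC EX oppr0. Qed.
Lemma DE i j k : cm (D k) (E i j) = 0. Proof. by rewrite cmC ED oppr0. Qed.
Lemma XD i j : cm (X i) (D j) = - (j == i)%:R. Proof. by rewrite cmC DX. Qed.
Lemma XLm i : (i < r)%N -> cm (X i) Lm = - X i. Proof. by move=> h; rewrite cmC LmX. Qed.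
Lemma LmD i : (i < r)%N -> cm Lm (D i) = - D i. Proof. by move=> h; rewrite cmC DLm. Qed.

Lemma stepS_X i l : (l < r)%N -> cm (stepS i) (X l) = E i l.
Proof.
move=> lr; rewrite cm_suml -[RHS](sum_mulrb (fun k => E i k) lr); apply: eq_bigr => k _.
by rewrite cmMl EX mul0r addr0 DX mulr_natr.
Qed.
Lemma stepS_D i l : cm (stepS i) (D l) = 0.
Proof. by rewrite cm_suml big1 // => k _; rewrite cmMl ED DD mul0r mulr0 addr0. Qed.
Lemma stepS_Lm i : cm (stepS i) Lm = stepS i.
Proof. by rewrite cm_suml; apply: eq_bigr => k _; rewrite cmMl ELm DLm // mul0r addr0. Qed.
Lemma E_stepS i j k : (i < r)%N -> (j < r)%N -> (k < r)%N ->
  cm (E i j) (stepS k) = stepS i *+ (j == k) - E k j * D i.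
Proof.
move=> ir jr kr; rewrite cm_sumr -(sum_mulrb (fun l => E k j * D l) ir) -sumrMnl -sumrB.
apply: eq_bigr => l _.
by rewrite cmMr ED mulr0 addr0 EE // mulrBl !mulrnAl.
Qed.
Lemma stepS_stepS i k : (i < r)%N -> (k < r)%N ->
  cm (stepS i) (stepS k) = stepS i * D k - stepS k * D i.
Proof.
move=> ir kr; rewrite {1}/stepS cm_suml.
rewrite (eq_bigr (fun l : 'I_r => (stepS i * D k) *+ (l == k :> nat) - E k l * D l * D i)); last first.
  move=> l _; rewrite cmMl [cm (D l) _]cmC stepS_D oppr0 mulr0 add0r E_stepS // mulrBl mulrnAl.
  congr (_ - _); first by case: eqP => [->|].
  by rewrite -!mulrA; congr (_ * _); apply/eqP; rewrite -subr_eq0; apply/eqP/DD.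
by rewrite sumrB (sum_mulrb (fun=> stepS i * D k) kr) -mulr_suml.
Qed.

Lemma step_AA i j k l : (i < r)%N -> (j < r)%N -> (k < r)%N -> (l < r)%N -> step_rel i j k l.
Proof.
move=> ir jr kr lr; rewrite /step_rel /step ir jr kr lr.
rewrite !(cmDl, cmDr, cmNl, cmNr, cmMl, cmMr, EE, EX, ED, XE, DE, XX, DD, DX, XD) //.
rewrite !(mul0r, mulr0, addr0, add0r, oppr0, opprK, mulNr, mulrN).
rewrite (eq_sym i l) (eq_sym k j) mulr_natl mulr_natr mulrnAr mulrnAl !mulrnBl opprB.
by rewrite [LHS](AC (2*2) ((1*4)*(3*2))).
Qed.

Lemma step_AL i j l : (i < r)%N -> (j < r)%N -> (l < r)%N -> step_rel i j r l.
Proof.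
move=> ir jr lr; rewrite /step_rel /step ir jr lr ltnn eqxx (ltn_eqF jr) mulr0n sub0r.
rewrite !(cmDl, cmNl, cmMl, EX, DX, XX) mul0r addr0 add0r.
by rewrite mulr_natr eq_sym.
Qed.

Lemma XD_Lm i j : (i < r)%N -> (j < r)%N -> cm (X j * D i) Lm = 0.
Proof. by move=> ir jr; rewrite cmMl DLm // XLm // mulNr subrr. Qed.

Lemma step_AU i j k : (i < r)%N -> (j < r)%N -> (k < r)%N -> step_rel i j k r.
Proof.
move=> ir jr kr; rewrite /step_rel /step ir jr kr ltnn eqxx (gtn_eqF ir) mulr0n subr0.
rewrite !(cmDl, cmDr, cmNl, cmNr) E_stepS // (cmMr _ Lm) ELm ED mul0r mulr0 addr0 oppr0 addr0.
rewrite (cmMl (X j)) [cm (D i) _]cmC stepS_D oppr0 mulr0 add0r [cm (X j) _]cmC stepS_X //.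
rewrite mulNr opprD !opprK addrA subrK (cmMr _ Lm) XD_Lm // mul0r add0r (cmMl (X j)) DD mulr0 add0r XD.
by rewrite mulNr mulr_natl mulrN mulrnBl mulrnAr [k == j]eq_sym.
Qed.

Lemma step_AH i j : (i < r)%N -> (j < r)%N -> step_rel i j r r.
Proof.
move=> ir jr; rewrite /step_rel /step ir jr ltnn eqxx (ltn_eqF jr) (gtn_eqF ir) !mulr0n subr0.
by rewrite !(cmDl, cmNl) ELm XD_Lm // subr0.
Qed.

Lemma step_LU l i : (l < r)%N -> (i < r)%N -> step_rel r l i r.
Proof.
move=> lr ir; rewrite /step_rel /step lr ir ltnn !eqxx mulr1n cmC.
rewrite !(cmDl, cmNl) stepS_X // cmMl DX LmX // mulr_natr eq_sym.
by rewrite !opprD !opprK addrCA.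
Qed.

Lemma step_UU i k : (i < r)%N -> (k < r)%N -> step_rel i r k r.
Proof.
move=> ir kr; rewrite /step_rel /step ir kr ltnn eqxx (gtn_eqF ir) (gtn_eqF kr) !mulr0n subr0.
have h1 : cm (stepS i) (Lm * D k) = stepS i * D k.
  by rewrite cmMr stepS_Lm stepS_D mulr0 addr0.
have h2 : cm (Lm * D i) (stepS k) = - (stepS k * D i).
  by rewrite cmMl [cm (D i) _]cmC stepS_D oppr0 mulr0 add0r [cm Lm _]cmC stepS_Lm mulNr.
have h3 : cm (Lm * D i) (Lm * D k) = 0.
  rewrite cmMl !cmMr cmxx DD DLm // LmD // !mulr0 addr0 mul0r add0r.
  by rewrite mulrN mulNr -!mulrA -mulrBr [D i * D k - _]DD mulr0.
rewrite !(cmDl, cmDr, cmNl, cmNr) stepS_stepS // h1 h2 h3 oppr0 addr0 opprK.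
by rewrite addrAC subrK subrr.
Qed.

Lemma step_UH i : (i < r)%N -> step_rel i r r r.
Proof.
move=> ir; rewrite /step_rel /step ir ltnn eqxx (gtn_eqF ir) mulr1n mulr0n subr0.
by rewrite !(cmDl, cmNl) stepS_Lm (cmMl Lm) DLm // cmxx mul0r addr0.
Qed.

Lemma step_LH l : (l < r)%N -> step_rel r l r r.
Proof.
move=> lr; rewrite /step_rel /step lr ltnn eqxx (ltn_eqF lr) mulr1n mulr0n sub0r.
by rewrite XLm.
Qed.

Lemma step_relP i j k l : (i <= r)%N -> (j <= r)%N -> (k <= r)%N -> (l <= r)%N -> step_rel i j k l.
Proof.
rewrite (leq_eqVlt i) (leq_eqVlt j) (leq_eqVlt k) (leq_eqVlt l).
case/orP=> [/eqP->|ir]; case/orP=> [/eqP->|jr]; case/orP=> [/eqP->|kr]; case/orP=> [/eqP->|lr].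
- by rewrite /step_rel cmxx subrr.
- exact/step_rel_sym/step_LH.
- exact/step_rel_sym/step_UH.
- exact/step_rel_sym/step_AH.
- exact: step_LH.
- by rewrite /step_rel /step !ltnn !eqxx jr lr XX (ltn_eqF jr) (ltn_eqF lr) subrr.
- exact: step_LU.
- exact/step_rel_sym/step_AL.
- exact: step_UH.
- exact/step_rel_sym/step_LU.
- exact: step_UU.
- exact/step_rel_sym/step_AU.
- exact: step_AH.
- exact: step_AL.
- exact: step_AU.
- exact: step_AA.
Qed.
End Step.
End Commutators.

(** * Differential operators on formal power series *)

Section Series.
Variable C : numClosedFieldType.

Definition mono := (nat * nat -> nat)%type.
Implicit Types (a : mono) (p q : nat * nat).

Definition upd a p k : mono := fun q => if q == p then k else a q.

Arguments upd : simpl never.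

Lemma upd_same a p k : upd a p k p = k. Proof. by rewrite /upd eqxx. Qed.
Lemma upd_other a p q k : q != p -> upd a p k q = a q.
Proof. by rewrite /upd => /negbTE ->. Qed.
Lemma upd_upd a p k l : upd (upd a p k) p l = upd a p l.
Proof. by apply: functional_extensionality_dep => q; rewrite /upd; case: eqP. Qed.
Lemma upd_id a p k : a p = k -> upd a p k = a.
Proof. by move=> <-; apply: functional_extensionality_dep => q; rewrite /upd; case: eqP => [->|]. Qed.
Lemma upd_comm a p q k l : p != q -> upd (upd a p k) q l = upd (upd a q l) p k.
Proof.
move=> pq; apply: functional_extensionality_dep => t; rewrite /upd.
by case: eqP => // ->; rewrite eq_sym (negbTE pq).
Qed.

Definition fser : Type := mono -> C.
HB.instance Definition _ := gen_eqMixin fser.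
HB.instance Definition _ := gen_choiceMixin fser.

Definition fser_add (f h : fser) : fser := fun a => f a + h a.
Definition fser_opp (f : fser) : fser := fun a => - f a.
Definition fser_scale (c : C) (f : fser) : fser := fun a => c * f a.
Definition fser_zero : fser := fun=> 0.
Lemma fserP (f h : fser) : f =1 h -> f = h.
Proof. exact: functional_extensionality_dep. Qed.
Lemma fser_addA : associative fser_add.
Proof. by move=> f h k; apply: fserP => a; apply: addrA. Qed.
Lemma fser_addC : commutative fser_add.
Proof. by move=> f h; apply: fserP => a; apply: addrC. Qed.
Lemma fser_add0 : left_id fser_zero fser_add.
Proof. by move=> f; apply: fserP => a; apply: add0r. Qed.
Lemma fser_addN : left_inverse fser_zero fser_opp fser_add.
Proof. by move=> f; apply: fserP => a; apply: addNr. Qed.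
HB.instance Definition _ :=
  GRing.isZmodule.Build fser fser_addA fser_addC fser_add0 fser_addN.
Lemma fser_scaleA c d f : fser_scale c (fser_scale d f) = fser_scale (c * d) f.
Proof. by apply: fserP => a; apply: mulrA. Qed.
Lemma fser_scale1 : left_id 1 fser_scale.
Proof. by move=> f; apply: fserP => a; apply: mul1r. Qed.
Lemma fser_scaleDr : right_distributive fser_scale +%R.
Proof. by move=> c f h; apply: fserP => a; apply: mulrDr. Qed.
Lemma fser_scaleDl f : {morph fser_scale^~ f : c d / c + d}.
Proof. by move=> c d; apply: fserP => a; apply: mulrDl. Qed.
HB.instance Definition _ := GRing.Zmodule_isLmodule.Build C fser
  fser_scaleA fser_scale1 fser_scaleDr fser_scaleDl.

Lemma fserDE (f h : fser) a : (f + h) a = f a + h a. Proof. by []. Qed.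
Lemma fserNE (f : fser) a : (- f) a = - f a. Proof. by []. Qed.
Lemma fserZE c (f : fser) a : (c *: f) a = c * f a. Proof. by []. Qed.
Lemma fser_sumE (I : Type) (r : seq I) (P : pred I) (F : I -> fser) a :
  (\sum_(i <- r | P i) F i) a = \sum_(i <- r | P i) F i a.
Proof. exact: (big_morph (fun f : fser => f a)). Qed.

Definition xfun p (f : fser) : fser := fun a => if a p is k.+1 then f (upd a p k) else 0.
Definition dfun p (f : fser) : fser := fun a => (a p).+1%:R * f (upd a p (a p).+1).
Lemma xfun_linear p : linear (xfun p).
Proof.
by move=> c f h; apply: fserP => a; rewrite /xfun !(fserDE, fserZE); case: (a p); rewrite ?mulr0 ?addr0.
Qed.
Lemma dfun_linear p : linear (dfun p).
Proof.
by move=> c f h; apply: fserP => a; rewrite /dfun !(fserDE, fserZE) mulrDr mulrCA.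
Qed.
Definition xv p : endo fser := Endo (xfun_linear p).
Definition dv p : endo fser := Endo (dfun_linear p).

Lemma xvE p f a : xv p f a = if a p is k.+1 then f (upd a p k) else 0. Proof. by []. Qed.
Lemma dvE p f a : dv p f a = (a p).+1%:R * f (upd a p (a p).+1). Proof. by []. Qed.

Lemma cm_xx p q : cm (xv p) (xv q) = 0.
Proof.
apply/eqP; rewrite subr_eq0; apply/eqP/endoP => f; apply: fserP => a.
have [->//|pq] := eqVneq p q; have qp : q != p by rewrite eq_sym.
rewrite !endoME !xvE; case ep: (a p) => [|k]; case eq: (a q) => [|l] //.
- by rewrite xvE upd_other // ep.
- by rewrite xvE upd_other // eq.
- by rewrite !xvE !upd_other // ep eq upd_comm.
Qed.
Lemma cm_dd p q : cm (dv p) (dv q) = 0.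
Proof.
apply/eqP; rewrite subr_eq0; apply/eqP/endoP => f; apply: fserP => a.
have [->//|pq] := eqVneq p q; have qp : q != p by rewrite eq_sym.
by rewrite !endoME !dvE !upd_other // mulrCA upd_comm.
Qed.
Lemma cm_dx p q : cm (dv p) (xv q) = (p == q)%:R.
Proof.
have nE (b : bool) (f : fser) : (b%:R : endo fser) f = b%:R *: f by case: b; rewrite ?scale1r ?scale0r.
apply: endoP => f; apply: fserP => a; rewrite endoBE !endoME nE fserDE fserNE fserZE dvE.
have [->|pq] := eqVneq p q.
  rewrite !xvE upd_same upd_upd upd_id // mul1r.
  case eq: (a q) => [|k]; first by rewrite mul1r subr0.
  by rewrite dvE upd_same upd_upd upd_id // -[k.+2%:R]natr1 mulrDl mul1r addrAC subrr add0r.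
have qp : q != p by rewrite eq_sym.
rewrite mul0r !xvE upd_other //; case eq: (a q) => [|k]; first by rewrite mulr0 subrr.
by rewrite dvE upd_other // upd_comm // subrr.
Qed.
Lemma cm_xd p q : cm (xv p) (dv q) = - (q == p)%:R.
Proof. by rewrite cmC cm_dx. Qed.

Variable lam : nat -> C.

Definition num r : endo fser := \sum_(k < r) xv (r, k : nat) * dv (r, k : nat).
Definition lnum r : endo fser := lam r *: (1 : endo fser) + num r.

(* The elementary matrix E_ij of gl(m) on the Verma module of highest weight
   lam, realised by differential operators in the variables x_(s, k), k < s,
   along the tower gl(1) < gl(2) < ... < gl(m). *)
Fixpoint gl_diffop (m i j : nat) : endo fser :=
  if m is r.+1 then
    step r (gl_diffop r) (fun k => xv (r, k)) (fun k => dv (r, k)) (lnum r) i j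
  else 0.

Lemma cm_scale1 (T : endo fser) c : cm T (c *: (1 : endo fser)) = 0.
Proof. by rewrite /cm -endo_scalerAr -endo_scalerAl mulr1 mul1r subrr. Qed.

Lemma cm_scale1l (T : endo fser) c : cm (c *: (1 : endo fser)) T = 0.
Proof. by rewrite cmC cm_scale1 oppr0. Qed.

Lemma cm_num (T : endo fser) r : (forall k, (k < r)%N -> cm T (xv (r, k)) = 0 /\ cm T (dv (r, k)) = 0) ->
  cm T (lnum r) = 0.
Proof.
move=> hT; rewrite cmDr cm_scale1 add0r cm_sumr big1 // => k _.
by have [h1 h2] := hT _ (ltn_ord k); rewrite cmMr h1 h2 mul0r mulr0 addr0.
Qed.

(** [gl_diffop m] is built from scalars and from the variables and derivations of index (r, k) with
    k < r < m. In particular the variables introduced at a later step commute with it. *)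
Lemma cm_gle (T : endo fser) m :
  (forall r k, (k < r < m)%N -> cm T (xv (r, k)) = 0 /\ cm T (dv (r, k)) = 0) ->
  forall i j, cm T (gl_diffop m i j) = 0.
Proof.
elim: m => [|r IH] hT i j; first by rewrite cm0r.
have hT' k : (k < r)%N -> cm T (xv (r, k)) = 0 /\ cm T (dv (r, k)) = 0.
  by move=> kr; apply: hT; rewrite kr ltnSn.
have hE : forall i j, cm T (gl_diffop r i j) = 0.
  by apply: IH => s k /andP [ks sr]; apply: hT; rewrite ks ltnW.
have hL : cm T (lnum r) = 0 by exact: cm_num.
rewrite /= /step; case: ifP => ir; case: ifP => jr.
- by rewrite cmDr cmNr cmMr hE; have [-> _] := hT' _ jr; have [_ ->] := hT' _ ir; rewrite mul0r mulr0 addr0 subr0.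
- case: ifP => _; last by rewrite cm0r.
  rewrite cmDr cmNr cmMr hL mul0r add0r; have [_ ->] := hT' _ ir; rewrite mulr0 subr0 cm_sumr big1 // => k _.
  by rewrite cmMr hE; have [_ ->] := hT' _ (ltn_ord k); rewrite mul0r mulr0 addr0.
- case: ifP => jr'; first by have [-> _] := hT' _ jr'.
  by case: ifP => _; rewrite ?cm0r.
- by rewrite cm0r.
Qed.

Lemma gl_diffop_x m i j r s : (m <= r)%N -> cm (gl_diffop m i j) (xv (r, s)) = 0.
Proof.
move=> mr; rewrite cmC cm_gle ?oppr0 // => r' k /andP [_ rm]; split; rewrite ?cm_xx //.
by rewrite cm_xd xpair_eqE (ltn_eqF (leq_trans rm mr)) oppr0.
Qed.
Lemma gl_diffop_d m i j r s : (m <= r)%N || (r <= s)%N -> cm (gl_diffop m i j) (dv (r, s)) = 0.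
Proof.
move=> h; rewrite cmC cm_gle ?oppr0 // => r' k /andP [kr rm]; split; rewrite ?cm_dd //.
rewrite cm_dx xpair_eqE; case: (eqVneq r r') => [e|//]; case: (eqVneq s k) => [e'|//].
by move: h; rewrite e e' (leqNgt m) rm (leqNgt r') kr.
Qed.

Lemma num_x r i : (i < r)%N -> cm (lnum r) (xv (r, i)) = xv (r, i).
Proof.
move=> ir; rewrite /lnum cmDl cm_scale1l add0r cm_suml.
rewrite -[RHS](sum_mulrb (fun k => xv (r, k)) ir); apply: eq_bigr => k _.
by rewrite cmMl cm_xx mul0r addr0 cm_dx xpair_eqE eqxx /= mulr_natr.
Qed.
Lemma d_num r i : (i < r)%N -> cm (dv (r, i)) (lnum r) = dv (r, i).
Proof.
move=> ir; rewrite /lnum cmDr cm_scale1 add0r cm_sumr.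
rewrite -[RHS](sum_mulrb (fun k => dv (r, k)) ir); apply: eq_bigr => k _.
by rewrite cmMr cm_dd mulr0 addr0 cm_dx xpair_eqE eqxx /= mulr_natl eq_sym.
Qed.

Lemma gl_diffop_bracket m i j k l : (i < m)%N -> (j < m)%N -> (k < m)%N -> (l < m)%N ->
  cm (gl_diffop m i j) (gl_diffop m k l) = gl_diffop m i l *+ (j == k) - gl_diffop m k j *+ (l == i).
Proof.
elim: m i j k l => [//|r IH] i j k l ir jr kr lr; apply: step_relP => //.
- by move=> *; apply: gl_diffop_x.
- by move=> *; apply: gl_diffop_d; rewrite leqnn.
- by move=> i' j'; apply: cm_num => k' kr'; rewrite gl_diffop_x // gl_diffop_d // leqnn.
- by move=> *; apply: cm_xx.
- by move=> *; apply: cm_dd.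
- by move=> i' j'; rewrite cm_dx xpair_eqE eqxx.
- exact: num_x.
- exact: d_num.
Qed.

Definition fone : fser := fun a => (`[< a = (fun=> 0%N) >])%:R.

Lemma d_one p : dv p fone = 0.
Proof.
apply: fserP => a; rewrite dvE /fone; case: asboolP => [e|_]; last by rewrite mulr0.
by have := congr1 (fun h : mono => h p) e; rewrite upd_same.
Qed.

Lemma num_one r : num r fone = 0.
Proof. by rewrite endo_sumE big1 // => k _; rewrite endoME d_one endo_of0. Qed.

Lemma gl_diffop_one m i j : (i <= j < m)%N -> gl_diffop m i j fone = (i == j)%:R *: (lam i *: fone).
Proof.
elim: m i j => [|r IH] i j /andP [ij jm]; first by rewrite ltn0 in jm.
rewrite /= /step; case: (ltngtP j r) => jr; last first.
- subst j; case: (ltngtP i r) => ir; rewrite ?ltnn ?eqxx.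
  + rewrite scale0r endoBE !endoME d_one endo_of0 subr0 endo_sumE big1 // => k _.
    by rewrite endoME d_one endo_of0.
  + by move: ij; rewrite leqNgt ir.
  + by rewrite scale1r /lnum endoDE endoZE endo1E num_one addr0 ir.
- by move: jm; rewrite ltnS leqNgt jr.
- rewrite (leq_ltn_trans ij jr) endoBE endoME d_one endo_of0 subr0; apply: IH.
  by rewrite ij jr.
Qed.
End Series.

(** * Degrees, and the leading monomials of singular vectors *)

Section Degree.
Variables (C : numClosedFieldType) (n : nat) (lam : nat -> C).
Implicit Types (a : mono) (p q : nat * nat) (f h : fser C) (T : endo (fser C)).
Local Notation x i j := (xv C (i%N : nat, j%N : nat)).
Local Notation d i j := (dv C (i%N : nat, j%N : nat)).
Local Notation gl_diffop := (gl_diffop lam).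

Definition in_range p := (p.1 < n)%N && (p.2 < n)%N.
(** Only indices below n are counted, which keeps the sum finite; the other variables are excluded
    from the relevant series by [regular]. *)
Definition deg a : nat := (\sum_(t : 'I_n * 'I_n) a (t.1 : nat, t.2 : nat))%N.

Lemma deg_upd a p k : in_range p -> (deg (upd a p k) + a p = deg a + k)%N.
Proof.
case: p => i j /andP [/= hi hj].
rewrite /deg (bigD1 (Ordinal hi, Ordinal hj)) // [in RHS](bigD1 (Ordinal hi, Ordinal hj)) //=.
rewrite upd_same (eq_bigr (fun t : 'I_n * 'I_n => a (t.1 : nat, t.2 : nat))).
  by rewrite [LHS](AC (2*1) ((3*2)*1))%AC.
by case=> i' j' ne; rewrite upd_other.
Qed.

Definition vanishes_from e f := forall a, (e <= deg a)%N -> f a = 0.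

Lemma vanishes_from_mono e e' f : (e <= e')%N -> vanishes_from e f -> vanishes_from e' f.
Proof. by move=> ee' hf a ha; apply/hf/(leq_trans ee'). Qed.
Lemma van0 f : vanishes_from 0 f -> f = 0.
Proof. by move=> hf; apply: fserP => a; apply: hf. Qed.
Lemma vanishes_from_x e p f : in_range p -> vanishes_from e f -> vanishes_from e.+1 (xv C p f).
Proof.
move=> ip hf a ha; rewrite xvE; case ep: (a p) => [//|k]; apply: hf.
have := deg_upd a k ip; rewrite ep addnS -addSn => /eqP; rewrite eqn_add2r => /eqP e1.
by move: ha; rewrite -e1 ltnS.
Qed.
Lemma vanishes_from_d e p f : in_range p -> vanishes_from e.+1 f -> vanishes_from e (dv C p f).
Proof.
move=> ip hf a ha; rewrite dvE hf ?mulr0 //.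
have := deg_upd a (a p).+1 ip; rewrite addnS -addSn => /eqP; rewrite eqn_add2r => /eqP ->.
by rewrite ltnS.
Qed.

(** T raises the degree by at most k2 - k1; two natural parameters avoid negative shifts, (1, 0)
    meaning that the degree drops. Passing from (1, 1) to (0, 0) uses that a series of degree below
    0 vanishes. *)
Definition degree_shift k1 k2 T := forall e f, vanishes_from (e + k1) f -> vanishes_from (e + k2) (T f).

Lemma dgD k1 k2 T T' : degree_shift k1 k2 T -> degree_shift k1 k2 T' -> degree_shift k1 k2 (T + T').
Proof. by move=> h1 h2 e f hf a ha; rewrite endoDE fserDE (h1 e) // (h2 e) // addr0. Qed.
Lemma dgN k1 k2 T : degree_shift k1 k2 T -> degree_shift k1 k2 (- T).
Proof. by move=> h1 e f hf a ha; rewrite endoNE fserNE (h1 e) // oppr0. Qed.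
Lemma dgB k1 k2 T T' : degree_shift k1 k2 T -> degree_shift k1 k2 T' -> degree_shift k1 k2 (T - T').
Proof. by move=> h1 h2; apply/dgD/dgN. Qed.
Lemma dg0 k1 k2 : degree_shift k1 k2 0. Proof. by []. Qed.
Lemma dg_sum k1 k2 (I : Type) (r : seq I) (P : pred I) (F : I -> endo (fser C)) :
  (forall i, P i -> degree_shift k1 k2 (F i)) -> degree_shift k1 k2 (\sum_(i <- r | P i) F i).
Proof. by move=> hF; apply: big_ind => // *; apply: dgD. Qed.
Lemma dgM k1 k2 k3 T T' : degree_shift k2 k3 T -> degree_shift k1 k2 T' -> degree_shift k1 k3 (T * T').
Proof. by move=> h1 h2 e f hf; rewrite endoME; apply/h1/h2. Qed.
Lemma dg_same T : degree_shift 1 1 T -> degree_shift 0 0 T.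
Proof.
move=> hT [|e] f; rewrite !addn0; last by have := hT e f; rewrite !addn1.
by move=> /van0 ->; rewrite endo_of0.
Qed.
Lemma dg_weak k1 k2 T : degree_shift k1 k2 T -> degree_shift k1 k2.+1 T.
Proof. by move=> hT e f /hT; apply: vanishes_from_mono; rewrite addnS leqnSn. Qed.
Lemma dg_x p : in_range p -> degree_shift 0 1 (xv C p).
Proof. by move=> ip e f; rewrite addn0 addn1; apply: vanishes_from_x. Qed.
Lemma dg_d p : in_range p -> degree_shift 1 0 (dv C p).
Proof. by move=> ip e f; rewrite addn0 addn1; apply: vanishes_from_d. Qed.
Lemma dg_low T : degree_shift 1 0 T -> degree_shift 0 0 T. Proof. by move=> /dg_weak /dg_same. Qed.
Lemma dg_xd p q : in_range p -> in_range q -> degree_shift 0 0 (xv C p * dv C q).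
Proof. by move=> ip iq; apply/dg_same/dgM/dg_d/iq/dg_x. Qed.
Lemma dg_scale1 c : degree_shift 0 0 (c *: (1 : endo (fser C))).
Proof. by move=> e f hf a ha; rewrite endoZE fserZE endo1E hf ?mulr0. Qed.

Lemma dg_lnum r : (r < n)%N -> degree_shift 0 0 (lnum lam r).
Proof.
move=> rn; apply: dgD (dg_scale1 _) _; apply: dg_sum => k _.
by apply: dg_xd; rewrite /in_range /= rn (ltn_trans (ltn_ord k) rn).
Qed.

(** In [step] each derivation comes with at most one factor that raises the degree, and only by one.
    The multiplication by x_(i, j) in a lowering operator is the single unbalanced term. *)
Lemma degree_shift_gl_diffop_all m : (m <= n)%N ->
  (forall i j, (i <= j)%N -> degree_shift 0 0 (gl_diffop m i j)) /\
  (forall i j, (j < i < m)%N -> degree_shift 0 0 (gl_diffop m i j - x i j)).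
Proof.
elim: m => [|r IH] mn; first by split=> // i j; rewrite ltn0 andbF.
have [C1 C2] := IH (ltnW mn).
have rse i k : (i < r)%N -> (k < r)%N -> degree_shift 0 1 (gl_diffop r i k).
  move=> ir kr; case: (leqP i k) => ik; first exact/dg_weak/C1.
  rewrite -[gl_diffop r i k](subrK (x i k)); apply: dgD; first by apply/dg_weak/C2; rewrite ik.
  by apply: dg_x; rewrite /in_range /= (ltn_trans ir mn) (ltn_trans kr mn).
have xd i j : (i < r)%N -> (j < r)%N -> degree_shift 0 0 (x r j * d r i).
  by move=> ir jr; apply: dg_xd; rewrite /in_range /= mn ?(ltn_trans ir mn) ?(ltn_trans jr mn).
have dd i : (i < r)%N -> degree_shift 1 0 (d r i).
  by move=> ir; apply: dg_d; rewrite /in_range /= mn (ltn_trans ir mn).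
split=> i j; rewrite /= /step.
  move=> ij; case: ifP => ir; case: ifP => jr.
  - by apply: dgB; [apply: C1|apply: xd].
  - case: ifP => _; last exact: dg0.
    apply: dgB; last by apply/dg_low/dgM/dd/ir/dg_lnum.
    by apply: dg_sum => k _; apply/dg_same/dgM/dd => //; apply: rse.
  - by case: ifP => jr'; [move: ij; rewrite (eqP jr) leqNgt jr'|case: ifP => _; [apply: dg_lnum|apply: dg0]].
  - exact: dg0.
move=> /andP [ji im]; case: ifP => ir.
  have jr := ltn_trans ji ir; rewrite jr addrAC; apply: dgB; last exact: xd.
  by apply: C2; rewrite ji.
have ei : i = r by apply/eqP; rewrite eqn_leq -ltnS im leqNgt ir.
by rewrite ei eqxx -{1}ei ji subrr; apply: dg0.
Qed.

(* The part of E_ij, i < j, of degree 0 in the variables; the other terms lower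
   the degree. *)
Definition leading_part (m i j : nat) : endo (fser C) :=
  \sum_(k < i) x i k * d j k - \sum_(s < m | (j < s)%N) x s j * d s i.

(** At the step where the index j enters the tower, the summands E_(i,k) d_(j,k) with k < i
    contribute x_(i,k) d_(j,k), and all else lowers the degree; each later step r subtracts exactly
    x_(r,j) d_(r,i). *)
Lemma degree_shift_gl_diffop_leading_part m i j : (m <= n)%N -> (i < j < m)%N -> degree_shift 1 0 (gl_diffop m i j - leading_part m i j).
Proof.
elim: m i j => [|r IH] i j mn /andP [ij]; rewrite ?ltn0 // ltnS leq_eqVlt => /orP [/eqP jr|jr].
  subst j; have [C1 C2] := degree_shift_gl_diffop_all (ltnW mn).
  rewrite /= /step ij ltnn eqxx /leading_part [X in _ - (_ - X)]big_pred0 ?subr0; last first.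
    by move=> s; rewrite ltnNge -ltnS ltn_ord.
  have dd k : (k < r)%N -> degree_shift 1 0 (d r k).
    by move=> kr; apply: dg_d; rewrite /in_range /= mn (ltn_trans kr mn).
  rewrite addrAC; apply: dgB; last by apply/dgM/dd/ij/dg_lnum.
  rewrite (big_ord_widen _ (fun k => x i k * d r k) (ltnW ij)) big_mkcond /= -sumrB.
  apply: dg_sum => k _; case: ifP => ki; last first.
    by rewrite subr0; apply/dgM/dd => //; apply: C1; rewrite leqNgt ki.
  by rewrite -mulrBl; apply/dgM/dd => //; apply: C2; rewrite ki.
have ir := ltn_trans ij jr.
have -> : gl_diffop r.+1 i j - leading_part r.+1 i j = gl_diffop r i j - leading_part r i j.
  rewrite /= /step ir jr /leading_part [X in _ - (_ - X)]big_mkcond big_ord_recr /= jr -big_mkcond /=.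
  rewrite !opprB [LHS](AC (2*(2*1)) ((1*(3*5))*(2*4))) /=.
  by rewrite addNr addr0.
by apply: IH (ltnW mn) _; rewrite ij.
Qed.

Definition tfun e f : fser C := fun a => if deg a == e then f a else 0.
Lemma tfun_linear e : linear (tfun e).
Proof.
by move=> c f h; apply: fserP => a; rewrite /tfun !(fserDE, fserZE); case: eqP; rewrite ?mulr0 ?addr0.
Qed.
Definition degree_part e : endo (fser C) := Endo (tfun_linear e).
Lemma degree_partE e f a : degree_part e f a = if deg a == e then f a else 0. Proof. by []. Qed.

Lemma degree_part_xd e p q : in_range p -> in_range q -> xv C p * dv C q * degree_part e = degree_part e * (xv C p * dv C q).
Proof.
move=> ip iq; apply: endoP => f; apply: fserP => a; rewrite !endoME degree_partE !xvE.
case ep: (a p) => [|k]; first by case: eqP.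
rewrite !dvE degree_partE; set a' := upd a p k.
have e1 := deg_upd a k ip; have e2 := deg_upd a' (a' q).+1 iq.
have -> : deg (upd a' q (a' q).+1) = deg a.
  move/eqP: e2; rewrite addnS -addSn eqn_add2r => /eqP ->.
  by move/eqP: e1; rewrite ep addnS -addSn eqn_add2r => /eqP.
by case: eqP => //; rewrite mulr0.
Qed.

Lemma degree_part_leading_part e i j : (i < j < n)%N -> leading_part n i j * degree_part e = degree_part e * leading_part n i j.
Proof.
move=> /andP [ij jn]; have hin := ltn_trans ij jn.
rewrite /leading_part mulrBl mulrBr !mulr_suml !mulr_sumr; congr (_ - _).
  by apply: eq_bigr => k _; apply: degree_part_xd; rewrite /in_range /= ?hin ?jn (ltn_trans (ltn_ord k)).
by apply: eq_bigr => s _; apply: degree_part_xd; rewrite /in_range /= ltn_ord ?hin ?jn.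
Qed.

Lemma xv_inj p f : xv C p f = 0 -> f = 0.
Proof.
move=> hf; apply: fserP => a; have := congr1 (fun h : fser C => h (upd a p (a p).+1)) hf.
by rewrite xvE upd_same upd_upd upd_id.
Qed.

(** The equation for the pair (j, j + h + 1) contains the wanted derivation d_(j+h+2, j) once. Its
    other derivations d_(s,k) have a larger gap s - k, or the same gap and a smaller k; so the
    induction is downward on h and then upward on j. *)
Lemma leading_part_support f : (forall i j, (i < j < n)%N -> leading_part n i j f = 0) ->
  forall (h j : nat), (j + h.+2 < n)%N -> d (j + h.+2) j f = 0.
Proof.
move=> hD h; have [t] := ubnP (n - h); elim: t h => // t IHt h ht.
have big_h (h' j : nat) : (h < h')%N -> (j + h'.+2 < n)%N -> d (j + h'.+2) j f = 0.
  by move=> hh' jn; apply: IHt => //; lia.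
elim/ltn_ind => j IHj jn.
have bn : (j + h.+1 < n)%N by lia.
apply: (@xv_inj (j + h.+2, j + h.+1)%N).
have jb : (j < j + h.+1 < n)%N by lia.
have := hD j (j + h.+1)%N jb; rewrite endoBE !endo_sumE big1 ?sub0r; last first.
  move=> k _; rewrite endoME; have kj := ltn_ord k; have [e|ne] := eqVneq k.+1 j.
    rewrite (_ : j + h.+1 = k + h.+2)%N; last by lia.
    by rewrite IHj ?endo_of0 //; lia.
  have [l el] : exists l, (j + h.+1 = k + l.+2)%N by exists (j + h.+1 - k - 2)%N; lia.
  by rewrite el big_h ?endo_of0 //; lia.
rewrite (bigD1 (Ordinal jn)); last by rewrite /=; lia.
rewrite big1 => [|s /andP [js ns]]; first by rewrite [X in - X]addr0 => /eqP; rewrite oppr_eq0 => /eqP.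
have ns' : (s : nat) <> (j + h.+2)%N by move=> e; move/eqP: ns; apply; apply: val_inj.
have sn := ltn_ord s.
have [l el] : exists l, (s = j + l.+2 :> nat)%N by exists (s - j - 2)%N; lia.
by rewrite endoME el big_h ?endo_of0 //; lia.
Qed.

Definition lower_index q := (q.2 < q.1)%N && (q.1 < n)%N.
Definition subdiagonal_mono a := forall q, a q <> 0%N -> (q.2.+1 == q.1) && (q.1 < n)%N.

(* By leading_part_support, the top degree part of a singular vector only
   involves the variables x_(i+1, i). *)
Lemma singular_top_degree f e : (forall q, ~~ lower_index q -> dv C q f = 0) ->
  (forall i j, (i < j < n)%N -> gl_diffop n i j f = 0) -> vanishes_from e f -> f <> 0 ->
  exists2 a, f a <> 0 & subdiagonal_mono a.
Proof.
move=> fv fs; elim: e => [|e IH] fe f0; first by case: f0; apply: van0.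
have [he|ne] := pselect (vanishes_from e f); first exact: IH.
have [a ha fa] : exists2 a, deg a = e & f a <> 0.
  apply: contrapT => H; apply: ne => a; rewrite leq_eqVlt => /orP [/eqP ea|/fe //].
  by apply: contrapT => fa; apply: H; exists a.
exists a => // q aq.
pose p := degree_part e f.
have pa : p a = f a by rewrite /p degree_partE ha eqxx.
(* E_ij is its leading part up to an operator that lowers the degree, so the component of degree e
   in E_ij f = 0 is the leading part applied to p. *)
have pD i j : (i < j < n)%N -> leading_part n i j p = 0.
  move=> ij; rewrite /p -endoME degree_part_leading_part // endoME; apply: fserP => b; rewrite degree_partE.
  case: eqP => // eb; have := degree_shift_gl_diffop_leading_part (leqnn n) ij => /(_ e f).
  rewrite addn1 addn0 => /(_ fe b); rewrite eb leqnn => /(_ isT).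
  by rewrite endoBE fs // sub0r fserNE => /eqP; rewrite oppr_eq0 => /eqP.
(* In characteristic 0, a series killed by the derivation d_r has coefficient 0 at every monomial
   that contains x_r. *)
have dE (r : nat * nat) (k : fser C) : dv C r k = 0 -> a r <> 0%N -> k a = 0.
  move=> rk ar; have := congr1 (fun h : fser C => h (upd a r (a r).-1)) rk.
  have pr : ((a r).-1.+1 = a r)%N by lia.
  rewrite dvE upd_same upd_upd upd_id ?pr // => /eqP.
  by rewrite mulf_eq0 -pr pnatr_eq0 /= => /eqP.
have vq : lower_index q by apply: contrapT => /negP nq; apply: fa; apply: dE (fv _ nq) aq.
case: q aq vq => i j aq /andP [/= ji iN]; rewrite iN andbT; apply: contrapT => /eqP nij.
apply: fa; rewrite -pa; apply: dE aq.
have [l el] : exists l, (i = j + l.+2)%N by exists (i - j - 2)%N; lia.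
by rewrite el; apply: leading_part_support => //; lia.
Qed.

(** Monomials are weight vectors: a factor x_(i, k) adds epsilon_i - epsilon_k. *)
Lemma gl_diffop_diag m i f a : (i < m)%N -> gl_diffop m i i f a =
  (lam i + (\sum_(k < i) a (i, k : nat))%:R - (\sum_(s < m | (i < s)%N) a (s : nat, i))%:R) * f a.
Proof.
have xd q : (xv C q * dv C q) f a = (a q)%:R * f a.
  rewrite endoME xvE; case eq: (a q) => [|k]; first by rewrite mul0r.
  by rewrite dvE upd_same upd_upd upd_id.
elim: m => // r IH; rewrite ltnS leq_eqVlt => /orP [/eqP ->|ir].
  rewrite /= /step ltnn eqxx /lnum endoDE fserDE endoZE endo1E fserZE.
  rewrite [X in _ - X%:R]big_pred0 ?subr0; last by move=> s; have := ltn_ord s; lia.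
  rewrite mulrDl; congr (_ + _); rewrite /num endo_sumE fser_sumE natr_sum mulr_suml.
  by apply: eq_bigr => k _; apply: xd.
rewrite /= /step ir endoBE fserDE fserNE IH // xd -mulrBl; congr (_ * _).
by rewrite [X in _ = _ - X%:R]big_mkcond big_ord_recr /= ir -big_mkcond /= natrD opprD addrA.
Qed.

(** For a monomial in the x_(i+1, i), the i-th coordinate of the weight is a(i, i-1) - a(i+1, i) up
    to a constant, and the exponents are recovered successively from i = 0 on. *)
Lemma simple_mono_eq a a' : subdiagonal_mono a -> subdiagonal_mono a' ->
  (forall i, (i < n)%N ->
    (\sum_(k < i) a (i, k : nat))%:R - (\sum_(s < n | (i < s)%N) a (s : nat, i))%:R =
    (\sum_(k < i) a' (i, k : nat))%:R - (\sum_(s < n | (i < s)%N) a' (s : nat, i))%:R :> C) ->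
  a = a'.
Proof.
move=> sa sa' ew.
have z b q : subdiagonal_mono b -> ~~ ((q.2.+1 == q.1) && (q.1 < n)%N) -> b q = 0%N.
  by move=> sb nq; apply: contrapT => /sb; rewrite (negbTE nq).
have key i : a (i.+1, i) = a' (i.+1, i).
  elim/ltn_ind: i => i IH; case: (ltnP i.+1 n) => iN; last first.
    by rewrite (z a) ?(z a') //= eqxx /= -leqNgt.
  have := ew i (ltnW iN).
  have -> : (\sum_(k < i) a (i, k : nat) = \sum_(k < i) a' (i, k : nat))%N.
    apply: eq_bigr => k _; have [e|ne] := eqVneq k.+1 i; last by rewrite (z a) ?(z a') //= negb_and ne.
    by have := IH k (ltn_ord k); rewrite e.
  move=> /addrI /oppr_inj /eqP; rewrite eqr_nat.
  have s1 b : subdiagonal_mono b -> (\sum_(s < n | (i < s)%N) b (s : nat, i))%N = b (i.+1, i).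
    move=> sb; rewrite (bigD1 (Ordinal iN)) //= big1 ?addn0 // => s /andP [_ ns].
    by rewrite (z b) //= negb_and (eq_sym i.+1) -[(s : nat) == i.+1]/(s == Ordinal iN) ns.
  by rewrite !s1 // => /eqP.
apply: functional_extensionality_dep => -[i j].
by have [<-//|ne] := eqVneq j.+1 i; rewrite (z a) ?(z a') //= negb_and ne.
Qed.

(** An encoding of the polynomials in the x_(i, j), j < i < n: the degree is bounded and no other
    variable occurs. *)
Definition regular f := (exists e, vanishes_from e f) /\ (forall q, ~~ lower_index q -> dv C q f = 0).

Lemma regular_lin c f h : regular f -> regular h -> regular (c *: f + h).
Proof.
move=> [[e fe] fv] [[e' he] hv]; split; last first.
  by move=> q nq; rewrite endo_ofD endo_ofZ fv // hv // scaler0 addr0.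
exists (maxn e e') => a ha; rewrite fserDE fserZE fe ?he ?mulr0 ?addr0 //.
  by apply: leq_trans ha; apply: leq_maxr.
by apply: leq_trans ha; apply: leq_maxl.
Qed.

Lemma degree_shift_gl_diffop i j : (i < n)%N -> (j < n)%N -> degree_shift 0 1 (gl_diffop n i j).
Proof.
move=> iN jN; have [C1 C2] := degree_shift_gl_diffop_all (leqnn n).
case: (leqP i j) => ij; first exact/dg_weak/C1.
rewrite -[gl_diffop n i j](subrK (x i j)); apply: dgD; first by apply/dg_weak/C2; rewrite ij.
by apply: dg_x; rewrite /in_range /= iN.
Qed.

Lemma regular_gle i j f : (i < n)%N -> (j < n)%N -> regular f -> regular (gl_diffop n i j f).
Proof.
move=> iN jN [[e fe] fv]; split; last first.
  move=> [r s] nq; have h : ((n <= r) || (r <= s))%N by move: nq; rewrite /lower_index /=; lia.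
  have := congr1 (fun T : endo (fser C) => T f) (gl_diffop_d lam i j h).
  by rewrite endoBE !endoME fv // endo_of0 sub0r => /eqP; rewrite oppr_eq0 => /eqP.
exists e.+1; have := degree_shift_gl_diffop iN jN (e := e) (f := f); rewrite addn0 addn1; exact.
Qed.

Lemma regular_one : regular (fone C).
Proof.
split; last by move=> q _; apply: d_one.
exists 1%N => a; rewrite /fone; case: asboolP => // ->.
by rewrite /deg big1.
Qed.

(** The multiple of f is chosen to cancel the coefficient at [a]. A non-zero difference would be
    singular of the same weight and contain a subdiagonal monomial, which the weight forces to be
    [a] again. *)
Lemma singular_unique (g : nat -> C) f h :
  regular f -> regular h ->
  (forall i j, (i < j < n)%N -> gl_diffop n i j f = 0) -> (forall i j, (i < j < n)%N -> gl_diffop n i j h = 0) ->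
  (forall i, (i < n)%N -> gl_diffop n i i f = g i *: f) -> (forall i, (i < n)%N -> gl_diffop n i i h = g i *: h) ->
  f <> 0 -> exists c, h = c *: f.
Proof.
move=> rf rh sf sh wf wh f0; have [[e fe] fv] := rf.
have [a fa sa] := singular_top_degree fv sf fe f0.
exists (h a / f a); apply/eqP; rewrite -subr_eq0; apply/eqP; apply: contrapT.
rewrite -scaleNr addrC; set c := - _; set k := c *: f + h => k0.
have rk : regular k by exact: regular_lin.
have [[e' ke] kv] := rk.
have sk i j : (i < j < n)%N -> gl_diffop n i j k = 0.
  by move=> ij; rewrite endo_ofD endo_ofZ sf // sh // scaler0 addr0.
have wk i : (i < n)%N -> gl_diffop n i i k = g i *: k.
  by move=> iN; rewrite endo_ofD endo_ofZ wf // wh // scalerDr !scalerA mulrC.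
have [b kb sb] := singular_top_degree kv sk ke k0.
have wt (u : fser C) t i : (i < n)%N -> gl_diffop n i i u = g i *: u -> u t <> 0 ->
    (\sum_(l < i) t (i, l : nat))%:R - (\sum_(s < n | (i < s)%N) t (s : nat, i))%:R = g i - lam i.
  move=> iN /(congr1 (fun v : fser C => v t)); rewrite gl_diffop_diag // fserZE => e1 /eqP ut.
  by rewrite -(mulIf ut e1) addrAC [lam i + _]addrC addrK.
have ab : a = b.
  apply: simple_mono_eq => // i iN.
  by rewrite (wt f a i) ?(wt k b i) //; [apply: wk|apply: wf].
apply: kb; rewrite -ab /k fserDE fserZE /c mulNr divfK ?addNr //.
by apply/eqP.
Qed.
End Degree.

(** * Embedding of the Verma module of gl(n) into the differential operator model *)

Section VermaModel.
Variables (C : numClosedFieldType) (n : nat) (lam : weight C n).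
Implicit Types (A B : 'M[C]_n) (p : 'I_n * 'I_n).

(** The weight extended by 0 to all natural indices, the form that [gl_diffop] takes. *)
Definition lamn (k : nat) : C := \sum_(i < n | (i : nat) == k) lam 0 i.
Lemma lamnE (i : 'I_n) : lamn i = lam 0 i.
Proof. by rewrite /lamn (big_pred1 i). Qed.

Local Notation egl i j := (gl_diffop lamn n (i : nat) (j : nat)).

Definition gl_op A : endo (fser C) := \sum_(i < n) \sum_(j < n) A i j *: egl i j.

Lemma gl_op_linear : linear gl_op.
Proof.
move=> c A B; rewrite /gl_op scaler_sumr -big_split; apply: eq_bigr => i _.
rewrite scaler_sumr -big_split; apply: eq_bigr => j _ /=.
by rewrite !mxE scalerDl scalerA.
Qed.

Lemma gl_op_delta (i j : 'I_n) : gl_op (delta_mx i j) = egl i j.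
Proof.
rewrite /gl_op (bigD1 i) //= (bigD1 j) //= mxE !eqxx scale1r !big1 ?addr0 // => k kj.
  by rewrite big1 // => l _; rewrite mxE (negbTE kj) scale0r.
by rewrite mxE (negbTE kj) andbF scale0r.
Qed.

Lemma cmZl (V : lmodType C) c (S T : endo V) : cm (c *: S) T = c *: cm S T.
Proof. by rewrite /cm scalerBr endo_scalerAl endo_scalerAr. Qed.
Lemma cmZr (V : lmodType C) c (S T : endo V) : cm S (c *: T) = c *: cm S T.
Proof. by rewrite /cm scalerBr endo_scalerAr endo_scalerAl. Qed.

Lemma gl_op_bracket_delta (i j k l : 'I_n) :
  gl_op (delta_mx i j *m delta_mx k l - delta_mx k l *m delta_mx i j) =
  cm (gl_op (delta_mx i j)) (gl_op (delta_mx k l)).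
Proof.
rewrite !gl_op_delta gl_diffop_bracket // !mul_delta_mx_cond.
rewrite -(linear_funB _ _ gl_op_linear).
have gM (b : bool) M : gl_op (M *+ b) = gl_op M *+ b.
  by case: b => //; rewrite !mulr0n (linear_fun0 gl_op_linear).
by rewrite !gM !gl_op_delta.
Qed.

Lemma gl_op_bracket A B : gl_op (A *m B - B *m A) = cm (gl_op A) (gl_op B).
Proof.
have lB (M : 'M[C]_n) : linear (fun X : 'M[C]_n => X *m M - M *m X).
  by move=> c X Y; rewrite mulmxDl mulmxDr -scalemxAl -scalemxAr scalerBr opprD addrACA.
have lg (M : 'M[C]_n) : linear (fun X => gl_op (X *m M - M *m X)).
  by move=> c X Y; rewrite lB gl_op_linear.
have lg' (M : 'M[C]_n) : linear (fun X => gl_op (M *m X - X *m M)).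
  by move=> c X Y; rewrite -gl_op_linear; congr gl_op; rewrite mulmxDl mulmxDr -scalemxAl -scalemxAr scalerBr opprD addrACA.
have lc (T : endo (fser C)) : linear (fun X => cm (gl_op X) T).
  by move=> c X Y; rewrite gl_op_linear cmDl cmZl.
have lc' (T : endo (fser C)) : linear (fun X => cm T (gl_op X)).
  by move=> c X Y; rewrite gl_op_linear cmDr cmZr.
rewrite (linear_fun_delta A (lg B)) (linear_fun_delta A (lc (gl_op B))).
apply: eq_bigr => i _; apply: eq_bigr => j _; congr (_ *: _).
rewrite (linear_fun_delta B (lg' (delta_mx i j))) (linear_fun_delta B (lc' (gl_op (delta_mx i j)))).
apply: eq_bigr => k _; apply: eq_bigr => l _; congr (_ *: _).
exact: gl_op_bracket_delta.
Qed.

Definition vm_act (x : set_type (pe_even C n)) (f : fser C) : fser C := gl_op (ulsubmx (val x)) f.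

Lemma even_val_odd (x : set_type (pe_even C n)) : homog true (val x) -> val x = 0.
Proof. by move=> hx; have [_ h] : in_pe_even (val x) := lie_val x; exact: homog_eq0 h hx. Qed.

Lemma ulsubmx0 : ulsubmx (0 : 'M[C]_(n + n)) = 0.
Proof. by apply/matrixP => i j; rewrite !mxE. Qed.

Lemma vm_actP (c : C) (x y z : set_type (pe_even C n)) f :
  val z = c *: val x + val y -> vm_act z f = c *: vm_act x f + vm_act y f.
Proof.
move=> hz; rewrite /vm_act hz (_ : ulsubmx (_ + _) = c *: ulsubmx (val x) + ulsubmx (val y)).
  by rewrite gl_op_linear.
by apply/matrixP => i j; rewrite !mxE.
Qed.
Lemma vm_act_par a (x : set_type (pe_even C n)) f : homog a (val x) ->
  vm_act x f = (-1) ^+ a *: vm_act x f.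
Proof.
case: a => [/even_val_odd x0|_]; last by rewrite scale1r.
by rewrite /vm_act x0 ulsubmx0 (linear_fun0 gl_op_linear) scaler0.
Qed.
Lemma vm_act_bracket a b (x y z : set_type (pe_even C n)) f :
    homog a (val x) -> homog b (val y) ->
    val z = sbracket a b (val x) (val y) ->
  vm_act z f = vm_act x (vm_act y f) - (-1) ^+ (a && b) *: vm_act y (vm_act x f).
Proof.
have z0 := linear_fun0 gl_op_linear.
case: a => [/even_val_odd x0|hx].
  move=> _ hz; rewrite /vm_act hz x0 /sbracket mul0mx mulmx0 scaler0 subrr ulsubmx0 z0 !endo0E.
  by rewrite endo_of0 scaler0 subrr.
case: b => [/even_val_odd y0|hy].
  move=> hz; rewrite /vm_act hz y0 /sbracket mul0mx mulmx0 scaler0 subrr ulsubmx0 z0 !endo0E.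
  by rewrite endo_of0 scaler0 subrr.
move=> hz; rewrite /= scale1r /vm_act hz /sbracket /= expr0 scale1r.
have ul_z0 (u : set_type (pe_even C n)) : val u = mx0 (ulsubmx (val u)).
  have [[X1 _ _] hX] : in_pe_even (val u) by exact: (lie_val u).
  by rewrite -[LHS]hX /hpart X1.
rewrite (ul_z0 x) (ul_z0 y).
have := bracket00 (ulsubmx (val x)) (ulsubmx (val y)); rewrite /sbracket /= expr0 scale1r => ->.
by rewrite !ul_mx0 gl_op_bracket.
Qed.

Lemma vm_par_linear : linear (fun f : fser C => f). Proof. by []. Qed.
Lemma vm_parK : involutive (fun f : fser C => f). Proof. by []. Qed.

(** Purely even, with all formal series; the image of the Verma module consists of polynomials by
    [regular_vm]. *)
Definition verma_model : smod (pe_even C n) := SMod vm_par_linear vm_parK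
  (fun x => endo_linear (gl_op (ulsubmx (val x)))) vm_actP vm_act_par vm_act_bracket.

Lemma vmod_z0 A (f : verma_model) : smod_act (z0 A) f = gl_op A f.
Proof. by rewrite /= /vm_act /= ul_mx0. Qed.

Local Notation verma := (Delta_even lam).
Local Notation v := (ind_gen (pe_even C n) (@borel_even C n) (wchar lam)).

Lemma vmod_one_char : char_vector (@borel_even C n) (wchar lam) (fone C : verma_model).
Proof.
apply/char_evenP => A uA; rewrite vmod_z0 /gl_op endo_sumE /wtr scaler_suml.
apply: eq_bigr => i _; rewrite endo_sumE (bigD1 i) // big1 => [|j ji].
  by rewrite endoZE gl_diffop_one ?leqnn ?ltn_ord // eqxx scale1r lamnE scalerA mulrC [LHS]addr0.
rewrite endoZE; have [ij|ij|/val_inj e] := ltngtP i j.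
- by rewrite gl_diffop_one ?(ltnW ij) ?ltn_ord // (ltn_eqF ij) scale0r scaler0.
- by rewrite uA // scale0r.
- by rewrite e eqxx in ji.
Qed.

Lemma vm_hom : exists F : shom verma verma_model, F v = fone C.
Proof. exact: (@ind_hom _ _ _ _ _ verma_model (fone C)) _ vmod_one_char. Qed.

Lemma fone_neq0 : fone C <> 0.
Proof.
move=> /(congr1 (fun f : fser C => f (fun=> 0%N))); rewrite /fone asboolT // => /eqP.
by rewrite oner_eq0.
Qed.

Lemma verma_neq0 : v <> 0.
Proof.
have [F Fv] := vm_hom => v0; apply: fone_neq0; rewrite -Fv v0.
exact/linear_fun0/(shom_linear F).
Qed.

Lemma regular_sum (I : Type) (r : seq I) (P : pred I) (F : I -> fser C) :
  (forall i, P i -> regular n (F i)) -> regular n (\sum_(i <- r | P i) F i).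
Proof.
move=> hF; apply: (big_ind (regular n)) => // [|f h rf rh].
  by split=> [|q _]; [exists 0%N|rewrite endo_of0].
by rewrite -[f]scale1r; apply: regular_lin.
Qed.
Lemma regular_scale c (f : fser C) : regular n f -> regular n (c *: f).
Proof.
move=> rf; rewrite -[c *: f]addr0; apply: regular_lin => //.
by split=> [|q _]; [exists 0%N|rewrite endo_of0].
Qed.

Lemma regular_uev t (f : verma_model) : regular n f -> regular n (uev t f).
Proof.
elim: t f => [x|c|s IHs t IHt|s IHs t IHt] f rf /=.
- rewrite /vm_act /gl_op endo_sumE; apply: regular_sum => i _.
  rewrite endo_sumE; apply: regular_sum => j _; rewrite endoZE.
  exact/regular_scale/regular_gle.
- exact: regular_scale.
- by rewrite -[uev s f]scale1r; apply: regular_lin; [apply: IHs|apply: IHt].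
- exact/IHs/IHt.
Qed.

Lemma regular_vm (F : shom verma verma_model) : F v = fone C -> forall w, regular n (F w).
Proof.
move=> Fv w; have [u ->] := @ind_gen_generates _ _ _ (@borel_even C n) (wchar lam) w.
by rewrite shom_umod Fv /umod; apply: regular_uev; apply: regular_one.
Qed.

Section Words.
Definition low p := (p.2 < p.1)%N.
Definition lower_word (s : seq ('I_n * 'I_n)) : verma :=
  foldr (fun p (w : verma) => smod_act (z0 (dE C p)) w) v s.

(** The filtration of the Verma module by words of length at most k in the lower elementary
    matrices. *)
Inductive word_span : nat -> verma -> Prop :=
| word_span_v k : word_span k v
| word_span_f k p w : low p -> word_span k w -> word_span k.+1 (smod_act (z0 (dE C p)) w)
| word_span_lin k c u w : word_span k u -> word_span k w -> word_span k (c *: u + w).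

Lemma word_span_0 k : word_span k 0.
Proof. by rewrite -(addNr v) -scaleN1r; apply: word_span_lin; apply: word_span_v. Qed.
Lemma word_span_scale k c u : word_span k u -> word_span k (c *: u).
Proof. by move=> hu; rewrite -[c *: u]addr0; apply: word_span_lin hu (word_span_0 k). Qed.
Lemma word_span_add k u w : word_span k u -> word_span k w -> word_span k (u + w).
Proof. by rewrite -{2}[u]scale1r; apply: word_span_lin. Qed.
Lemma word_span_sum k (I : Type) (r : seq I) (P : pred I) (G : I -> verma) :
  (forall i, P i -> word_span k (G i)) -> word_span k (\sum_(i <- r | P i) G i).
Proof. by move=> hG; apply: (big_ind (word_span k)) => //; [apply: word_span_0|apply: word_span_add]. Qed.
Lemma word_span_mono k k' w : (k <= k')%N -> word_span k w -> word_span k' w.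
Proof.
move=> kk' hw; elim: hw k' kk' => {k w} [k|k p w lp _ IH|k c u w _ IHu _ IHw] k' kk'.
- exact: word_span_v.
- by case: k' kk' => // k' kk'; apply: word_span_f => //; apply: IH.
- by apply: word_span_lin; [apply: IHu|apply: IHw].
Qed.

Lemma word_span_low k A w : (forall i j : 'I_n, (i <= j)%N -> A i j = 0) -> word_span k w ->
  word_span k.+1 (smod_act (z0 A) w).
Proof.
move=> lA hw; rewrite (linear_fun_delta A (actz_linear w)).
apply: word_span_sum => i _; apply: word_span_sum => j _.
case: (leqP i j) => ij; first by rewrite lA // scale0r; apply: word_span_0.
by apply: word_span_scale; apply: (@word_span_f k (i, j)).
Qed.

Lemma word_span_all w : exists k, word_span k w.
Proof.
have : root_span (fun p => z0 (lowE C p)) v w.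
  apply: (@root_spanT C n (pe_even C n) (@borel_even C n) (wchar lam) (@Hz C n)
    _ (fun p => z0 (lowE C p)) (fun _ => false) (root_wt0 false (@cpos C n)) _ _ verma v false).
  - exact: is_rootz.
  - exact: root_z_dec.
  - by rewrite scale1r; apply: ind_gen_par.
  - exact: ind_gen_char.
  - exact: ind_gen_generates.
elim=> {w} [|p w _ [k hw]|c u w _ [k hu] _ [l hw]].
- by exists 0%N; apply: word_span_v.
- exists k.+1; rewrite /lowE; case: ifP => hp; first exact: word_span_f.
  by rewrite (linear_fun0 (actz_linear w)); apply: word_span_0.
- exists (maxn k l); apply: word_span_lin.
    by apply: word_span_mono hu; apply: leq_maxl.
  by apply: word_span_mono hw; apply: leq_maxr.
Qed.

Lemma word_span_fword s : all low s -> word_span (size s) (lower_word s).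
Proof. by elim: s => [_|p s IH /andP [lp ls]]; [apply: word_span_v|apply: word_span_f lp (IH ls)]. Qed.

Definition titem := (C * seq ('I_n * 'I_n))%type.
Lemma word_span_items k w : word_span k w -> exists2 s : seq titem,
  (forall it, List.In it s -> (size it.2 <= k)%N /\ all low it.2) &
  w = \sum_(it <- s) it.1 *: lower_word it.2.
Proof.
elim=> {k w} [k|k p w lp _ [s hs ->]|k c u w _ [s hs ->] _ [s' hs' ->]].
- by exists [:: (1, [::])]; rewrite ?big_seq1 ?scale1r // => it [<-|].
- exists [seq (it.1, p :: it.2) | it <- s].
    move=> it /(List.in_map_iff (fun it : titem => (it.1, p :: it.2))) [i [<- /hs [h1 h2]]].
    by rewrite /= lp.
  rewrite big_map (linear_fun_sum _ _ _ (@smod_act_linear _ _ _ verma _)).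
  by apply: eq_bigr => it _; rewrite (linear_funZ _ _ (@smod_act_linear _ _ _ verma _)).
- exists ([seq (c * it.1, it.2) | it <- s] ++ s').
    move=> it h; have [|/hs' //] := List.in_app_or _ _ _ h.
    by move=> /(List.in_map_iff (fun it : titem => (c * it.1, it.2))) [i [<- /hs [h1 h2]]].
  rewrite big_cat big_map scaler_sumr; congr (_ + _).
  by apply: eq_bigr => it _; rewrite scalerA.
Qed.

(** Moving x to the front creates commutators of lower elementary matrices. These are again strictly
    lower triangular, so two letters are replaced by one and the correction has smaller length. *)
Lemma fword_rem s x : all low s -> x \in s ->
  word_span (size s).-1 (lower_word s - lower_word (x :: rem x s)).
Proof.
elim: s => // y s IH /andP [ly ls]; rewrite inE.
have [-> _|nxy /= xs] := eqVneq x y; first by rewrite /= eqxx subrr; apply: word_span_0.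
rewrite eq_sym (negbTE nxy) /=.
have lr : all low (rem x s) by apply/allP => z /mem_rem /(allP ls).
set W := lower_word (rem x s).
have sz : size s = (size (rem x s)).+1 by rewrite size_rem // prednK //; case: (s) xs.
have -> : smod_act (z0 (dE C y)) (lower_word s) - smod_act (z0 (dE C x)) (smod_act (z0 (dE C y)) W) =
    smod_act (z0 (dE C y)) (lower_word s - lower_word (x :: rem x s)) +
    smod_act (z0 (dE C y *m dE C x - dE C x *m dE C y)) W.
  by rewrite actzz -(linear_funB _ _ (@smod_act_linear _ _ _ verma _)) /= addrA subrK.
apply: word_span_add.
  by rewrite sz; apply: word_span_f => //; have := IH ls xs; rewrite sz.
rewrite sz; apply: word_span_low; last exact: word_span_fword.
have lx : low x by exact: (allP ls).
have pz (a b : 'I_n * 'I_n) (i j : 'I_n) : low a -> low b -> (i <= j)%N -> (dE C a *m dE C b) i j = 0.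
  rewrite /low /dE => la lb ij; rewrite mul_delta_mx_cond; case: eqP => [e|_]; last by rewrite mxE.
  rewrite mulr1n mxE; case: eqP => //= ei; case: eqP => //= ej.
  by move: la lb ij; rewrite -ei -ej e; lia.
by move=> i j ij; rewrite mxE [X in _ + X]mxE !pz // subrr.
Qed.

Lemma fword_perm s t : all low s -> perm_eq s t -> word_span (size s).-1 (lower_word s - lower_word t).
Proof.
elim: t s => [|x t IH] s ls st.
  by rewrite (perm_nilP st) subrr; apply: word_span_0.
have xs : x \in s by rewrite (perm_mem st) mem_head.
have e : lower_word s - lower_word (x :: t) = (lower_word s - lower_word (x :: rem x s)) + (lower_word (x :: rem x s) - lower_word (x :: t)).
  by rewrite addrA subrK.
rewrite e; apply: word_span_add; first exact: fword_rem.
have rt : perm_eq (rem x s) t.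
  by rewrite -(perm_cons x) -(permPl (perm_to_rem xs)).
have lr : all low (rem x s) by apply/allP => z /mem_rem /(allP ls).
rewrite /= (linear_funB _ _ (@smod_act_linear _ _ _ verma _)).
have lx : low x by exact: (allP ls).
have := IH _ lr rt; rewrite size_rem //.
case er: (rem x s) rt lr => [|y r] rt lr.
  have -> : t = [::] by apply/perm_nilP; rewrite perm_sym.
  by move=> _; rewrite subrr (linear_fun0 (@smod_act_linear _ _ _ verma _)); apply: word_span_0.
have sz : size s = (size r).+2 by rewrite (perm_size (perm_to_rem xs)) er.
by rewrite sz /=; apply: word_span_f.
Qed.

(** The commutative image of a word: the exponents of the monomial in which each letter (i, j) is
    read as x_(i, j). *)
Definition cnt (s : seq ('I_n * 'I_n)) : mono := fun q => count (fun p : 'I_n * 'I_n => (p.1 : nat, p.2 : nat) == q) s.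
Definition dmono (b : mono) : fser C := fun a => (`[< a = b >])%:R.

Lemma deg_cnt s : deg n (cnt s) = size s.
Proof.
rewrite /deg /cnt; elim: s => [|p s IH]; first by rewrite big1.
rewrite /= -IH big_split -[RHS]add1n; congr (_ + _)%N.
rewrite (bigD1 p) //= eqxx big1 ?addn0 // => t tp.
by case: eqP => // -[e1 e2]; case/eqP: tp; case: t p e1 e2 => ? ? [? ?] /= /val_inj -> /val_inj ->.
Qed.

Lemma x_dmono p s : xv C (p.1 : nat, p.2 : nat) (dmono (cnt s)) = dmono (cnt (p :: s)).
Proof.
apply: fserP => a; rewrite xvE /dmono.
have e q : cnt (p :: s) q = ((((p.1 : nat, p.2 : nat)) == q) + cnt s q)%N by [].
case ea: (a _) => [|k].
  rewrite asboolF // => ap; move: ea; rewrite ap e eqxx //.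
congr (nat_of_bool _)%:R; apply/asboolP/asboolP => h.
  apply: functional_extensionality_dep => q; rewrite e -h /upd eq_sym.
  by case: eqP => [->|]; rewrite // ea.
apply: functional_extensionality_dep => q; rewrite /upd h e eq_sym; case: eqP => [eq|//].
by move: ea; rewrite h e eqxx eq => -[].
Qed.

Lemma cnt_perm s t : (cnt s = cnt t) <-> perm_eq s t.
Proof.
have ec x r : count_mem x r = cnt r (x.1 : nat, x.2 : nat).
  by apply: eq_count => p /=; rewrite xpair_eqE !val_eqE; case: p x => ? ? [? ?]; rewrite xpair_eqE.
split=> [e|/seq.permP h]; last by apply: functional_extensionality_dep => q; apply: h.
by apply/allP => x _ /=; rewrite !ec e.
Qed.

Variable F : shom verma verma_model.
Hypothesis Fv : F v = fone C.

(** Each letter acts as multiplication by its variable up to terms that do not raise the degree. The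
    symbol of a word is therefore the monomial of its letters. *)
Lemma F_fword_lead s : all low s -> vanishes_from n (size s) ((F (lower_word s) : fser C) - dmono (cnt s)).
Proof.
elim: s => [_|p s IH /andP [lp ls]].
  by rewrite /= Fv => a _; rewrite fserDE fserNE subrr.
rewrite /= shom_act vmod_z0 gl_op_delta -x_dmono.
set f := F _; set b := dmono _.
have -> : (egl p.1 p.2) f - xv C (p.1 : nat, p.2 : nat) b =
   (egl p.1 p.2 - xv C (p.1 : nat, p.2 : nat)) f + xv C (p.1 : nat, p.2 : nat) ((f : fser C) - b).
  by rewrite endoBE (endo_ofD _ (f : fser C)) endo_ofN addrA subrK.
have fb : vanishes_from n (size s) ((f : fser C) - b) by exact: IH.
have vf : vanishes_from n (size s).+1 f.
  move=> a ha; have := fb a (ltnW ha); rewrite fserDE fserNE /b /dmono => /eqP.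
  rewrite subr_eq0 => /eqP ->; case: asboolP => // ea.
  by move: ha; rewrite ea deg_cnt ltnn.
move=> a ha; rewrite fserDE [X in _ + X](@vanishes_from_x _ n (size s) (p.1 : nat, p.2 : nat)) ?addr0 //; last first.
  by rewrite /in_range /= !ltn_ord.
have [_ C2] := degree_shift_gl_diffop_all lamn (leqnn n).
have := C2 (p.1 : nat) (p.2 : nat); rewrite [(p.2 < p.1)%N]lp ltn_ord => /(_ isT (size s).+1 f).
by rewrite !addn0 => /(_ vf a ha).
Qed.

(** Words with the same letters agree modulo shorter ones, so that in each class only the sum of the
    coefficients matters. The classes are removed one at a time, by induction on the length of the
    list. *)
Lemma cancel_words k (s : seq titem) :
  (forall it, List.In it s -> size it.2 = k.+1 /\ all low it.2) ->
  (forall t, \sum_(it <- s | perm_eq it.2 t) it.1 = 0) ->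
  word_span k (\sum_(it <- s) it.1 *: lower_word it.2).
Proof.
have [m] := ubnP (size s); elim: m s => // m IH [|it0 s] sz hs h0.
  by rewrite big_nil; apply: word_span_0.
set s1 := (it0 :: s) in sz hs h0 *; pose P (it : titem) := perm_eq it.2 it0.2.
rewrite (bigID P) /=; apply: word_span_add.
  have -> : \sum_(it <- s1 | P it) it.1 *: lower_word it.2 =
      \sum_(it <- s1 | P it) it.1 *: (lower_word it.2 - lower_word it0.2).
    under [RHS]eq_bigr do rewrite scalerBr.
    by rewrite sumrB -scaler_suml h0 scale0r subr0.
  elim: s1 hs {h0 sz} => [|it r IHr] hs; first by rewrite big_nil; apply: word_span_0.
  have hr : word_span k (\sum_(it <- r | P it) it.1 *: (lower_word it.2 - lower_word it0.2)).
    by apply: IHr => i hi; apply: hs; right.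
  rewrite big_cons; case: ifP => // pit; apply: word_span_add hr; apply: word_span_scale.
  have [e1 l1] := hs it (or_introl erefl).
  by have := fword_perm l1 pit; rewrite e1.
rewrite -big_filter; apply: IH.
- rewrite /= /P perm_refl /= size_filter; apply: leq_ltn_trans (count_size _ _) _.
  exact: sz.
- move=> it hi; apply: hs; elim: (s1) hi => //= i r IHr; case: ifP => _; last by right; apply: IHr.
  by move=> [->|hi]; [left|right; apply: IHr].
- move=> t; rewrite big_filter_cond; have [pt|npt] := boolP (perm_eq it0.2 t).
    rewrite big_pred0 // => it; apply/negP => /andP [/negP n1 n2]; apply: n1.
    by rewrite /P (permPl n2) perm_sym.
  rewrite -[RHS](h0 t); apply: eq_bigl => it; case pt: (perm_eq it.2 t); rewrite ?andbF ?andbT //.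
  by apply/negP => pi; move: npt; rewrite -(permPl pi) pt.
Qed.

(** In degree k + 1, the coefficient of F w at the monomial of a word t is the sum of the
    coefficients of the rearrangements of t. If F w = 0 these sums vanish, and [cancel_words]
    applies. *)
Lemma F_step k w : word_span k.+1 w -> F w = 0 -> word_span k w.
Proof.
move=> hw Fw; have [s hs ws] := word_span_items hw.
have coef t : (size t = k.+1)%N -> \sum_(it <- s | perm_eq it.2 t) it.1 = 0.
  move=> st; have : (F w : fser C) (cnt t) = 0 by rewrite Fw.
  rewrite ws (linear_fun_sum _ _ _ (shom_linear F)) fser_sumE => e0; rewrite -[RHS]e0.
  rewrite big_mkcond; elim: s hs {ws e0} => [|it r IHr] hs; first by rewrite !big_nil.
  rewrite !big_cons IHr; last by move=> i hi; apply: hs; right.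
  congr (_ + _); rewrite (linear_funZ _ _ (shom_linear F)) fserZE.
  have [s1 l1] := hs it (or_introl erefl).
  have := F_fword_lead l1 (a := cnt t); rewrite deg_cnt st => /(_ s1).
  rewrite fserDE fserNE => /eqP; rewrite subr_eq0 => /eqP ->; rewrite /dmono.
  case: asboolP => [/esym/cnt_perm ->|h]; first by rewrite mulr1.
  by case: ifP => [/cnt_perm e|_]; [case: h|rewrite mulr0].
rewrite ws (bigID (fun it : titem => size it.2 == k.+1)) /=; apply: word_span_add; last first.
  elim: s hs {ws coef} => [|it r IHr] hs; first by rewrite big_nil; apply: word_span_0.
  have hr := IHr (fun i hi => hs i (or_intror hi)).
  rewrite big_cons; case: ifP => // sk; apply: word_span_add hr; apply: word_span_scale.
  have [s1 l1] := hs it (or_introl erefl); apply: word_span_mono (word_span_fword l1).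
  by rewrite -ltnS ltn_neqAle sk.
rewrite -big_filter; apply: cancel_words.
  move=> it hi; suff [h1 h2] : List.In it s /\ size it.2 == k.+1.
    by have [_ l1] := hs _ h1; split=> //; apply/eqP.
  elim: (s) hi => //= i r IHr; case: ifP => [hi [<-|/IHr [? ?]]|_ /IHr [? ?]];
    by split=> //; auto.
move=> t; rewrite big_filter_cond; have [st|st] := eqVneq (size t) k.+1.
  rewrite -[RHS](coef t st); apply: eq_bigl => it; case pt: (perm_eq it.2 t); rewrite ?andbF //.
  by rewrite (perm_size pt) st eqxx.
by rewrite big_pred0 // => it; apply/negP => /andP [/eqP h /perm_size e]; rewrite -e h eqxx in st.
Qed.

(** The substitute for the PBW theorem of strictly lower triangular matrices: descending the
    filtration, w becomes a multiple of the generator, whose image is not 0. *)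
Lemma F_inj w : F w = 0 -> w = 0.
Proof.
move=> Fw; have [k] := word_span_all w; elim: k => [|k IH] hw; last exact/IH/F_step.
have [s hs ws] := word_span_items hw.
have e : w = (\sum_(it <- s) it.1) *: v.
  rewrite ws scaler_suml; elim: s hs {ws} => [|it r IHr] hs; first by rewrite !big_nil.
  rewrite !big_cons IHr; last by move=> i hi; apply: hs; right.
  by have [] := hs it (or_introl erefl); rewrite leqn0 => /nilP ->.
move: Fw; rewrite e (linear_funZ _ _ (shom_linear F)) Fv => /eqP.
rewrite scaler_eq0 => /orP [/eqP ->|/eqP /fone_neq0 //].
exact: scale0r.
Qed.
End Words.

Theorem verma_singular_unique (gam : weight C n) (w0 w1 : verma) :
  char_vector (@borel_even C n) (wchar gam) w0 -> char_vector (@borel_even C n) (wchar gam) w1 ->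
  w0 <> 0 -> exists c, w1 = c *: w0.
Proof.
have [F Fv] := vm_hom.
pose gamn (k : nat) : C := \sum_(i < n | (i : nat) == k) gam 0 i.
have sing w : char_vector (@borel_even C n) (wchar gam) w ->
    (forall i j, (i < j < n)%N -> gl_diffop lamn n i j (F w) = 0) /\
    (forall i, (i < n)%N -> gl_diffop lamn n i i (F w) = gamn i *: (F w : fser C)).
  move=> /char_evenP h; have act A : upmx A -> gl_op A (F w) = wtr gam A *: (F w : fser C).
    by move=> uA; rewrite -vmod_z0 -shom_act h // (linear_funZ _ _ (shom_linear F)).
  split=> [i j /andP [ij jn]|i iN].
    have := gl_op_delta (Ordinal (ltn_trans ij jn)) (Ordinal jn) => /= <-; rewrite act.
      rewrite /wtr big1 ?scale0r // => k _; rewrite mxE.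
      case: eqP => [->|] /=; last by rewrite mulr0.
      by rewrite -val_eqE /= (ltn_eqF ij) mulr0.
    move=> a b ba; rewrite mxE; case: eqP => //= ea; case: eqP => //= eb.
    by move: ba; rewrite ea eb /= ltnNge (ltnW ij).
  have := gl_op_delta (Ordinal iN) (Ordinal iN) => /= <-; rewrite act; last exact: upmx_diag.
  congr (_ *: _); rewrite /wtr /gamn [RHS](big_pred1 (Ordinal iN)) //.
  rewrite (bigD1 (Ordinal iN)) //= mxE !eqxx mulr1 big1 ?addr0 // => k ki.
  by rewrite mxE (negbTE ki) mulr0.
move=> /sing [s0 h0] /sing [s1 h1] n0.
have F0 : (F w0 : fser C) <> 0 by move=> /(F_inj Fv).
have [c ec] := singular_unique (regular_vm Fv w0) (regular_vm Fv w1) s0 s1 h0 h1 F0.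
exists c; apply/eqP; rewrite -subr_eq0; apply/eqP/(F_inj Fv).
rewrite -(linear_funB _ _ (shom_linear F)) (linear_funZ _ _ (shom_linear F)).
by rewrite [X in X - _ = _]ec subrr.
Qed.
End VermaModel.

(** * Simple submodules, direct sums and twists *)

Section SimpleModules.
Variables (C : numClosedFieldType) (n : nat) (g : lieSub C n).
Implicit Types M N : smod g.

Lemma sub_eqP M (S T : submod M) : (forall v, S v <-> T v) -> sub_set S = sub_set T.
Proof. by move=> h; apply: functional_extensionality_dep => v; apply/propext/h. Qed.

Lemma sub_neq0 M (S : submod M) : sub_set S <> [set 0]%classic -> exists2 v, S v & v <> 0.
Proof.
move=> nS; apply: contrapT => h; apply: nS; apply/seteqP; split=> [v Sv|_ ->]; last exact: sub0.
by apply: contrapT => v0; apply: h; exists v.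
Qed.

Lemma simple_subP M (S : submod M) : (exists2 v, S v & v <> 0) ->
  (forall (T : submod M) t, (forall v, T v -> S v) -> T t -> t <> 0 -> forall v, S v -> T v) ->
  simple_sub S.
Proof.
move=> nS h; split=> // T TS; have [T0|/sub_neq0 [t Tt t0]] := pselect (sub_set T = [set 0]%classic).
  by left.
right; apply: sub_eqP => v; split; first exact: TS.
exact: h Tt t0 v.
Qed.

Lemma simple_sub_max M (S T : submod M) t : simple_sub S -> (forall v, T v -> S v) ->
  T t -> t <> 0 -> forall v, S v -> T v.
Proof.
move=> [_ h] TS Tt t0 v Sv; have [e|->] := h T TS => //.
by case: t0; move: Tt; rewrite e.
Qed.

(** The preimage of [T] in M, if proper, is contained in [rad], and then [T] is 0. *)
Lemma simple_quo_sub M (T : submod (simple_quo M)) t : T t -> t <> 0 -> forall v, T v.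
Proof.
move=> Tt t0; pose P := preim_submod (quo_proj (rad M)) T.
have [PT|nP] := pselect (sub_set P = setT).
  by elim/quo_ind=> u; have : sub_set P u by rewrite PT.
case: t0; move: t Tt; elim/quo_ind=> u Pu; rewrite -[RHS]/(quo_pi (rad M) 0).
by apply/quo_piP; rewrite subr0 => N; apply; exists P.
Qed.

Lemma soc_iso M N (B : shom M N) (A : shom N M) : cancel B A -> cancel A B ->
  forall w, soc M w -> soc N (B w).
Proof.
move=> BK AK w /(_ (preim_submod B (soc N))); apply=> v [S hS Sv] T; apply.
have B0 u : B u = 0 -> u = 0 by move=> e; rewrite -[u]BK e (linear_fun0 (shom_linear A)).
have A0 u : A u = 0 -> u = 0 by move=> e; rewrite -[u]AK e (linear_fun0 (shom_linear B)).
exists (preim_submod A S); last by rewrite /= BK.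
have [[s Ss s0] _] := hS; apply: simple_subP; first by exists (B s); [rewrite /= BK|move/B0].
move=> T' t T'S T't t0 u Su.
have := @simple_sub_max _ S (preim_submod B T') (A t) hS; rewrite /= AK => max.
rewrite -[u]AK; apply: max => // [x Tx|]; last by move/A0.
by have := T'S _ Tx; rewrite /= BK.
Qed.

(** The isomorphism is h followed by the inverse of f; its parity is the sum of the two shifts. *)
Lemma iso_of_ranges M N P (a b : bool) (S : submod P) (h : shom (pshift a M) P)
    (f : shom (pshift b N) P) :
  injective h -> range h = sub_set S -> injective f -> range f = sub_set S -> smod_iso M N.
Proof.
move=> hi hr fi fr.
have ex u : exists w, f w = h u.
  by have : range f (h u) by [rewrite fr -hr; exists u]; move=> [w _ <-]; exists w.
have ex' w : exists u, h u = f w.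
  by have : range h (f w) by [rewrite hr -fr; exists w]; move=> [u _ <-]; exists u.
pose phi (u : M) : N := projT1 (cid (ex u)).
have phiE u : f (phi u) = h u := projT2 (cid (ex u)).
have phi_lin : linear phi by move=> c u v; apply: fi; rewrite (shom_linear f) !phiE (shom_linear h).
have phi_act x u : phi (smod_act x u) = smod_act x (phi u).
  by apply: fi; rewrite phiE (shom_act f x) (shom_act h x) phiE.
have phi_par u : phi (pshift_par (a (+) b) u) = smod_par (phi u).
  apply: fi; have := shom_par f (phi u); rewrite /= /pshift_par phiE => e.
  have -> : f (smod_par (phi u)) = (-1) ^+ b *: smod_par (h u).
    by rewrite -e (linear_funZ _ _ (shom_linear f)) scalerA sgn_sq scale1r.
  rewrite phiE -(shom_par h) /= /pshift_par -(linear_funZ _ _ (shom_linear h)).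
  by rewrite scalerA -signr_addb addbC.
exists (a (+) b), (@SHom _ _ _ (pshift (a (+) b) M) N phi phi_lin phi_act phi_par).
exists (fun w => projT1 (cid (ex' w))) => [u|w] /=.
  by apply: hi; rewrite (projT2 (cid (ex' _))) phiE.
by apply: fi; rewrite phiE (projT2 (cid (ex' _))).
Qed.

(** The orbit U(g) v, which is a graded submodule as soon as v is homogeneous. *)
Definition cyclic_set M (v : M) (w : M) := exists u, w = umod u v.

Section Cyclic.
Variables (M : smod g) (v : M) (q : bool).
Hypothesis pv : smod_par v = (-1) ^+ q *: v.
Lemma cyclic0 : cyclic_set v 0.
Proof. by exists 0; rewrite umod0. Qed.
Lemma cyclicP (c : C) w w' : cyclic_set v w -> cyclic_set v w' -> cyclic_set v (c *: w + w').
Proof. by move=> [u ->] [u' ->]; exists (c *: u + u'); rewrite umodD umodZ. Qed.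
Lemma cyclic_par w : cyclic_set v w -> cyclic_set v (smod_par w).
Proof.
move=> [u ->]; exists ((-1) ^+ q *: upar u).
by rewrite umod_par pv (linear_funZ _ _ (umod_linear _)) umodZ.
Qed.
Lemma cyclic_act x w : cyclic_set v w -> cyclic_set v (smod_act x w).
Proof. by move=> [u ->]; exists (ugen x * u); rewrite umodM umod_gen. Qed.
Definition cyclic_submod := SubMod cyclic0 cyclicP cyclic_par cyclic_act.

Lemma generates_of_sub : (forall S : submod M, S v -> forall w, S w) -> generates v.
Proof. by move=> h; apply: (h cyclic_submod); exists 1; rewrite umod1. Qed.
End Cyclic.

Section DirectSums.
Variables (I : finType) (F : I -> smod g).

(** The summands have different types, so x is transported along an equality k = i that is decided
    classically. *)
Definition dinj_fun k (x : F k) : dsum F := fun i =>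
  if pselect (k = i) is left e then eq_rect k (fun i => smod_car (F i)) x i e else 0.

Lemma dinj_same k x : @dinj_fun k x k = x.
Proof.
by rewrite /dinj_fun; case: pselect => // e; rewrite (Prop_irrelevance e erefl).
Qed.
Lemma dinj_diff k i x : k <> i -> @dinj_fun k x i = 0.
Proof. by rewrite /dinj_fun; case: pselect. Qed.

Lemma dinj_eq k x (u : dsum F) : u k = x -> (forall i, k <> i -> u i = 0) -> dinj_fun x = u.
Proof.
move=> uk ui; apply: functional_extensionality_dep => i.
have [e|ne] := pselect (k = i); last by rewrite dinj_diff ?ui.
by subst i; rewrite dinj_same.
Qed.

Lemma dinj_linear k : linear (@dinj_fun k).
Proof.
move=> c x y; apply: dinj_eq => [|i ki].
  by rewrite -[LHS]/(c *: dinj_fun x k + dinj_fun y k) !dinj_same.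
by rewrite -[LHS]/(c *: dinj_fun x i + dinj_fun y i) !dinj_diff // scaler0 addr0.
Qed.
Lemma dinj_act k x (u : F k) : dinj_fun (smod_act x u) = smod_act x (dinj_fun u : dsum F).
Proof.
apply: dinj_eq => [|i ki]; first by rewrite -[LHS]/(smod_act x (dinj_fun u k)) dinj_same.
rewrite -[LHS]/(smod_act x (dinj_fun u i)) dinj_diff //.
exact/linear_fun0/smod_act_linear.
Qed.
Lemma dinj_par k (u : F k) : dinj_fun (smod_par u) = smod_par (dinj_fun u : dsum F).
Proof.
apply: dinj_eq => [|i ki]; first by rewrite -[LHS]/(smod_par (dinj_fun u k)) dinj_same.
rewrite -[LHS]/(smod_par (dinj_fun u i)) dinj_diff //.
exact/linear_fun0/smod_par_linear.
Qed.
Definition dinj k : shom (F k) (dsum F) := SHom (@dinj_linear k) (@dinj_act k) (@dinj_par k).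

Lemma dsumE (J : Type) (r : seq J) (P : pred J) (u : J -> dsum F) i :
  (\sum_(j <- r | P j) u j) i = \sum_(j <- r | P j) u j i.
Proof.
by elim/big_rec2: _ => // j y x _ <-.
Qed.

Lemma dsum_decomposition (u : dsum F) : u = \sum_k dinj k (u k).
Proof.
apply: functional_extensionality_dep => i; rewrite dsumE (bigD1 i) //= dinj_same.
by rewrite big1 ?addr0 // => j ji; rewrite dinj_diff //; apply/eqP.
Qed.

Variables (M : smod g) (f : forall k, shom (F k) M).
Definition dsum_hom_fun (u : dsum F) : M := \sum_k f k (u k).
Lemma dsum_hom_linear : linear dsum_hom_fun.
Proof.
move=> c u v; rewrite /dsum_hom_fun scaler_sumr -big_split; apply: eq_bigr => k _.
exact: shom_linear.
Qed.
Lemma dsum_hom_act x u : dsum_hom_fun (smod_act x u) = smod_act x (dsum_hom_fun u).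
Proof.
rewrite [RHS](linear_fun_sum _ _ _ (@smod_act_linear _ _ _ M x)); apply: eq_bigr => k _.
exact: shom_act.
Qed.
Lemma dsum_hom_par u : dsum_hom_fun (smod_par u) = smod_par (dsum_hom_fun u).
Proof.
rewrite [RHS](linear_fun_sum _ _ _ (@smod_par_linear _ _ _ M)); apply: eq_bigr => k _.
exact: shom_par.
Qed.
Definition dsum_hom : shom (dsum F) M := SHom dsum_hom_linear dsum_hom_act dsum_hom_par.
End DirectSums.
End SimpleModules.

Section Restriction.
Variables (C : numClosedFieldType) (n : nat) (M : smod (pe C n)).

Definition even_incl (x : set_type (pe_even C n)) : set_type (pe C n) :=
  SigSub (mem_set (proj1 (set_mem (valP x)))).

Definition restriction : smod (pe_even C n) :=
  @SMod _ _ (pe_even C n) M (@smod_par _ _ _ M) (fun x => smod_act (even_incl x))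
    (@smod_par_linear _ _ _ M) (@smod_parK _ _ _ M) (fun x => @smod_act_linear _ _ _ M _)
    (fun c x y z v => @smod_actP _ _ _ M c (even_incl x) (even_incl y) (even_incl z) v)
    (fun a x v => @smod_act_par _ _ _ M a (even_incl x) v)
    (fun a b x y z v =>
       @smod_act_bracket _ _ _ M a b (even_incl x) (even_incl y) (even_incl z) v).

Lemma restriction_z0 A (v : M) : smod_act (s := restriction) (z0 A) v = smod_act (e0 A) v.
Proof. by rewrite /= (_ : even_incl (z0 A) = e0 A) //; apply: val_inj. Qed.
End Restriction.

Section Twist.
Variables (C : numClosedFieldType) (n : nat) (c : C) (M : smod (pe C n)).
Implicit Types (x y z : set_type (pe C n)) (v : M).

Definition ultr x : C := c * \tr (ulsubmx (val x)).
Definition twist_act x v : M := smod_act x v + ultr x *: v.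

Lemma ultr_odd x : homog true (val x) -> ultr x = 0.
Proof. by move=> hx; rewrite /ultr; have [/= -> _ _ _] := pe_blocks hx; rewrite mxtrace0 mulr0. Qed.

Lemma mxtrace_sym_antisym (S D : 'M[C]_n) : sym S -> antisym D -> \tr (S *m D) = 0.
Proof.
move=> hS hD; have e : \tr (S *m D) = - \tr (S *m D).
  by rewrite -{1}mxtrace_tr trmx_mul hD hS mulNmx linearN /= mxtrace_mulC.
have : \tr (S *m D) *+ 2 == 0 by rewrite mulr2n {1}e addNr.
by rewrite mulrn_eq0 => /eqP.
Qed.

Lemma ultr_bracket a b x y z : homog a (val x) -> homog b (val y) ->
  val z = sbracket a b (val x) (val y) -> ultr z = 0.
Proof.
move=> hx hy hz; have [zx sx ax ex] := pe_blocks hx; have [zy sy ay ey] := pe_blocks hy.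
rewrite /ultr hz ex ey /sbracket !mulmx_block scale_block_mx opp_block_mx add_block_mx block_mxKul.
rewrite linearB linearZ /= !linearD /= ![\tr (ursubmx _ *m _)]mxtrace_sym_antisym // !addr0.
suff -> : \tr (ulsubmx (val x) *m ulsubmx (val y)) - (-1) ^+ (a && b) * \tr (ulsubmx (val y) *m ulsubmx (val x)) = 0.
  by rewrite mulr0.
rewrite [X in _ - _ * X]mxtrace_mulC; case: a b zx zy {hx hy hz ex ey} => [|] [|] zx zy;
  by rewrite /= ?expr0 ?mul1r ?subrr // ?zx ?zy ?mul0mx ?mxtrace0 ?mulr0 ?subr0.
Qed.

Lemma twist_act_linear x : linear (twist_act x).
Proof.
move=> k u v; rewrite /twist_act smod_act_linear !scalerDr addrACA; congr (_ + _).
by rewrite !scalerA mulrC.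
Qed.
Lemma twist_actP (k : C) x y z v : val z = k *: val x + val y ->
  twist_act z v = k *: twist_act x v + twist_act y v.
Proof.
move=> hz; rewrite /twist_act (smod_actP _ hz) /ultr hz scalerDr addrACA; congr (_ + _).
rewrite (_ : ulsubmx _ = k *: ulsubmx (val x) + ulsubmx (val y)); last by apply/matrixP => i j; rewrite !mxE.
by rewrite linearP /= mulrDr scalerDl mulrCA scalerA.
Qed.
Lemma twist_act_par a x v : homog a (val x) ->
  smod_par (twist_act x v) = (-1) ^+ a *: twist_act x (smod_par v).
Proof.
move=> hx; rewrite /twist_act (linear_funD _ _ (@smod_par_linear _ _ _ M)) (smod_act_par _ hx).
rewrite (linear_funZ _ _ (@smod_par_linear _ _ _ M)) scalerDr; congr (_ + _).
by case: a hx => [/ultr_odd ->|_]; rewrite ?scale0r ?scaler0 ?scale1r.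
Qed.
Lemma twist_act_bracket a b x y z v : homog a (val x) -> homog b (val y) ->
  val z = sbracket a b (val x) (val y) ->
  twist_act z v = twist_act x (twist_act y v) - (-1) ^+ (a && b) *: twist_act y (twist_act x v).
Proof.
move=> hx hy hz; rewrite /twist_act (ultr_bracket hx hy hz) scale0r addr0.
rewrite (smod_act_bracket _ hx hy hz).
rewrite !(linear_funD _ _ (@smod_act_linear _ _ _ M _)) !(linear_funZ _ _ (@smod_act_linear _ _ _ M _)).
have cancel (p q r s t : M) : p + s + (r + t) - (q + r + (s + t)) = p - q.
  by rewrite -[p + s + _]addrA -[q + r + _]addrA [r + (s + t)]addrCA opprD addrACA subrr addr0.
case ab: (a && b); last first.
  by rewrite !scale1r !scalerDr !scalerA [ultr y * _]mulrC cancel.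
move: ab hx hy {hz}; case: a; case: b => // _ /ultr_odd -> /ultr_odd ->.
by rewrite !scale0r !addr0.
Qed.

(* M tensored with the character c tr(A), which is one of pe(n) because
   tr(B C) = 0 for B symmetric and C antisymmetric. *)
Definition twist : smod (pe C n) := SMod (@smod_par_linear _ _ _ M) (@smod_parK _ _ _ M)
  twist_act_linear twist_actP twist_act_par twist_act_bracket.

Lemma twist_e0 A (v : twist) : smod_act (e0 A) v = smod_act (e0 A) (v : M) + (c * \tr A) *: (v : M).
Proof. by rewrite -[LHS]/(twist_act (e0 A) v) /twist_act /ultr /= ul_mx0. Qed.
Lemma twist_e1 B (v : twist) : smod_act (e1 B) v = smod_act (e1 B) (v : M).
Proof. by rewrite -[LHS]/(twist_act (e1 B) v) /twist_act /ultr /= ul_mx1 mxtrace0 mulr0 scale0r addr0. Qed.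
Lemma twist_em B (v : twist) : smod_act (em B) v = smod_act (em B) (v : M).
Proof. by rewrite -[LHS]/(twist_act (em B) v) /twist_act /ultr /= ul_mxm mxtrace0 mulr0 scale0r addr0. Qed.

Lemma twist_sub_act (S : submod M) x v : S v -> S (twist_act x v).
Proof. by move=> Sv; apply: subD; [apply: sub_act|apply: sub_scale]. Qed.
Definition twist_sub (S : submod M) : submod twist :=
  @SubMod _ _ _ twist S (sub0 S) (@subP _ _ _ _ S) (@sub_par _ _ _ _ S) (@twist_sub_act S).

Lemma untw_sub_act (S : submod twist) x v : S v -> S (smod_act x v).
Proof.
move=> Sv; have -> : smod_act x v = (- ultr x) *: (v : twist) + smod_act (s := twist) x v.
  by rewrite [X in _ + X]/= /twist_act addrCA scaleNr addNr addr0.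
by apply: subP => //; apply: sub_act.
Qed.
Definition untw_sub (S : submod twist) : submod M :=
  @SubMod _ _ _ M S (sub0 S) (@subP _ _ _ _ S) (@sub_par _ _ _ _ S) (@untw_sub_act S).

Lemma twist_simple (S : submod M) : simple_sub S -> simple_sub (twist_sub S).
Proof.
by move=> [h1 h2]; split=> // T TS; apply: (h2 (untw_sub T)).
Qed.

(** U(g) acts on the twist by different operators, but the submodules are the same, and for a
    homogeneous vector generation can be tested on submodules. *)
Lemma twist_generates (v : M) (q : bool) : smod_par v = (-1) ^+ q *: v -> generates v -> @generates _ _ _ twist v.
Proof.
move=> pv gv; apply: (@generates_of_sub _ _ _ twist v q) => // S Sv.
exact: (@generates_sub _ _ _ M v (untw_sub S)).
Qed.

Lemma wtr_shift k a (A : 'M[C]_n) : wtr (k + a *: \sum_i eps C i) A = wtr k A + a * \tr A.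
Proof.
rewrite /wtr /mxtrace mulr_sumr -big_split; apply: eq_bigr => i _ /=.
rewrite !mxE summxE (bigD1 i) //= eps_eval eqxx big1 ?addr0 ?mulr1 ?mulrDl // => j ji.
by rewrite eps_eval (negbTE ji).
Qed.

Lemma twist_char k (v : M) : char_vector (@borel C n) (wchar k) v <->
  char_vector (@borel C n) (wchar (k + c *: \sum_i eps C i)) (v : twist).
Proof.
split=> /char_borelP [h0 h1]; apply/char_borelP; split=> [A uA|B].
- by rewrite twist_e0 h0 // wtr_shift scalerDl.
- by rewrite twist_e1.
- by have := h0 A uA; rewrite twist_e0 wtr_shift scalerDl => /addIr.
- by rewrite -twist_e1.
Qed.
Lemma twist_char_rev k (v : M) :
  (forall A, upmx A -> smod_act (e0 A) v = wtr k A *: v) -> (forall B, smod_act (em B) v = 0) ->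
  char_vector (@borel_rev C n) (wchar (k + c *: \sum_i eps C i)) (v : twist).
Proof.
move=> h0 h1; apply/char_borel_revP; split=> [A uA|B]; last by rewrite twist_em.
by rewrite twist_e0 h0 // wtr_shift scalerDl.
Qed.
End Twist.

(** * The socle of a Kac module *)

Section FockSubspaces.
Variables (C : numClosedFieldType) (V : lmodType C).

Section Stable.
Variable S : V -> Prop.
Hypothesis S0 : S 0.
Hypothesis SP : forall (c : C) u v, S u -> S v -> S (c *: u + v).

Lemma fall0 k : @fall C V k S 0. Proof. by elim: k => //= k IH; split. Qed.
Lemma fallP k (c : C) (u v : fock V k) : fall S u -> fall S v -> fall S (c *: u + v).
Proof.
elim: k c u v => [|k IH] c u v; first exact: SP.
by move=> [u1 u2] [v1 v2]; split; apply: IH.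
Qed.
Lemma fallN k (u : fock V k) : fall S u -> fall S (- u).
Proof. by move=> hu; rewrite -scaleN1r -[_ *: _]addr0; apply: fallP hu (fall0 k). Qed.
Lemma fallD k (u v : fock V k) : fall S u -> fall S v -> fall S (u + v).
Proof. by move=> hu; rewrite -[u]scale1r; apply: fallP. Qed.
Lemma fallZ k (c : C) (u : fock V k) : fall S u -> fall S (c *: u).
Proof. by move=> hu; rewrite -[_ *: _]addr0; apply: fallP hu (fall0 k). Qed.
Lemma fall_sum k (I : Type) (r : seq I) (P : pred I) (F : I -> fock V k) :
  (forall i, P i -> fall S (F i)) -> fall S (\sum_(i <- r | P i) F i).
Proof. by move=> hF; apply: (big_ind (@fall C V k S)) => //; [apply: fall0|apply: fallD]. Qed.

Lemma fall_create k j (w : fock V k) : fall S w -> fall S (Th V k j w).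
Proof.
elim: k w => [|k IH] w; first by [].
move=> [w1 w2]; rewrite /=; case: eqP => _; split => //=; first exact: fall0.
  exact: IH.
exact/fallN/IH.
Qed.
Lemma fall_annih k j (w : fock V k) : fall S w -> fall S (Dl V k j w).
Proof.
elim: k w => [|k IH] w; first by [].
move=> [w1 w2]; rewrite /=; case: eqP => _; split => //=; first exact: fall0.
  exact: IH.
exact/fallN/IH.
Qed.
Lemma fall_map k (a : endo V) (w : fock V k) : (forall v, S v -> S (a v)) ->
  fall S w -> fall S (Mp k a w).
Proof.
move=> Sa; elim: k w => [|k IH] w; first exact: Sa.
by move=> [w1 w2]; split; apply: IH.
Qed.
Lemma fall_par k (p : V -> V) (w : fock V k) : (forall v, S v -> S (p v)) ->
  fall S w -> fall S (fpar p w).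
Proof.
move=> Sp; elim: k w => [|k IH] w; first exact: Sp.
by move=> [w1 w2]; split; [apply: IH|apply/fallN/IH].
Qed.
End Stable.

(** Componentwise in the exterior algebra. For an independent family of submodules T of V it gives
    the independence of the Lambda(g_{-1}) (x) T. *)
Lemma fall_independent (I : finType) (S : I -> V -> Prop) :
  (forall x : I -> V, (forall i, S i (x i)) -> \sum_i x i = 0 -> forall i, x i = 0) ->
  forall k (w : I -> fock V k), (forall i, fall (S i) (w i)) -> \sum_i w i = 0 ->
  forall i, w i = 0.
Proof.
move=> h; elim=> [|k IH] w Sw w0 i; first exact: h.
have l1 : linear (fun w : fock V k.+1 => w.1) by [].
have l2 : linear (fun w : fock V k.+1 => w.2) by [].
apply: (@fock_eq C V k).
  apply: (IH (fun i => (w i).1)) => [j|]; first by have [] := Sw j.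
  by rewrite -(linear_fun_sum _ _ _ l1) w0.
apply: (IH (fun i => (w i).2)) => [j|]; first by have [] := Sw j.
by rewrite -(linear_fun_sum _ _ _ l2) w0.
Qed.

Lemma Mp_scalar k (c : C) (a : endo V) (w : fock V k) : (forall v, a v = c *: v) -> Mp k a w = c *: w.
Proof.
move=> ac; elim: k w => [|k IH] w; first exact: ac.
by apply: (@fock_eq C V k); apply: IH.
Qed.

Lemma ftop_inj k : injective (@ftop C V k).
Proof. by elim: k => [|k IH] u v //= [/IH]. Qed.
Lemma fvac_inj k : injective (@fvac C V k).
Proof. by elim: k => [|k IH] u v //= [/IH]. Qed.
End FockSubspaces.

Section KacSocle.
Variables (C : numClosedFieldType) (n : nat) (V : smod (pe_even C n)).
Local Notation K := (kac V).

Lemma kac_sub_TH (T : submod V) D (w : K) : fall T w -> fall T (TH V D w).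
Proof.
move=> Tw; rewrite /TH endo_sumE; apply: fall_sum => [||j _]; [exact: sub0|exact: subP|].
by rewrite endoZE; apply: fallZ => //; [exact: sub0|exact: subP|apply: fall_create => //; [exact: sub0|exact: subP]].
Qed.
Lemma kac_sub_MA (T : submod V) A (w : K) : fall T w -> fall T (MA V A w).
Proof. by apply: fall_map => v; apply: sub_act. Qed.
Lemma kac_sub_dl (T : submod V) j (w : K) : fall T w -> fall T (Dl V _ j w).
Proof. by apply: fall_annih; [exact: sub0|exact: subP]. Qed.
Lemma kac_sub_O0 (T : submod V) A (w : K) : fall T w -> fall T (O0 V A w).
Proof.
move=> Tw; have [T0 TP] := (sub0 T, @subP _ _ _ _ T).
rewrite O0E endoDE; apply: fallD => //; first exact: kac_sub_MA.
by rewrite endo_sumE; apply: fall_sum => // j _; rewrite endoME; apply/kac_sub_TH/kac_sub_dl.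
Qed.
Lemma kac_sub_O1 (T : submod V) A (w : K) : fall T w -> fall T (O1 V A w).
Proof.
move=> Tw; have [T0 TP] := (sub0 T, @subP _ _ _ _ T).
rewrite O1E endoDE; apply: fallD => //.
  by rewrite endo_sumE; apply: fall_sum => // j _; rewrite endoME; apply/kac_sub_MA/kac_sub_dl.
rewrite endoZE; apply: fallZ => //; rewrite endo_sumE; apply: fall_sum => // j _.
rewrite endo_sumE; apply: fall_sum => // l _; rewrite !endoME.
by apply/kac_sub_TH/kac_sub_dl/kac_sub_dl.
Qed.

Section Sub.
Variable T : submod V.
Lemma kac_sub0 : fall T (0 : K). Proof. exact/fall0/sub0. Qed.
Lemma kac_subP c (u w : K) : fall T u -> fall T w -> fall T (c *: u + w).
Proof. by apply: fallP; apply: subP. Qed.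
Lemma kac_sub_par (w : K) : fall T w -> fall T (smod_par w : K).
Proof. by apply: fall_par => [||v]; [exact: sub0|exact: subP|apply: sub_par]. Qed.
Lemma kac_sub_act x (w : K) : fall T w -> fall T (smod_act x w : K).
Proof.
move=> Tw; rewrite -[smod_act x w]/(kac_act x w) /kac_act !endoDE.
have [T0 TP] := (sub0 T, @subP _ _ _ _ T).
by apply: fallD => //; [apply: fallD => //; [apply: kac_sub_O0|apply: kac_sub_O1]|apply: kac_sub_TH].
Qed.
(** K(T) inside K(V). It bounds [top_gen T] from above: by [kac_sub_top], the vectors of Lambda^top
    (x) V in it come from T. *)
Definition kac_sub : submod K := SubMod kac_sub0 kac_subP kac_sub_par kac_sub_act.

Lemma kac_sub_top v : kac_sub (top v) <-> T v.
Proof. exact/fall_top/sub0. Qed.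

Definition top_gen : submod K := @gen_submod _ _ _ K [set w : K | exists2 v, T v & w = top v]%classic.

Lemma top_gen_top v : T v -> top_gen (top v).
Proof. by move=> Tv S; apply; exists v. Qed.
Lemma top_gen_min (S : submod K) : (forall v, T v -> S (top v)) -> forall w, top_gen w -> S w.
Proof. by move=> h w; apply=> _ [v Tv ->]; apply: h. Qed.
Lemma top_gen_sub w : top_gen w -> kac_sub w.
Proof. by apply: top_gen_min => v /kac_sub_top. Qed.
End Sub.

Section Top.
Variable S : submod K.
Definition vtop_set (v : V) := S (top v).
Lemma vtop0 : vtop_set 0.
Proof. by rewrite /vtop_set (linear_fun0 (@top_linear _ _ V)); apply: sub0. Qed.
Lemma vtopP c u v : vtop_set u -> vtop_set v -> vtop_set (c *: u + v).
Proof. by rewrite /vtop_set top_linear; apply: subP. Qed.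
Lemma vtop_par v : vtop_set v -> vtop_set (smod_par v).
Proof.
move=> Sv; have := sub_par Sv; rewrite -[smod_par (top v : K)]/(kac_par (top v)) kac_par_top => h.
by rewrite /vtop_set -[top _]scale1r -(sgn_sq C (odd (adim n))) -scalerA !signr_odd; apply: sub_scale.
Qed.
Lemma vtop_act x v : vtop_set v -> vtop_set (smod_act x v).
Proof.
move=> Sv; rewrite act_pe_even /vtop_set; have := sub_act (e0 (ulsubmx (val x))) Sv.
rewrite kac_e0 O0_top => h; rewrite -[top _](addrK ((1 - n%:R) * \tr (ulsubmx (val x)) *: top v)).
by apply: subD => //; apply/subN/sub_scale.
Qed.
(** The inverse of T |-> [top_gen T] on simple submodules. It is stable under gl(n) because A acts
    on Lambda^top (x) v as on v, up to the scalar of [O0_top]. *)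
Definition vtop : submod V := SubMod vtop0 vtopP vtop_par vtop_act.
End Top.

(** A non-zero S inside [top_gen T] contains Lambda^top (x) v for some non-zero v, so [vtop S] is a
    non-zero submodule of T, hence T; then S contains the generators of [top_gen T]. *)
Lemma top_gen_simple (T : submod V) : simple_sub T -> simple_sub (top_gen T).
Proof.
move=> hT; have [[t Tt t0] _] := hT; apply: simple_subP.
  exists (top t); first exact: top_gen_top.
  by move=> e; apply: t0; move: e; rewrite -(linear_fun0 (@top_linear _ _ V)); apply: ftop_inj.
move=> S s SG Ss s0; have [v v0 Sv] := sub_reaches_top Ss s0.
apply: top_gen_min => u Tu; apply: (simple_sub_max (T := vtop S) hT _ Sv v0 Tu) => x Sx.
exact/kac_sub_top/top_gen_sub/SG.
Qed.

(** A non-zero submodule T of [vtop S] has a non-zero [top_gen T] inside S, hence equal to S, and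
    the intersection with Lambda^top (x) V gives T back. *)
Lemma simple_top_gen (S : submod K) : simple_sub S ->
  simple_sub (vtop S) /\ forall w, S w -> top_gen (vtop S) w.
Proof.
move=> hS; have [[s Ss s0] _] := hS; have [v v0 Sv] := sub_reaches_top Ss s0.
have max (T : submod V) t : (forall u, T u -> vtop S u) -> T t -> t <> 0 -> forall w, S w -> top_gen T w.
  move=> TS Tt t0; apply: (@simple_sub_max _ _ _ K S (top_gen T) (top t) hS _ (top_gen_top Tt)).
    by apply: top_gen_min => u /TS.
  by move=> e; apply: t0; move: e; rewrite -(linear_fun0 (@top_linear _ _ V)); apply: ftop_inj.
split; last exact: (max (vtop S) v (fun _ h => h) Sv v0).
apply: simple_subP => [|T t TS Tt t0 u Su]; first by exists v.
exact/kac_sub_top/top_gen_sub/(max T t).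
Qed.
End KacSocle.

Section ShiftedVectors.
Variables (C : numClosedFieldType) (n : nat) (g : lieSub C n) (M N : smod g) (a : bool).
Variable (f : shom (pshift a M) N).

Lemma shift_hom_char b chi (t : M) : @char_vector _ _ g b chi M t -> @char_vector _ _ g b chi N (f t).
Proof. by move=> h x bx; rewrite -(shom_act f) /= h // (linear_funZ _ _ (shom_linear f)). Qed.

Lemma shift_hom_par (q : bool) (t : M) : smod_par t = (-1) ^+ q *: t ->
  smod_par (f t) = (-1) ^+ (a (+) q) *: f t.
Proof.
move=> h; rewrite -(shom_par f) /= /pshift_par h !(linear_funZ _ _ (shom_linear f)).
by rewrite scalerA signr_addb.
Qed.
End ShiftedVectors.

Section SimpleQuotient.
Variables (C : numClosedFieldType) (n : nat) (g : lieSub C n).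
Variables (b : set 'M[C]_(n + n)) (chi : 'M[C]_(n + n) -> C).

Definition simple_gen : simple_quo (induced g b chi) := quo_pi (rad (induced g b chi)) (ind_gen g b chi).

Lemma simple_gen_char : @char_vector _ _ g b chi (simple_quo (induced g b chi)) simple_gen.
Proof.
move=> x bx; rewrite -[LHS]/(quo_act x simple_gen) quo_actE ind_gen_char //.
exact: (linear_funZ _ _ (@quo_pi_linear _ _ _ _ (rad (induced g b chi)))).
Qed.
Lemma simple_gen_par : smod_par simple_gen = (-1) ^+ false *: simple_gen.
Proof. by rewrite scale1r -[LHS]/(quo_par simple_gen) quo_parE ind_gen_par. Qed.

Lemma simple_gen_eq0 : simple_gen = 0 -> forall w : simple_quo (induced g b chi), w = 0.
Proof.
move=> e; elim/quo_ind=> w; have [u ->] := @ind_gen_generates _ _ _ b chi w.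
rewrite -[LHS]/(quo_proj (rad (induced g b chi)) _) shom_umod -[quo_proj _ _]/simple_gen e.
exact/linear_fun0/umod_linear.
Qed.
End SimpleQuotient.

Section SocleOfKac.
Variables (C : numClosedFieldType) (n : nat) (V : smod (pe_even C n)).
Variables (v0 : V) (beta : weight C n).
Hypothesis v0_par : smod_par v0 = v0.
Hypothesis v0_char : char_vector (@borel_even C n) (wchar beta) v0.
Hypothesis v0_gen : generates v0.
Local Notation K := (kac V).

Lemma vac_par : smod_par (vac v0 : K) = vac v0.
Proof.
rewrite -{2}v0_par; exact: fpar_vac (@smod_par_linear _ _ _ V).
Qed.

Lemma vac_char : char_vector (@borel C n) (wchar beta) (vac v0 : K).
Proof.
apply/char_borelP; split=> [A uA|B]; last by rewrite kac_e1 O1_vac.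
have /char_evenP h := v0_char.
rewrite kac_e0 O0_vac h //; exact: (linear_funZ _ _ (@fvac_linear _ _ _)).
Qed.

Lemma top_gen_iso nu (T : submod V) (t : V) (q : bool) :
  simple_sub T -> T t -> t <> 0 -> smod_par t = (-1) ^+ q *: t ->
  char_vector (@borel_even C n) (wchar nu) t ->
  exists (r : bool) (f : shom (pshift r (L (wplus nu + eta C n))) K),
    injective f /\ range f = sub_set (top_gen T).
Proof.
(* The twist by c tr(A) subtracts [eta] from every weight. *)
move=> sT Tt t0 pt /char_evenP ct; pose c : C := - (1 - n%:R).
have shiftK (k : weight C n) : k + eta C n + c *: \sum_i eps C i = k.
  by rewrite /eta /c scaleNr addrK.
pose S := top_gen T; have sS : simple_sub S by exact: top_gen_simple.
have sS' : simple_sub (twist_sub c S) by exact: twist_simple.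
have St : twist_sub c S (top t) by exact: top_gen_top.
have top0 : (top t : twist c K) <> 0.
  by move=> e; apply: t0; move: e; rewrite -(linear_fun0 (@top_linear _ _ V)); apply: ftop_inj.
have ptop : smod_par (top t : twist c K) = (-1) ^+ (odd (adim n) (+) q) *: (top t : twist c K).
  rewrite -[LHS]/(kac_par (top t)) kac_par_top pt (linear_funZ _ _ (@top_linear _ _ V)).
  by rewrite scalerA signr_addb signr_odd.
have ctop : @char_vector _ _ _ (@borel_rev C n) (wchar nu) (twist c K) (top t).
  rewrite -[nu]shiftK; apply: twist_char_rev => [A uA|B]; last by rewrite kac_em TH_top.
  rewrite kac_e0 O0_top ct // (linear_funZ _ _ (@top_linear _ _ V)) /eta wtr_shift.
  by rewrite scalerDl.
(* In the twist Lambda^top (x) t has weight nu for the reverse Borel subalgebra, so that S becomes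
   L^r(nu). *)
have [g [gi gr]] := @L_rev_embed _ _ nu (twist c K) (twist_sub c S) (top t) _ sS' St top0 ptop ctop.
have pvac : smod_par (vac v0 : twist c K) = (-1) ^+ false *: (vac v0 : twist c K).
  by rewrite scale1r; apply: vac_par.
have cvac : @char_vector _ _ _ (@borel C n) (wchar (beta + c *: \sum_i eps C i)) (twist c K) (vac v0).
  exact: (proj1 (@twist_char _ _ c K _ _) vac_char).
have gvac : @generates _ _ _ (twist c K) (vac v0).
  apply: (@twist_generates _ _ c K (vac v0) false); last exact: vac_generates.
  by rewrite scale1r; apply: vac_par.
(* A singular vector for [borel] exhibits S as some L(k) too; this k is the witness that makes the
   choice in [wplus nu] a genuine one. *)
have [w [k [r [Sw w0 pw cw]]]] := exists_borel_singular pvac cvac gvac St top0.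
have [h [hi hr]] := L_embed sS' Sw w0 pw cw.
have [p [phi [phi' phiK phiK']]] : smod_iso (L (wplus nu)) (L_rev nu).
  apply: (@xgetPex _ 0 [set nu' | smod_iso (L nu') (L_rev nu)]%classic).
  by exists k; apply: iso_of_ranges hi hr gi gr.
(* The highest weight vector of L(nu^+) is carried into S, where after removal of the twist it has
   weight nu^+ + eta. *)
pose x0 := simple_gen (pe C n) (@borel C n) (wchar (wplus nu)).
pose t' : twist c K := g (phi x0).
have ct' : @char_vector _ _ _ (@borel C n) (wchar (wplus nu)) (twist c K) t'.
  by apply: shift_hom_char; apply: shift_hom_char; apply: simple_gen_char.
have pt' : smod_par t' = (-1) ^+ (odd (adim n) (+) q (+) (p (+) false)) *: t'.
  by apply: shift_hom_par; apply: shift_hom_par; apply: simple_gen_par.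
have St' : twist_sub c S t' by rewrite -gr; exists (phi x0).
have t'0 : t' <> 0.
  move=> e; apply: top0; have : range g (top t) by rewrite gr.
  move=> [y _ <-]; rewrite -[y]phiK' [phi' y](@simple_gen_eq0 _ _ (pe C n) (@borel C n) (wchar (wplus nu))).
    by rewrite (linear_fun0 (shom_linear phi)) (linear_fun0 (shom_linear g)).
  rewrite -/x0 -[x0]phiK (_ : phi x0 = 0); last first.
    by apply: gi; rewrite -/t' e (linear_fun0 (shom_linear g)).
  by rewrite -[RHS]phiK (linear_fun0 (shom_linear phi)).
exists (odd (adim n) (+) q (+) (p (+) false)).
apply: (@L_embed _ _ (wplus nu + eta C n) K S t') => //.
by apply: (proj2 (@twist_char _ _ c K _ _)); rewrite shiftK.
Qed.

Variables (I : finType) (nu : I -> weight C n) (m : I -> nat).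

(** The summands correspond one by one: the image T k of the k-th summand is simple, and the new
    k-th summand maps onto [top_gen (T k)]. Injectivity rests on the independence of the K(T k),
    surjectivity on every simple submodule of K(V) being generated by its part in Lambda^top (x)
    V. *)
Lemma kac_socle : sub_iso_dsum (soc V) (fun z => L_even (nu z)) m ->
  sub_iso_dsum (soc K) (fun z => L (wplus (nu z) + eta C n)) m.
Proof.
move=> [p [phi0 [phi_inj phi_range]]].
pose F (k : {z : I & 'I_(m z)}) : smod (pe_even C n) := pshift (p k) (L_even (nu (tag k))).
pose j k : shom (F k) V := shom_comp phi0 (dinj F k).
have jE k x : j k x = phi0 (dinj F k x) by [].
have j_inj k : injective (j k).
  by move=> x y /phi_inj e; rewrite -(dinj_same x) -(dinj_same y) -[dinj_fun x]/(dinj F k x) e.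
pose T k := im_submod (j k).
pose x0 k := simple_gen (pe_even C n) (@borel_even C n) (wchar (nu (tag k))) : F k.
have x0_neq0 k : x0 k <> 0.
  have := @rad_even_not_top C n (nu (tag k)) (@verma_neq0 _ _ _).
  move=> nr e; apply: nr; move: e; rewrite -[0]/(quo_pi (rad (Delta_even (nu (tag k)))) 0).
  by move/quo_piP; rewrite subr0.
have u0 k : j k (x0 k) <> 0.
  by move=> e; apply: (x0_neq0 k); apply: j_inj; rewrite e (linear_fun0 (shom_linear (j k))).
have Tu k : T k (j k (x0 k)) by exists (x0 k).
have sT k : simple_sub (T k).
  apply: simple_subP; first by exists (j k (x0 k)).
  move=> S t ST St t0 _ [y _ <-]; have [s _ es] := ST _ St.
  have s0 : s <> 0 by move=> e; apply: t0; rewrite -es e (linear_fun0 (shom_linear (j k))).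
  pose S' := @unshift_submod _ _ _ (p k) (L_even (nu (tag k))) (preim_submod (j k) S).
  have Ss : S (j k s) by rewrite es.
  exact: (@simple_quo_sub _ _ _ _ S' s Ss s0 y).
have ex k : exists (r : bool) (f : shom (pshift r (L (wplus (nu (tag k)) + eta C n))) K),
    injective f /\ range f = sub_set (top_gen (T k)).
  apply: (@top_gen_iso _ (T k) (j k (x0 k)) (p k (+) false)) => //.
    exact: (@shift_hom_par _ _ _ _ _ (p k) (j k) false _ (@simple_gen_par _ _ _ _ _)).
  exact: (@shift_hom_char _ _ _ _ _ (p k) (j k) _ _ _ (@simple_gen_char _ _ _ _ _)).
pose r k := projT1 (cid (ex k)).
pose psi k : shom (pshift (r k) (L (wplus (nu (tag k)) + eta C n))) K := projT1 (cid (projT2 (cid (ex k)))).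
have psiP k : injective (psi k) /\ range (psi k) = sub_set (top_gen (T k)).
  exact: (projT2 (cid (projT2 (cid (ex k))))).
have psi_in k x : fall (T k) (psi k x).
  apply: top_gen_sub; have [_ e] := psiP k.
  by change (sub_set (top_gen (T k)) (psi k x)); rewrite -e; exists x.
(* The T k are independent in V because [phi0] is injective on the direct sum. *)
have indep (x : {z : I & 'I_(m z)} -> V) : (forall k, T k (x k)) -> \sum_k x k = 0 -> forall k, x k = 0.
  move=> Tx x_sum k; have ey l : exists y : F l, j l y = x l by have [y _ <-] := Tx l; exists y.
  pose y l := projT1 (cid (ey l)); have yE l : j l (y l) = x l := projT2 (cid (ey l)).
  have : phi0 (\sum_l dinj F l (y l)) = phi0 0.
    rewrite (linear_fun_sum _ _ _ (shom_linear phi0)) (linear_fun0 (shom_linear phi0)) -[RHS]x_sum.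
    by apply: eq_bigr => l _; rewrite -yE.
  move/phi_inj => e; rewrite -yE -(dinj_same (y k)).
  have -> : y k = 0; last by rewrite dinj_same (linear_fun0 (shom_linear (j k))).
  have := congr1 (fun u : dsum F => u k) e; rewrite dsumE (bigD1 k) //= dinj_same big1 ?addr0 //.
  by move=> l lk; rewrite dinj_diff //; apply/eqP.
exists r, (dsum_hom psi); split.
  move=> u v e; apply: functional_extensionality_dep => k; have [ik _] := psiP k; apply: ik.
  apply/eqP; rewrite -subr_eq0; apply/eqP; move: k.
  apply: (fall_independent indep) => [k|].
    by rewrite (linear_funB _ _ (shom_linear (psi k))); apply: psi_in.
  by rewrite sumrB; apply/eqP; rewrite subr_eq0; apply/eqP.
apply: sub_eqP (im_submod (dsum_hom psi)) (soc K) _ => w; split=> [[u _ <-]|].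
  apply: sub_sum => k _ S; apply; exists (top_gen (T k)); first exact: top_gen_simple.
  by have [_ <-] := psiP k; exists (u k).
apply=> {}w [S sS Sw]; have [sV SG] := simple_top_gen sS.
move: w Sw {SG} (SG w Sw) => w _; apply: top_gen_min => v Sv.
have : soc V v by move=> N; apply; exists (vtop S).
rewrite -[soc V v]/(sub_set (soc V) v) -phi_range => -[u _ <-].
rewrite (dsum_decomposition u) (linear_fun_sum _ _ _ (shom_linear phi0)).
rewrite (linear_fun_sum _ _ _ (@top_linear _ _ V)); apply: sub_sum => k _.
have : top_gen (T k) (top (phi0 (dinj F k (u k)))) by apply: top_gen_top; exists (u k).
have [_ e] := psiP k; rewrite -[top_gen _ _]/(sub_set (top_gen (T k)) _) -e => -[x _ <-].
exists (dinj _ k x) => //; rewrite /= /dsum_hom_fun (bigD1 k) //= dinj_same big1 ?addr0 // => l lk.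
by rewrite dinj_diff ?(linear_fun0 (shom_linear _)) //; apply/eqP; rewrite eq_sym.
Qed.
End SocleOfKac.

(** * Cokernels of homomorphisms of Verma modules *)

Section IdentityAndTransport.
Variables (C : numClosedFieldType) (n : nat) (g : lieSub C n).
Implicit Types M N : smod g.

Definition shom_id M : shom M M :=
  @SHom _ _ _ M M (fun v => v) (fun _ _ _ => erefl) (fun _ _ => erefl) (fun _ => erefl).

Lemma generates_quo M (S : submod M) (v : M) : generates v -> generates (quo_proj S v).
Proof.
by move=> gv; elim/quo_ind=> w; have [u ->] := gv w; exists u; rewrite -shom_umod.
Qed.

Lemma shift_im_generated (a : bool) M N (f : shom (pshift a M) N) (v : M) w :
  generates v -> im_submod f w -> exists u, w = umod u (f v).
Proof.
move=> gv [y _ <-]; have [u ->] := gv y; exists u.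
by rewrite -(shom_umod f) umod_pshift.
Qed.

Lemma sub_iso_dsum_transport M N (B : shom M N) (A : shom N M) : cancel B A -> cancel A B ->
  forall (I : finType) (F : I -> smod g) (m : I -> nat),
  sub_iso_dsum (soc M) F m -> sub_iso_dsum (soc N) F m.
Proof.
move=> BK AK I F m [p [phi [phi_inj phi_range]]].
exists p, (shom_comp B phi); split; first by move=> u v /(can_inj BK) /phi_inj.
apply: (sub_eqP (S := im_submod (shom_comp B phi))) => w; split=> [[u _ <-]|Sw].
  by apply: (soc_iso BK AK); change (sub_set (soc M) (phi u)); rewrite -phi_range; exists u.
have : sub_set (soc M) (A w) by apply: (soc_iso AK BK).
by rewrite -phi_range => -[u _ e]; exists u => //=; rewrite e AK.
Qed.
End IdentityAndTransport.

Section Frobenius.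
Variables (C : numClosedFieldType) (n : nat).

Section Killed.
Variable M : smod (pe C n).
(** The invariants of g_1. They form a gl(n)-submodule, so a map from a cyclic module lands in them
    as soon as the generator does. *)
Definition killed_set (v : restriction M) := forall B, smod_act (e1 B) (v : M) = 0.
Lemma killed0 : killed_set 0.
Proof. by move=> B; exact: (linear_fun0 (@smod_act_linear _ _ _ M _)). Qed.
Lemma killedP (c : C) u v : killed_set u -> killed_set v -> killed_set (c *: u + v).
Proof. by move=> hu hv B; rewrite (@smod_act_linear _ _ _ M) hu hv scaler0 addr0. Qed.
Lemma killed_par v : killed_set v -> killed_set (smod_par v).
Proof.
move=> hv B; have := @smod_act_par _ _ _ M true (e1 B) v (mx1_homog B).
rewrite hv (linear_fun0 (@smod_par_linear _ _ _ M)) scaleN1r => /esym /eqP.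
by rewrite oppr_eq0 => /eqP.
Qed.
Lemma killed_act x v : killed_set v -> killed_set (smod_act x v).
Proof.
move=> hv B; rewrite act_pe_even restriction_z0; set A := ulsubmx _.
have := act01 A B (v : M); rewrite !hv (linear_fun0 (@smod_act_linear _ _ _ M _)) sub0r => /esym /eqP.
by rewrite oppr_eq0 => /eqP.
Qed.
Definition killed : submod (restriction M) := SubMod killed0 killedP killed_par killed_act.
End Killed.

Lemma kac_hom (V : smod (pe_even C n)) (v0 : V) (M : smod (pe C n)) (phi : shom V (restriction M)) :
  generates v0 -> killed M (phi v0) -> exists F : shom (kac V) M, forall v, F (vac v) = phi v.
Proof.
move=> gv kv; apply: (@kac_extend _ _ V M phi) => [|A v|v|B v].
- exact: (shom_linear phi).
- by rewrite shom_act restriction_z0.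
- exact: (shom_par phi).
- exact: (@generates_sub _ _ _ V v0 (preim_submod phi (killed M)) gv kv v B).
Qed.

Definition res_hom (M N : smod (pe C n)) (f : shom M N) : shom (restriction M) (restriction N) :=
  @SHom _ _ _ (restriction M) (restriction N) f (shom_linear f)
    (fun x v => shom_act f (even_incl x) v) (shom_par f).

Lemma vac_act_in (V : smod (pe_even C n)) x (v : V) :
  (vac (smod_act x v) : restriction (kac V)) = smod_act x (vac v : restriction (kac V)).
Proof. by rewrite act_pe_even [RHS]act_pe_even restriction_z0 kac_e0 O0_vac. Qed.
Lemma vac_par_in (V : smod (pe_even C n)) (v : V) :
  (vac (smod_par v) : restriction (kac V)) = smod_par (vac v : restriction (kac V)).
Proof. by apply/esym/fpar_vac/smod_par_linear. Qed.
Definition vac_hom (V : smod (pe_even C n)) : shom V (restriction (kac V)) :=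
  @SHom _ _ _ V (restriction (kac V)) (@vac _ _ V) (@fvac_linear _ _ _)
    (@vac_act_in V) (@vac_par_in V).
End Frobenius.

Section CentralElement.
Variables (C : numClosedFieldType) (n : nat) (V : smod (pe_even C n)) (s : C).

(** The identity matrix is central in gl(n), so its eigenspaces are submodules; one that contains a
    generator is the whole of V. *)
Definition scalar_set (v : V) := smod_act (z0 1%:M) v = s *: v.
Lemma scalar0 : scalar_set 0.
Proof. by rewrite /scalar_set scaler0; apply/linear_fun0/smod_act_linear. Qed.
Lemma scalarP (c : C) u v : scalar_set u -> scalar_set v -> scalar_set (c *: u + v).
Proof. by rewrite /scalar_set smod_act_linear => -> ->; rewrite scalerDr !scalerA mulrC. Qed.
Lemma scalar_par v : scalar_set v -> scalar_set (smod_par v).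
Proof. by rewrite /scalar_set -actz_par => ->; apply/linear_funZ/smod_par_linear. Qed.
Lemma scalar_act x v : scalar_set v -> scalar_set (smod_act x v).
Proof.
rewrite /scalar_set (act_pe_even x) => h; set A := ulsubmx _.
have := actzz 1%:M A v; rewrite mul1mx mulmx1 subrr (linear_fun0 (actz_linear v)) => /esym /eqP.
by rewrite subr_eq0 => /eqP ->; rewrite h; apply/linear_funZ/smod_act_linear.
Qed.
Definition scalar_submod : submod V := SubMod scalar0 scalarP scalar_par scalar_act.

(* The identity matrix acts on Lambda^d(g_{-1}) (x) V by s - 2 d. *)
Lemma degree0_vac (v0 : V) (w : kac V) : generates v0 -> scalar_submod v0 ->
  smod_act (e0 1%:M) w = s *: w -> exists v, w = vac v.
Proof.
move=> gv sv; rewrite kac_e0 O0E endoDE /MA (Mp_scalar (c := s)); last first.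
  exact: (@generates_sub _ _ _ V v0 scalar_submod gv sv).
have -> : \sum_j TH V (adm 1%:M (abase C (apr j))) * Dl V (adim n) j =
    (- 2%:R) *: \sum_(j < adim n) (Th V (adim n) j * Dl V (adim n) j).
  rewrite scaler_sumr; apply: eq_bigr => j _; rewrite /adm trmx1 mul1mx mulmx1 -mulr2n.
  rewrite THN -scaler_nat (linear_funZ _ _ (@TH_linear _ _ V)) TH_base.
  by rewrite -scaleNr endo_scalerAl.
rewrite endoZE -{2}[s *: w]addr0 => /addrI /eqP.
rewrite scaler_eq0 oppr_eq0 pnatr_eq0 => /eqP e.
by apply: (@fock_number _ _ _ 0); rewrite e oppr0 scale0r.
Qed.
End CentralElement.

Section Cokernel.
Variables (C : numClosedFieldType) (n : nat) (lam gam : weight C n) (a : bool).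
Variable f : shom (pshift a (Delta gam)) (Delta lam).
Hypothesis f_neq0 : exists v, f v <> 0.
Variable f0 : shom (Delta_even gam) (Delta_even lam).
Hypothesis f0_inj : injective f0.
Hypothesis same_trace : \sum_i gam 0 i = \sum_i lam 0 i.

Local Notation E := (Delta_even lam).
Local Notation vE := (ind_gen (pe_even C n) (@borel_even C n) (wchar lam)).
Local Notation vE' := (ind_gen (pe_even C n) (@borel_even C n) (wchar gam)).
Local Notation vD := (ind_gen (pe C n) (@borel C n) (wchar lam)).
Local Notation vD' := (ind_gen (pe C n) (@borel C n) (wchar gam) : Delta gam).

Lemma wtr1 k : wtr k (1%:M : 'M[C]_n) = \sum_i k 0 i.
Proof. by apply: eq_bigr => i _; rewrite mxE eqxx mulr1. Qed.
Lemma upmx1 : upmx (1%:M : 'M[C]_n).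
Proof. by move=> i j ji; rewrite mxE; case: eqP => // e; rewrite e ltnn in ji. Qed.

Lemma verma_restriction : exists phi : shom E (restriction (Delta lam)), phi vE = vD.
Proof.
apply: (@ind_hom _ _ _ _ _ (restriction (Delta lam)) vD); first exact: ind_gen_par.
apply/char_evenP => A uA; rewrite restriction_z0.
by have /char_borelP [h _] := @ind_gen_char _ _ (pe C n) (@borel C n) (wchar lam); apply: h.
Qed.

(** Delta(lambda) is compared with the Kac module of the even Verma module: as R P is the identity,
    P is injective and y can be studied through P y. There [same_trace] makes the identity matrix
    act by the scalar of degree 0. *)
Lemma singular_degree0 (phi : shom E (restriction (Delta lam))) : phi vE = vD ->
  exists w0, [/\ f vD' = phi w0, w0 <> 0 &
    char_vector (@borel_even C n) (wchar gam) w0].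
Proof.
move=> phiE; have killed_vD : killed (Delta lam) vD.
  by have /char_borelP [_ h] := @ind_gen_char _ _ (pe C n) (@borel C n) (wchar lam).
have gE : generates vE by exact: ind_gen_generates.
have [R RE] : exists R : shom (kac E) (Delta lam), forall v, R (vac v) = phi v.
  by apply: kac_hom gE _; rewrite phiE.
have [P PE] : exists P : shom (Delta lam) (kac E), P vD = vac vE.
  apply: ind_hom; first by apply: vac_par; apply: ind_gen_par.
  by apply: vac_char; apply: ind_gen_char.
have RP w : R (P w) = w.
  have gD : generates vD by exact: ind_gen_generates.
  by apply: (eq_hom_gen (f := shom_comp R P) (h := shom_id _) gD); rewrite /= PE RE phiE.
set y := f vD'; have cy : char_vector (@borel C n) (wchar gam) (P y).
  move=> x bx; rewrite -shom_act.
  rewrite (shift_hom_char f (@ind_gen_char _ _ (pe C n) (@borel C n) (wchar gam)) bx).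
  exact: (linear_funZ _ _ (shom_linear P)).
have y0 : y <> 0.
  move=> y0; have [v] := f_neq0; apply.
  have : im_submod f (f v) by exists v.
  have gD' : generates vD' by exact: ind_gen_generates.
  by move=> /(shift_im_generated gD') [u ->]; rewrite -/y y0; apply/linear_fun0/umod_linear.
have /char_borelP [c0 c1] := cy.
have [w0 ew0] : exists w0, P y = vac w0.
  apply: (degree0_vac (s := \sum_i lam 0 i) gE).
    have /char_evenP h := @ind_gen_char _ _ (pe_even C n) (@borel_even C n) (wchar lam).
    by have := h _ upmx1; rewrite wtr1.
  by rewrite c0 ?wtr1 ?same_trace //; apply: upmx1.
exists w0; split; first by rewrite -RE -ew0 RP.
  by move=> e; apply: y0; rewrite -[y]RP ew0 e RE (linear_fun0 (shom_linear phi)).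
apply/char_evenP => A uA; apply: (@fvac_inj C E (adim n)).
rewrite (linear_funZ _ _ (@fvac_linear _ _ _)) -[fvac _ w0]/(vac w0) -ew0 -c0 // kac_e0 ew0.
by rewrite O0_vac.
Qed.

(** The vectors w0, obtained from f, and w1, obtained from f0, are singular of the same weight in
    one Verma module, so each is a multiple of the other. One relation makes A' vanish on the image
    of f, the other makes [qphi] vanish on the image of f0. The induced maps A and B exchange the
    generators and are therefore inverse to each other. *)
Lemma coker_kac : exists (B : shom (kac (coker f0)) (coker f)) (A : shom (coker f) (kac (coker f0))),
  cancel B A /\ cancel A B.
Proof.
have [phi phiE] := verma_restriction.
have [w0 [fE w0_neq0 w0_char]] := singular_degree0 phiE.
pose w1 : E := f0 vE'.
have w1_char : char_vector (@borel_even C n) (wchar gam) w1.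
  move=> x bx; rewrite -shom_act ind_gen_char //; exact: (linear_funZ _ _ (shom_linear f0)).
have w1_neq0 : w1 <> 0.
  move=> e; apply: (@verma_neq0 C n gam); apply: f0_inj.
  by rewrite -/w1 e (linear_fun0 (shom_linear f0)).
have [c ec] := verma_singular_unique w0_char w1_char w0_neq0.
have [d ed] := verma_singular_unique w1_char w0_char w1_neq0.
have gE : generates vE by exact: ind_gen_generates.
have gE' : generates vE' by exact: ind_gen_generates.
have gD : generates vD by exact: ind_gen_generates.
have gD' : generates vD' by exact: ind_gen_generates.
pose V := coker f0; pose pr : shom E V := quo_proj (im_submod f0).
pose qr : shom (Delta lam) (coker f) := quo_proj (im_submod f).
have prw0 : pr w0 = 0.
  rewrite ed (linear_funZ _ _ (shom_linear pr)) [X in _ *: X](_ : _ = 0) ?scaler0 //.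
  by apply/(quo_piP (im_submod f0) w1 0); rewrite subr0; exists vE'.
have qrf : qr (f vD') = 0.
  by apply/(quo_piP (im_submod f) (f vD') 0); rewrite subr0; exists vD'.
have gV : generates (pr vE) by exact: generates_quo.
have pV : smod_par (pr vE) = pr vE by rewrite -shom_par ind_gen_par.
have cV : char_vector (@borel_even C n) (wchar lam) (pr vE).
  move=> x bx; rewrite -shom_act ind_gen_char //; exact: (linear_funZ _ _ (shom_linear pr)).
have [A' A'E] : exists A' : shom (Delta lam) (kac V), A' vD = vac (pr vE).
  by apply: ind_hom; [apply: vac_par|apply: vac_char].
have A'phi w : A' (phi w) = vac (pr w).
  apply: (eq_hom_gen (f := shom_comp (res_hom A') phi) (h := shom_comp (vac_hom V) pr) gE).
  by rewrite /= phiE A'E.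
have A'f v : im_submod f v -> A' v = 0.
  move=> /(shift_im_generated gD') [u ->].
  rewrite shom_umod fE A'phi prw0 [vac 0](linear_fun0 (@fvac_linear _ _ _)).
  exact: (linear_fun0 (@umod_linear _ _ _ (kac V) u)).
pose A : shom (coker f) (kac V) := quo_hom A'f.
pose qphi : shom E (restriction (coker f)) := shom_comp (res_hom qr) phi.
have qphi0 v : im_submod f0 v -> qphi v = 0.
  move=> [y _ <-]; have [u ->] := gE' y; rewrite shom_umod -/w1 shom_umod.
  have -> : qphi w1 = 0; last exact/linear_fun0/umod_linear.
  rewrite ec (linear_funZ _ _ (shom_linear qphi)) (_ : qphi w0 = 0) ?scaler0 //.
  by rewrite /= -fE.
pose phiV : shom V (restriction (coker f)) := quo_hom qphi0.
have phiVE w : phiV (pr w) = qr (phi w) by exact: (quo_homE qphi0).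
have [B BE] : exists B : shom (kac V) (coker f), forall v, B (vac v) = phiV v.
  apply: kac_hom gV _ => b; rewrite phiVE phiE -(shom_act qr).
  have /char_borelP [_ ->] := @ind_gen_char _ _ (pe C n) (@borel C n) (wchar lam).
  exact/linear_fun0/(shom_linear qr).
exists B, A; split=> [w|q].
  apply: (eq_hom_gen (f := shom_comp A B) (h := shom_id _) (vac_generates gV)).
  by rewrite /= BE phiVE phiE; apply: (etrans (quo_homE A'f vD) A'E).
apply: (eq_hom_gen (f := shom_comp B A) (h := shom_id _) (generates_quo (S := im_submod f) gD)).
by rewrite /= [X in B X](etrans (quo_homE A'f vD) A'E) BE phiVE phiE.
Qed.

Lemma coker_gen_data : exists v0 : coker f0,
  [/\ smod_par v0 = v0, char_vector (@borel_even C n) (wchar lam) v0 & generates v0].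
Proof.
pose pr : shom E (coker f0) := quo_proj (im_submod f0).
exists (pr vE); split; first by rewrite -shom_par ind_gen_par.
  move=> x bx; rewrite -shom_act ind_gen_char //; exact: (linear_funZ _ _ (shom_linear pr)).
apply: generates_quo; exact: ind_gen_generates.
Qed.

Lemma coker_socle (I : finType) (nu : I -> weight C n) (m : I -> nat) :
  sub_iso_dsum (soc (coker f0)) (fun z => L_even (nu z)) m ->
  sub_iso_dsum (soc (coker f)) (fun z => L (wplus (nu z) + eta C n)) m.
Proof.
have [B [A [BK AK]]] := coker_kac; have [v0 [p0 c0 g0]] := coker_gen_data.
by move=> /(kac_socle p0 c0 g0); apply: (sub_iso_dsum_transport BK AK).
Qed.
End Cokernel.

(** W permutes coordinates and the two shifts by [rho_even] cancel. Applied to gamma and lambda,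
    this is the equality of coordinate sums that forces degree 0. *)
Lemma sum_dot (C : numClosedFieldType) (n : nat) (w : 'S_n) (mu : weight C n) :
  \sum_i dot w mu 0 i = \sum_i mu 0 i.
Proof.
have sum_wact k : \sum_i wact w k 0 i = \sum_i k 0 i.
  under eq_bigr do rewrite summxE; rewrite exchange_big; apply: eq_bigr => i _ /=.
  rewrite (bigD1 (w i)) //= mxE eps_eval eqxx mulr1 big1 ?addr0 // => j ji.
  by rewrite mxE eps_eval eq_sym (negbTE ji) mulr0.
have sumD (k l : weight C n) : \sum_i (k + l) 0 i = \sum_i k 0 i + \sum_i l 0 i.
  by rewrite -big_split; apply: eq_bigr => i _; rewrite mxE.
by rewrite sumD sum_wact sumD -addrA -sumD subrr [X in _ + X]big1 ?addr0 // => i _; rewrite mxE.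
Qed.

Theorem theorem7 (R : realType) (n : nat) (lam gam mu : weight R[i] n)
  (lam_integral : integral lam) (gam_integral : integral gam)
  (a : bool) (f : shom (pshift a (Delta gam)) (Delta lam))
  (f_neq0 : exists v, f v <> 0)
  (mu_dominant : dominant mu) (x y : 'S_n) (x_lt_y : bruhat_lt x y)
  (lamE : lam = dot x mu) (gamE : gam = dot y mu)
  (f0 : shom (Delta_even (dot y mu)) (Delta_even (dot x mu)))
  (f0_inj : injective f0)
  (m : 'S_n -> nat)
  (soc_even : sub_iso_dsum (soc (coker f0)) (fun z => L_even (dot z mu)) m) :
  sub_iso_dsum (soc (coker f)) (fun z => L (wplus (dot z mu) + eta _ _)) m.
Proof.
subst lam gam; apply: (coker_socle f_neq0 f0_inj) soc_even.
by rewrite !sum_dot.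
Qed.
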